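(* Let $X$ be a Fano variety over a perfect field $k$ of characteristic $p>0$. Suppose that $X$ admits an int-amplified endomorphism of degree prime to $p$. If $X$ is strongly $F$-regular (for example, smooth), then $X$ is globally $F$-regular.
   Context: A Fano variety is a normal projective variety $X$ such that $-K_X$ is an ample Weil divisor, where a Weil divisor (with integer coefficients) is called ample if some positive multiple of it is an ample Cartier divisor. An endomorphism $f\colon X\to X$ (a morphism over $k$) is int-amplified if there is an ample Cartier divisor $H$ on $X$ such that $f^*H-H$ is ample. Let $F$ denote the absolute Frobenius morphism. A normal variety $X$ over a perfect field of characteristic $p>0$ is globally $F$-regular if for every effective Weil divisor $D$ on $X$ there is a positive integer $e$ such that the composite map \[ \mathcal{O}_X\to F^e_*\mathcal{O}_X\hookrightarrow F^e_*(\mathcal{O}_X(D)) \] splits as a homomorphism of $\mathcal{O}_X$-modules. $X$ is strongly $F$-regular if it is covered by open subsets that are globally $F$-regular. *)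

(* Defs.v *)
From HB Require Import structures.
From mathcomp Require Import all_boot all_order all_algebra.
From mathcomp Require Import boolp classical_sets functions cardinality.

Set Implicit Arguments.
Unset Strict Implicit.
Unset Printing Implicit Defensive.

Import GRing.Theory.

Local Open Scope classical_set_scope.
Local Open Scope ring_scope.

(* Conventions.  A variety over k is an integral separated scheme of finite
   type over k.  An integral separated scheme is encoded a la Chevalley-Zariski
   (EGA I, section 8), as a set of local subrings of its function field K:
   x |-> O_{X,x} is injective, so that points *are* subrings of K, the structure
   sheaf is O_X(U) = \bigcap_(x in U) O_{X,x} for U nonempty, and specialization
   is inclusion of local rings.  The generic point is K itself. *)

Section Subrings.
Variable K : fieldType.
Implicit Types (A P O E : set K) (f : K).

Definition prime_ideal A P :=
  [/\ P `<=` A /\ P 0,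
      forall a b, P a -> P b -> P (a + b),
      forall a b, A a -> P b -> P (a * b),
      ~ P 1
    & forall a b, A a -> A b -> P (a * b) -> P a \/ P b].

Definition localization A P : set K :=
  [set z | exists a b, [/\ A a, A b, ~ P b & z = a / b]].

Definition unit_in O f := [/\ f != 0, O f & O f^-1].

Definition nonunits O : set K := [set f | O f /\ ~ unit_in O f].

Definition int_closed A :=
  forall z (q : {poly K}),
    q \is monic -> q \is a polyOver (mem A) -> root q z -> A z.

(* For O local: Krull dimension 1. *)
Definition dim1_local O :=
  O <> setT /\
  forall P, prime_ideal O P -> P = [set 0] \/ P = nonunits O.

Definition uniformizer O t :=
  O t /\ nonunits O = [set t * z | z in O].

(* The normalized valuation of a discrete valuation ring E with fraction
   field K; only meaningful at f != 0. *)
Definition vord E f : int :=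
  xget 0 [set m : int |
    exists t u, [/\ uniformizer E t, unit_in E u & f = u * t ^ m]].

End Subrings.

(* A closed integral subscheme X of P^n_k with function field K is given by the
   point [x_0 : ... : x_n] of P^n(K) through which Spec K -> P^n_k factors; the
   chart X_i != 0 is Spec k[x_j / x_i : j], and is empty when x_i = 0. *)
Definition chart (k K : fieldType) (iota : k -> K) n (x : 'I_n.+1 -> K) i :
    set K :=
  smallest (fun A : set K => subring_closed (mem A))
           (range iota `|` range (fun j => x j / x i)).

Record projVariety (k : fieldType) := ProjVariety {
  funField :> fieldType;
  constants : {rmorphism k -> funField};
  ambientDim : nat;
  hcoord : 'I_ambientDim.+1 -> funField;
  hcoord_frac : exists2 i, hcoord i != 0 &
    forall z, exists a b, [/\ chart constants hcoord i a,
      chart constants hcoord i b, b != 0 & z = a / b] }.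

Arguments constants {k}.
Arguments hcoord {k}.

Section Varieties.
Variables (k : fieldType) (X : projVariety k).
Implicit Types (O E : set X) (U V W : set (set X)) (D H C : set X -> int).

Definition points : set (set X) :=
  [set O | exists i P, [/\ hcoord X i != 0,
     prime_ideal (chart (constants X) (hcoord X) i) P &
     O = localization (chart (constants X) (hcoord X) i) P]].

(* The sets { O | s `<=` O }, for s a finite set of rational functions, form a
   basis of the Zariski topology: { O | f \in O } is the domain of definition
   of f, and the basic open D(b) of the chart k[x_j / x_i : j] is obtained from
   s = { x_j / x_i : j } together with 1 / b. *)
Definition open_in U :=
  U `<=` points /\
  forall O, U O -> exists s : seq X, [set` s] `<=` O /\
    forall O', points O' -> [set` s] `<=` O' -> U O'.

Definition regular_on U : set X := \bigcap_(O in U) O.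

Definition affine_open U :=
  open_in U /\
  U = [set localization (regular_on U) P | P in prime_ideal (regular_on U)].

Definition normal_variety := forall O, points O -> int_closed O.

(* A prime divisor is identified with its generic point.  Divisors are only
   meaningful on a normal X, where the local ring E is then a DVR. *)
Definition prime_divisor E := points E /\ dim1_local E.

(* A divisor is a function on all subrings of K, of which only the values at
   prime divisors (of the open subset W under consideration) matter. *)
Definition weil_divisor W D :=
  finite_set [set E | [/\ W E, prime_divisor E & D E != 0]].

Definition effective W D := forall E, W E -> prime_divisor E -> 0 <= D E.

(* Gamma(U, O_X(D)), for U a nonempty open. *)
Definition sections D U : set X :=
  [set s | s = 0 \/ forall E, U E -> prime_divisor E -> 0 <= vord E s + D E].

Definition local_equation D O h :=
  h != 0 /\ exists U, [/\ open_in U, U O &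
    forall E, U E -> prime_divisor E -> D E = vord E h].

Definition cartier D :=
  weil_divisor points D /\
  forall O, points O -> exists h, local_equation D O h.

(* For s a nonzero global section of O_X(D), D Cartier: the open set X_s where
   s generates O_X(D), i.e. the complement of the support of div(s) + D. *)
Definition nonvanishing D (s : X) : set (set X) :=
  [set O | points O /\
    forall E, prime_divisor E -> O `<=` E -> vord E s + D E = 0].

(* Ampleness of the invertible sheaf O_X(D), as in EGA II, 4.5 and Hartshorne,
   II.7: the affine X_s, s a section of a positive power, cover X. *)
Definition ample_cartier D :=
  cartier D /\
  forall O, points O -> exists n s, [/\ (0 < n)%N, s != 0,
    sections (D *+ n) points s,
    nonvanishing (D *+ n) s O & affine_open (nonvanishing (D *+ n) s)].

Definition ample_weil D :=
  weil_divisor points D /\ exists2 m, (0 < m)%N & ample_cartier (D *+ m).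

Definition derivation (M : lmodType X) (d : X -> M) :=
  [/\ forall a b, d (a + b) = d a + d b,
      forall a b, d (a * b) = a *: d b + b *: d a
    & forall c, d (constants X c) = 0].

(* d : K -> K^n is a universal derivation, i.e. identifies the module of
   Kaehler differentials of K over k with K^n. *)
Definition universal_derivation n (d : X -> 'rV[X]_n) :=
  derivation d /\
  forall (M : lmodType X) (delta : X -> M), derivation delta ->
    exists h : {linear 'rV[X]_n -> M}, (forall a, delta a = h (d a)) /\
      forall h' : {linear 'rV[X]_n -> M},
        (forall a, delta a = h' (d a)) -> forall v, h' v = h v.

(* dt_1 /\ ... /\ dt_n, the top exterior power of K^n being identified with K
   by the determinant. *)
Definition dwedge n (d : X -> 'rV[X]_n) (t : 'I_n -> X) : X :=
  \det (\matrix_(i < n) d (t i)).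

(* dt_1, ..., dt_n is a basis of the differentials of E over k.  For E a
   discrete valuation ring of X and k perfect, these differentials form a free
   E-module, which is thus the E-submodule of K^n generated by d(E). *)
Definition local_coordinates n (d : X -> 'rV[X]_n) E (t : 'I_n -> X) :=
  [/\ forall i, E (t i), dwedge d t != 0 &
      forall a, E a -> exists2 c : 'I_n -> X,
        forall i, E (c i) & d a = \sum_(i < n) c i *: d (t i)].

(* C = div(omega) for a nonzero rational top form omega (corresponding to w):
   locally at E, omega = g dt_1 /\ ... /\ dt_n and C E = v_E(g). *)
Definition canonical_divisor C :=
  weil_divisor points C /\
  exists n (d : X -> 'rV[X]_n) (w : X),
    [/\ universal_derivation d, w != 0 &
     forall E, prime_divisor E -> exists t g,
       [/\ local_coordinates d E t, w = g * dwedge d t & C E = vord E g]].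

Definition fano :=
  normal_variety /\ exists2 C, canonical_divisor C & ample_weil (- C).

Definition dominates (phi : X -> X) O O' :=
  forall z, O' z -> O (phi z) /\ (unit_in O (phi z) -> unit_in O' z).

(* A dominant k-morphism f : X -> X, given by its comorphism phi = f^* on K;
   f x is the point x' whose local ring is mapped into that of x by phi, as a
   local homomorphism. *)
Record dominantEndo := DominantEndo {
  comorph :> {rmorphism X -> X};
  comorph_const : forall c, comorph (constants X c) = constants X c;
  comorph_point : forall O, points O ->
    exists2 O', points O' & dominates comorph O O' }.

(* H' = f^* H, for H Cartier. *)
Definition pullback (f : dominantEndo) H H' :=
  forall E, prime_divisor E -> exists O h,
    [/\ points O, dominates f E O, local_equation H O h &
        H' E = vord E (f h)].

Definition int_amplified (f : dominantEndo) :=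
  exists H H', [/\ ample_cartier H, pullback f H H' & ample_cartier (H' - H)].

(* [K : f^* K] = deg *)
Definition has_degree (f : dominantEndo) (deg : nat) :=
  exists b : 'I_deg -> X, forall y, exists c : 'I_deg -> X,
    y = \sum_(i < deg) f (c i) * b i /\
    forall c' : 'I_deg -> X,
      y = \sum_(i < deg) f (c' i) * b i -> forall i, c' i = c i.

(* sigma is a splitting of O_W -> F^e_* (O_W(D)), a |-> a^(p^e), as a morphism
   of sheaves of O_W-modules; the sections over a nonempty open U of
   F^e_* (O_W(D)) are those of O_W(D), on which a acts through a^(p^e). *)
Definition frobenius_splits (p e : nat) W D :=
  exists sigma : set (set X) -> X -> X,
  forall U, open_in U -> U `<=` W -> U !=set0 ->
  [/\ forall s, sections D U s -> regular_on U (sigma U s),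
      forall s s', sections D U s -> sections D U s' ->
        sigma U (s + s') = sigma U s + sigma U s',
      forall a s, regular_on U a -> sections D U s ->
        sigma U (a ^+ (p ^ e) * s) = a * sigma U s,
      forall V s, open_in V -> V `<=` U -> V !=set0 -> sections D U s ->
        sigma V s = sigma U s
    & forall a, regular_on U a -> sigma U (a ^+ (p ^ e)) = a].

(* W is an open subvariety of X; its open subsets and its prime divisors are
   those of X contained in W. *)
Definition globally_F_regular (p : nat) W :=
  forall D, weil_divisor W D -> effective W D ->
    exists2 e, (0 < e)%N & frobenius_splits p e W D.

Definition strongly_F_regular (p : nat) :=
  forall O, points O ->
    exists W, [/\ open_in W, W O & globally_F_regular p W].

End Varieties.

Arguments points {k} X.

Definition perfect_of_char (k : fieldType) (p : nat) :=
  p \in [pchar k] /\ forall a : k, exists b : k, a = b ^+ p.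

(* Main.v *)
(* Fix a nonzero rational top form w of X, with divisor C, and let tau be the
   Cartier operator on top forms, transported to the function field K by w.  Every
   p^-e-linear endomap of K is tau^e(h.) for some h, and tau^e pairs the stalk
   O_E(C + p^e N) with O_E(-p^e N) perfectly at each prime divisor E.  A splitting of
   O_X -> F^e_* O_X(D) is thus a global section h of O_X((1 - p^e) C - D) such
   that tau^e(h) = 1.  Strong F-regularity provides such sections on the affine
   charts; multiplied by large powers of the homogeneous coordinates, they become
   global and kill Cech cohomology, because the Frobenius pull-back of a cocycle is
   a coboundary by Serre vanishing.  A Koszul argument then yields
   H^0(C + N) = sum_i x_i^M H^0(C + N - M B), B a hyperplane section, as soon as
   N is positive enough, whence kappa in H^0(C + p^e N - D') such that
   tau^e(kappa) is a given section of O_X(C + N).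

   Let phi = f^m, m large.  As A = - C and f^* H - H are ample, N = phi^* A is as
   positive as one likes.  The section j of O_X(C + N) is defined by phi^* w = j w, and D' is the
   ramification divisor plus phi^* D.  As the degree is prime to p, the trace
   of phi divided by the degree is a retraction t of phi, and commutes with
   tau up to j; so h = t(kappa / j) is a section of O_X(C + p^e A - D) and
   tau^e(h) = t(1) = 1. *)

From HB Require Import structures.
Require Import Defs.
From mathcomp Require Import all_boot all_order all_algebra.
From mathcomp Require Import boolp classical_sets functions cardinality.
From mathcomp Require Import zify ring lra.

Set Implicit Arguments.
Unset Strict Implicit.
Unset Printing Implicit Defensive.

Import Order.TTheory GRing.Theory Num.Theory.

Local Open Scope classical_set_scope.
Local Open Scope ring_scope.

(** * Noetherian subrings *)

(** The order of the choices shapes the proof. The positivity wanted of N decides which iterate of f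
    is taken, and that iterate decides D'; so the positivity [M1] required by the lifting step must
    depend only on splittings chosen on the charts for the zero divisor. Serre's bound does depend
    on N. This is harmless because C + qN = C + q(N - B) + qB has a large last term as soon as q =
    p^e is large, provided that the bound is uniform in the multiple of N - B. Hence vanishing is
    proved for a bigraded module, and a semiample N - B suffices.

    The trace needs the image of a prime divisor under f to be a prime divisor. Positivity of f^* H
    provides enough functions integral over the image; instead of going down, one uses
    characteristic polynomials over f^* K. Their coefficients are regular because poles would be
    multiplied by p^s under Frobenius while denominators of powers stay bounded; the same argument
    makes the trace regular. Extension of functions over codimension two is obtained from Frobenius
    splittings, in [strong_hartogs]. *)

Section SubringTheory.
Variable L : comNzRingType.
Implicit Types (A : set L).

Record subring A : Prop := Subring {
  subring1 : A 1;
  subringB : forall a b, A a -> A b -> A (a - b);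
  subringM : forall a b, A a -> A b -> A (a * b) }.

Section SubringOps.
Variables (A : set L) (rA : subring A).

Lemma subring0 : A 0.
Proof. by rewrite -(subrr 1); apply: subringB; rewrite //; apply: subring1. Qed.

Lemma subringN a : A a -> A (- a).
Proof. by move=> Aa; rewrite -sub0r; apply: subringB => //; apply: subring0. Qed.

Lemma subringD a b : A a -> A b -> A (a + b).
Proof. by move=> Aa Ab; rewrite -[b]opprK; apply: subringB => //; apply: subringN. Qed.

Lemma subringX a n : A a -> A (a ^+ n).
Proof.
move=> Aa; elim: n => [|n IH]; first exact: subring1.
by rewrite exprS; apply: subringM.
Qed.

Lemma subring_sum I (r : seq I) (P : pred I) F :
  (forall i, P i -> A (F i)) -> A (\sum_(i <- r | P i) F i).
Proof. by move=> AF; apply: big_ind => //; [exact: subring0|exact: subringD]. Qed.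

Lemma subring_prod I (r : seq I) (P : pred I) F :
  (forall i, P i -> A (F i)) -> A (\prod_(i <- r | P i) F i).
Proof. by move=> AF; apply: big_ind => //; [exact: subring1|exact: subringM]. Qed.

Lemma subring_nat n : A n%:R.
Proof.
elim: n => [|n IH]; first exact: subring0.
by rewrite -addn1 natrD; apply: subringD => //; apply: subring1.
Qed.

Lemma subring_horner (q : {poly L}) x : (forall i, A q`_i) -> A x -> A q.[x].
Proof.
by move=> Aq Ax; rewrite horner_coef; apply: subring_sum => i _;
  apply: subringM => //; apply: subringX.
Qed.

End SubringOps.

Lemma subring_closedP A : subring_closed (mem A) <-> subring A.
Proof.
split=> [[c1 cB cM]|rA].
  split; first by have := c1; rewrite inE.
    by move=> a b /mem_set Aa /mem_set Ab; have := cB _ _ Aa Ab; rewrite inE.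
  by move=> a b /mem_set Aa /mem_set Ab; have := cM _ _ Aa Ab; rewrite inE.
split=> [|a b|a b]; rewrite ?inE.
- exact: subring1.
- exact: subringB.
- exact: subringM.
Qed.

Section SpanTheory.
Variable V : lmodType L.
Implicit Types (S N : set V).

(** A is a mere subset of the ring L, so an A-module is a subset of an L-module V. Ideals,
    fractional ideals and modules of cochains thus share one notion of generation. *)
Inductive Span A S : V -> Prop :=
| Span0 : Span A S 0
| SpanZ a v w : A a -> S v -> Span A S w -> Span A S (a *: v + w).

Definition submod A N := N 0 /\ forall a v w, A a -> N v -> N w -> N (a *: v + w).

Lemma Span_min A S N : submod A N -> S `<=` N -> Span A S `<=` N.
Proof. by move=> [N0 NZ] SN v; elim=> // a {}v w Aa Sv _; apply: NZ => //; apply: SN. Qed.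

Lemma SpanD A S v w : Span A S v -> Span A S w -> Span A S (v + w).
Proof.
move=> Sv Sw; elim: Sv => [|a v' w' Aa Sv' _ IH]; first by rewrite add0r.
by rewrite -addrA; apply: SpanZ.
Qed.

Lemma SpanS A S a v : subring A -> A a -> Span A S v -> Span A S (a *: v).
Proof.
move=> rA Aa; elim=> [|b v' w Ab Sv' _ IH]; first by rewrite scaler0; apply: Span0.
by rewrite scalerDr scalerA; apply: SpanZ => //; apply: subringM.
Qed.

Lemma Span_submod A S : subring A -> submod A (Span A S).
Proof.
move=> rA; split; first exact: Span0.
by move=> a v w Aa Sv Sw; apply: SpanD => //; apply: SpanS.
Qed.

Lemma Span_id A S v : subring A -> S v -> Span A S v.
Proof.
move=> rA Sv; rewrite -[v]scale1r -[_ *: _]addr0; apply: SpanZ => //.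
  exact: subring1.
exact: Span0.
Qed.

Lemma SpanN A S v : subring A -> Span A S v -> Span A S (- v).
Proof.
move=> rA Sv; rewrite -scaleN1r; apply: SpanS => //.
by apply: (subringN rA); apply: subring1.
Qed.

Lemma SpanB A S v w : subring A -> Span A S v -> Span A S w -> Span A S (v - w).
Proof. by move=> rA Sv Sw; apply: SpanD => //; apply: SpanN. Qed.

Lemma Span_sum A S I (r : seq I) (P : pred I) F : subring A ->
  (forall i, P i -> Span A S (F i)) -> Span A S (\sum_(i <- r | P i) F i).
Proof. by move=> rA SF; apply: big_ind => //; [exact: Span0|move=> v w; exact: SpanD]. Qed.

Lemma Span_sub A B S T : subring B -> A `<=` B -> S `<=` Span B T -> Span A S `<=` Span B T.
Proof.
move=> rB AB ST v; elim=> [|a v' w Aa Sv' _ IH]; first exact: Span0.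
by apply: SpanD => //; apply: SpanS => //; [exact: AB|exact: ST].
Qed.

Lemma submodN A N v : subring A -> submod A N -> N v -> N (- v).
Proof.
move=> rA [N0 NZ] Nv; rewrite -scaleN1r -[_ *: _]addr0; apply: NZ => //.
by apply: (subringN rA); apply: subring1.
Qed.

Lemma submodD A N v w : subring A -> submod A N -> N v -> N w -> N (v + w).
Proof.
by move=> rA [N0 NZ] Nv Nw; rewrite -[v]scale1r; apply: NZ => //; apply: subring1.
Qed.

Lemma submodZ A N a v : submod A N -> A a -> N v -> N (a *: v).
Proof. by move=> [N0 NZ] Aa Nv; rewrite -[_ *: _]addr0; apply: NZ. Qed.

Lemma Span_cons A v0 (s : seq V) v : subring A ->
  Span A [set` v0 :: s] v -> exists2 a, A a & Span A [set` s] (v - a *: v0).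
Proof.
move=> rA; elim=> [|a v' w Aa Sv' _ [b Ab IH]].
  by exists 0; [exact: subring0|rewrite scale0r subr0; exact: Span0].
move: Sv'; rewrite /= in_cons => /orP[/eqP ->|v's].
    exists (a + b); first exact: subringD.
  by rewrite scalerDl opprD addrACA subrr add0r.
by exists b => //; rewrite -addrA; apply: SpanZ.
Qed.

End SpanTheory.

Definition noeth A := forall I : set L^o, I `<=` A -> submod A I ->
  exists2 s : seq L^o, [set` s] `<=` I & I `<=` Span A [set` s].

(** Induction on the generators. The coefficients at [v0] of the elements of N form an ideal I;
    lifts to N of finitely many generators of I account for that coefficient, and the remainder lies
    in the span of s, where the induction hypothesis applies. *)
Lemma noeth_submod A (V : lmodType L) (s : seq V) (N : set V) :
  subring A -> noeth A -> submod A N -> N `<=` Span A [set` s] ->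
  exists2 t : seq V, [set` t] `<=` N & N `<=` Span A [set` t].
Proof.
move=> rA nA; elim: s N => [|v0 s IH] N mN Ns.
  by exists [::] => // v /Ns; elim=> [|a u w _ //]; apply: Span0.
pose I : set L^o := [set a | A a /\ exists2 n, N n & Span A [set` s] (n - a *: v0)].
have mI : submod A I.
  split.
    split; first exact: subring0.
    by exists 0; [case: mN|rewrite scale0r subr0; apply: Span0].
  move=> a b c Aa [Ab [n Nn Sn]] [Ac [m Nm Sm]]; split.
    by apply: subringD => //; apply: subringM.
  exists (a *: n + m); first by case: mN => _; apply.
  have -> : a *: n + m - (a *: b + c) *: v0 = a *: (n - b *: v0) + (m - c *: v0).
    by rewrite scalerDl scalerBr scalerA opprD addrACA.
  by apply: SpanD => //; apply: SpanS.
have [t tI It] := nA I (fun a Ia => Ia.1) mI.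
have [g gP] : exists g : L -> V, forall a, a \in t ->
    N (g a) /\ Span A [set` s] (g a - a *: v0).
  have : forall a, exists b, a \in t -> N b /\ Span A [set` s] (b - a *: v0).
    move=> a; have [/tI[_ [n Nn Sn]]|_] := boolP (a \in t); first by exists n.
    by exists 0.
  by case/choice=> g gP; exists g.
have mN0 : submod A (N `&` Span A [set` s]).
  split; first by split; [case: mN|exact: Span0].
  move=> a v w Aa [Nv Sv] [Nw Sw]; split; first by case: mN => _; apply.
  by apply: SpanD => //; apply: SpanS.
have [t0 t0N Nt0] := IH _ mN0 (fun v Nv => Nv.2).
exists (t0 ++ map g t).
  move=> v; rewrite /= mem_cat => /orP[/t0N[]//|/mapP[a /gP[Na _] -> //]].
move=> v Nv; have [a Aa Sva] := Span_cons rA (Ns _ Nv).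
have St b : Span A [set` t] b -> exists n,
    [/\ N n, Span A [set` t0 ++ map g t] n & Span A [set` s] (n - (b : L) *: v0)].
  elim=> [|c b' b'' Ac tb' _ [n [Nn Sn Sn']]].
    by exists 0; split; [case: mN|exact: Span0|rewrite scale0r subr0; exact: Span0].
  have [Ng Sg] := gP _ tb'.
  exists (c *: g b' + n); split.
  - by case: mN => _; apply.
  - by apply: SpanZ => //; rewrite /= mem_cat map_f ?orbT.
  - have -> : c *: g b' + n - (c *: b' + b'') *: v0 =
        c *: (g b' - (b' : L) *: v0) + (n - (b'' : L) *: v0).
      by rewrite scalerDl scalerBr scalerA opprD addrACA.
    by apply: SpanD => //; apply: SpanS.
have Ia : I a by split => //; exists v.
have [n [Nn Sn Sn']] := St _ (It _ Ia).
rewrite -(subrK n v); apply: SpanD => //.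
have /Nt0 H : (N `&` Span A [set` s]) (v - n).
  split; first by apply: (submodD rA mN) => //; apply: (submodN rA mN).
  have -> : v - n = (v - a *: v0) - (n - a *: v0) by rewrite opprB addrA subrK.
  exact: SpanB.
apply: (Span_sub rA (fun _ h => h) _ H) => w wt0.
by apply: Span_id => //; rewrite /= mem_cat [X in X || _]wt0.
Qed.

(* An ideal of A[x] is controlled by the ideal of leading coefficients of the
   polynomials over A whose value at x belongs to it. *)
Definition adjoin A (x : L) : set L :=
  [set z | exists2 q : {poly L}, (forall i, A q`_i) & z = q.[x]].

Lemma adjoin_subring A x : subring A -> subring (adjoin A x).
Proof.
move=> rA; split.
- exists 1; last by rewrite hornerC.
  by move=> i; rewrite coef1; apply: subring_nat.
- move=> _ _ [q Aq ->] [r Ar ->]; exists (q - r); last by rewrite !hornerE.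
  by move=> i; rewrite coefB; apply: subringB.
- move=> _ _ [q Aq ->] [r Ar ->]; exists (q * r); last by rewrite hornerM.
  by move=> i; rewrite coefM; apply: subring_sum => // j _; apply: subringM.
Qed.

Lemma adjoin_sub A x : subring A -> A `<=` adjoin A x.
Proof.
move=> rA a Aa; exists a%:P; last by rewrite hornerC.
by move=> i; rewrite coefC; case: ifP => // _; apply: subring0.
Qed.

Lemma adjoin_mem A x : subring A -> adjoin A x x.
Proof.
move=> rA; exists 'X; last by rewrite hornerX.
by move=> i; rewrite coefX; apply: subring_nat.
Qed.

Lemma noeth_adjoin A x : subring A -> noeth A -> noeth (adjoin A x).
Proof.
move=> rA nA J JA mJ; have rB := adjoin_subring x rA.
pose PJ (q : {poly L}) := (forall i, A q`_i) /\ J q.[x].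
have PJD q r : PJ q -> PJ r -> PJ (q + r).
  move=> [Aq Jq] [Ar Jr]; split; first by move=> i; rewrite coefD; apply: subringD.
  by rewrite hornerD; apply: (submodD rB mJ).
have PJM (q r : {poly L}) : (forall i, A q`_i) -> PJ r -> PJ (q * r).
  move=> Aq [Ar Jr]; split.
    by move=> i; rewrite coefM; apply: subring_sum => // j _; apply: subringM.
  by rewrite hornerM; apply: (submodZ mJ) => //; exists q.
pose lead d : set L^o := [set a | exists q, [/\ PJ q, (size q <= d.+1)%N & q`_d = a]].
have PJ0 : PJ 0.
  by split=> [i|]; rewrite ?coef0 ?horner0; [exact: subring0|case: mJ].
have Apoly c : A c -> forall i, A (c%:P)`_i.
  by move=> Ac i; rewrite coefC; case: ifP => // _; apply: subring0.
have AX n i : A ('X^n : {poly L})`_i by rewrite coefXn; apply: subring_nat.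
have leadS d e : (d <= e)%N -> lead d `<=` lead e.
  move=> de a [q [Jq sq <-]]; exists ('X^(e - d) * q); split.
  - exact: PJM.
  - by apply: (leq_trans (size_polyMleq _ _)); rewrite size_polyXn; lia.
  - by rewrite coefXnM; case: ltnP => [|_]; [lia|congr (q`_ _); lia].
pose I : set L^o := [set a | exists d, lead d a].
have mI : submod A I.
  split; first by exists 0%N, 0; split; rewrite ?coef0 ?size_poly0.
  move=> a b c Aa [d [q [Jq sq qb]]] [e /(leadS _ _ (leq_addl d e)) [r [Jr sr rc]]].
  have [q' [Jq' sq' qb']] : lead (d + e)%N b by apply: (leadS _ _ (leq_addr e d)); exists q.
  exists (d + e)%N, (a%:P * q' + r); split.
  - by apply: PJD => //; apply: PJM => //; apply: Apoly.
  - apply: (leq_trans (size_polyD _ _)); rewrite geq_max sr andbT.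
    by rewrite mul_polyC (leq_trans (size_scale_leq _ _)).
  - by rewrite coefD coefCM qb' rc.
have IA : I `<=` A by move=> a [d [q [[Aq _] _ <-]]].
have [s sI Is] := nA I IA mI.
have [m sm] : exists m, [set` s] `<=` lead m.
  elim: s sI {Is} => [|a s IH] sI; first by exists 0%N.
  have [|m sm] := IH; first by move=> b bs; apply: sI; rewrite /= in_cons [X in _ || X]bs orbT.
  have [d da] : I a by apply: sI; rewrite /= mem_head.
  exists (d + m)%N => b; rewrite /= in_cons => /orP[/eqP ->|/sm].
    exact: leadS (leq_addr m d) _ da.
  by apply: leadS; apply: leq_addl.
have {}Im : I `<=` lead m.
  move=> a /Is; apply: Span_min; last exact: sm.
  split; first by exists 0; split; rewrite ?coef0 ?size_poly0.
  move=> b c e Ab [q [Jq sq qc]] [r [Jr sr re]]; exists (b%:P * q + r); split.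
  - by apply: PJD => //; apply: PJM => //; apply: Apoly.
  - apply: (leq_trans (size_polyD _ _)); rewrite geq_max sr andbT.
    by rewrite mul_polyC (leq_trans (size_scale_leq _ _)).
  - by rewrite coefD coefCM qc re.
pose Jm : set L^o := [set z | exists q, [/\ PJ q, (size q <= m.+1)%N & z = q.[x]]].
have mJm : submod A Jm.
  split; first by exists 0; split; rewrite ?horner0 ?size_poly0.
  move=> a _ _ Aa [q [Jq sq ->]] [r [Jr sr ->]]; exists (a%:P * q + r); split.
  - by apply: PJD => //; apply: PJM => //; apply: Apoly.
  - apply: (leq_trans (size_polyD _ _)); rewrite geq_max sr andbT.
    by rewrite mul_polyC (leq_trans (size_scale_leq _ _)).
  - by rewrite !hornerE.
have [|t tJ Jt] := @noeth_submod A L^o [seq x ^+ i | i <- iota 0 m.+1] Jm rA nA mJm.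
  move=> _ [q [[Aq _] sq ->]]; rewrite (horner_coef_wide _ sq).
  apply: Span_sum => // i _; apply: (@SpanS L^o) => //; apply: Span_id => //.
  have : x ^+ i \in [seq x ^+ i | i <- iota 0 m.+1].
    by apply: map_f; rewrite mem_iota add0n ltn_ord.
  exact.
exists t; first by move=> z /tJ[q [[]]] _ Jq _ ->.
have main n (q : {poly L}) : PJ q -> (size q <= n)%N -> Span (adjoin A x) ([set` t] : set L^o) q.[x].
  elim: n q => [|n IH] q Jq sq.
    by move: sq; rewrite leqn0 size_poly_eq0 => /eqP ->; rewrite horner0; apply: Span0.
  have [nm|mn] := leqP n m.
    have /Jt H : Jm q.[x] by exists q; split=> //; apply: leq_trans sq _.
    apply: (@Span_sub L^o A (adjoin A x) [set` t] [set` t] rB _ _ _ H).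
      exact: adjoin_sub.
    by move=> z zt; apply: Span_id.
  have [r [Jr sr rq]] : lead m q`_n by apply: Im; exists n, q.
  pose r' := 'X^(n - m) * r.
  have Jr' : PJ r' by apply: PJM.
  rewrite -(subrK r' q) hornerD; apply: SpanD.
    apply: IH.
      by rewrite -mulN1r; apply: PJD => //; apply: PJM => // i;
        rewrite -polyCN; apply: Apoly; apply: (subringN rA); apply: subring1.
    apply/leq_sizeP => j; rewrite leq_eqVlt => /orP[/eqP <-|nj].
      rewrite coefB coefXnM ltnNge leq_subr /= subKn ?(ltnW mn) // rq.
      exact: subrr.
    rewrite coefB (leq_sizeP _ _ sq) // coefXnM; case: ltnP => _; rewrite ?subrr //.
    by rewrite (leq_sizeP _ _ sr) ?subrr //; lia.
  rewrite hornerM; apply: (@SpanS L^o) => //; first by exists 'X^(n - m).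
  have /Jt H : Jm r.[x] by exists r.
  apply: (@Span_sub L^o A (adjoin A x) [set` t] [set` t] rB _ _ _ H).
    exact: adjoin_sub.
  by move=> z zt; apply: Span_id.
move=> z Jz; have [q Aq zq] := JA _ Jz; rewrite zq.
by apply: (main (size q)) => //; split=> //; rewrite -zq.
Qed.

Lemma noeth_fg A (s : seq L) : subring A -> noeth A -> exists B,
  [/\ subring B, noeth B, A `<=` B, [set` s] `<=` B &
      forall C, subring C -> A `<=` C -> [set` s] `<=` C -> B `<=` C].
Proof.
move=> rA nA; elim: s => [|x s [B [rB nB AB sB Bmin]]]; first by exists A; split.
exists (adjoin B x); split.
- exact: adjoin_subring.
- exact: noeth_adjoin.
- by apply: (subset_trans AB); apply: adjoin_sub.
- move=> y; rewrite /= in_cons => /orP[/eqP ->|ys]; first exact: adjoin_mem.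
  by apply: adjoin_sub => //; apply: sB.
- move=> C rC AC sC _ [q Bq ->]; apply: subring_horner => //.
    move=> i; apply: Bmin => // y ys; apply: sC; rewrite /= in_cons [X in _ || X]ys orbT //.
  by apply: sC; rewrite /= mem_head.
Qed.
End SubringTheory.

Section Ideals.
Variables (K : fieldType) (A : set K).
Hypotheses (rA : subring A) (nA : noeth A).

Definition ideal (I : set K) := I `<=` A /\ @submod K K^o A I.

Lemma ideal0 I : ideal I -> I 0. Proof. by case=> _ []. Qed.
Lemma idealD I a b : ideal I -> I a -> I b -> I (a + b).
Proof. by case=> _ mI; exact: (@submodD K K^o A I a b rA mI). Qed.
Lemma idealM I a b : ideal I -> A a -> I b -> I (a * b).
Proof. by case=> _ mI; exact: (@submodZ K K^o A I a b mI). Qed.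
Lemma prime_ideal_ideal P : prime_ideal A P -> ideal P.
Proof.
move=> [[PA P0] PD PM _ _]; split=> //; split=> // a v w Aa Pv Pw.
by apply: PD => //; apply: PM.
Qed.

(** Zorn's lemma: the union of a chain in F is finitely generated, hence equal to a member of the
    chain. [Zorn_bigcup] also asks for the union of the empty chain, which is why [F'] contains the
    empty set. *)
Lemma ideal_max (F : set (set K)) I0 : F `<=` ideal -> F I0 ->
  exists2 M, F M & forall I, F I -> M `<=` I -> I `<=` M.
Proof.
move=> Fid FI0; pose F' := [set I | I = set0 \/ F I].
have [C CF' Ctot|M [FM Mmax]] := @Zorn_bigcup K F'; last first.
  have FM' : F M.
    case: FM => // M0; exfalso; apply: (Mmax I0); last by right.
    by rewrite M0; split=> // /(_ 0); apply; apply: (ideal0 (Fid _ FI0)).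
  exists M => // I FI MI z Iz; apply: contrapT => Mz.
  by apply: (Mmax I); [split=> // h; apply: Mz; apply: h|right].
have [[I CI Ine]|C0] := pselect (exists2 I, C I & I !=set0); last first.
  left; apply/seteqP; split=> // z [I CI Iz]; apply: C0; exists I => //; by exists z.
right; set U := \bigcup_(X in C) X.
have CidF X z : C X -> X z -> F X.
  by move=> CX Xz; case: (CF' _ CX) => // X0; move: Xz; rewrite X0.
have idU : ideal U.
  split; first by move=> z [X CX Xz]; case: (Fid _ (CidF _ _ CX Xz)) => XA _; apply: XA.
  split.
    case: Ine => z Iz; exists I => //; exact: (ideal0 (Fid _ (CidF _ _ CI Iz))).
  move=> a v w Aa [X CX Xv] [Y CY Yw].
  have iX := Fid _ (CidF _ _ CX Xv); have iY := Fid _ (CidF _ _ CY Yw).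
  case: (Ctot _ _ CX CY) => XY.
    by exists Y => //; apply: idealD => //; apply: idealM => //; apply: XY.
  by exists X => //; apply: idealD => //; [apply: idealM|apply: XY].
have [s sU Us] := nA idU.1 idU.2.
have [X CX sX] : exists2 X, C X /\ X !=set0 & [set` s] `<=` X.
  elim: s sU {Us} => [|z s IH] sU; first by exists I.
  have [|X [CX X0] sX] := IH; first by move=> y ys; apply: sU; rewrite /= in_cons [X in _ || X]ys orbT.
  have [Y CY Yz] : U z by apply: sU; rewrite /= mem_head.
  case: (Ctot _ _ CX CY) => XY.
    exists Y; first by split=> //; exists z.
    by move=> y; rewrite /= in_cons => /orP[/eqP -> //|/sX /XY].
  exists X => // y; rewrite /= in_cons => /orP[/eqP ->|/sX //]; exact: XY.
case: CX => CX [z Xz]; have FX := CidF _ _ CX Xz.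
have -> : U = X; last by [].
apply/seteqP; split; last by move=> y Xy; exists X.
move=> y /Us; apply: Span_min; last exact: sX.
by case: (Fid _ FX).
Qed.

Definition ideal_add (I : set K) (a : K) : set K :=
  [set z | exists2 m, I m & exists2 c, A c & z = m + c * a].

Lemma ideal_add_ideal I a : ideal I -> A a -> ideal (ideal_add I a).
Proof.
move=> iI Aa; split.
  move=> _ [m Im [c Ac ->]]; apply: subringD => //; first by case: iI => IA _; apply: IA.
  exact: subringM.
split.
  by exists 0; [exact: ideal0|exists 0; [exact: subring0|rewrite mul0r addr0]].
move=> b _ _ Ab [m Im [c Ac ->]] [m' Im' [c' Ac' ->]].
exists (b * m + m'); first by apply: idealD => //; apply: idealM.
exists (b * c + c'); first by apply: subringD => //; apply: subringM.
by rewrite /GRing.scale /=; ring.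
Qed.

Lemma ideal_add_sub I a : I `<=` ideal_add I a.
Proof.
by move=> z Iz; exists z => //; exists 0; [exact: subring0|rewrite mul0r addr0].
Qed.

Lemma ideal_add_mem I a : ideal I -> ideal_add I a a.
Proof.
by move=> iI; exists 0; [exact: ideal0|exists 1; [exact: subring1|rewrite mul1r add0r]].
Qed.

(** An ideal P maximal among those over I that avoid S is prime: if neither a nor b is in P, then P
    + Aa and P + Ab both meet S, and so would P if it contained ab. *)
Lemma prime_disjoint (I S : set K) : ideal I -> S 1 ->
  (forall a b, S a -> S b -> S (a * b)) -> (forall z, I z -> ~ S z) ->
  exists P, [/\ prime_ideal A P, I `<=` P & forall z, P z -> ~ S z].
Proof.
move=> iI S1 SM IS.
pose F : set (set K) := [set J | [/\ ideal J, I `<=` J & forall z, J z -> ~ S z]].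
have [J []//||P [iP IP PS] Pmax] := @ideal_max F I; first by split.
exists P; split=> //; split.
- by split; [case: iP|exact: ideal0].
- by move=> a b; apply: idealD.
- by move=> a b; apply: idealM.
- by move=> P1; apply: (PS 1).
move=> a b Aa Ab Pab; apply: contrapT => /not_orP [Pa Pb].
have meets c : A c -> ~ P c -> exists2 z, ideal_add P c z & S z.
  move=> Ac Pc; apply: contrapT => H; apply: Pc.
  apply: (Pmax (ideal_add P c)); [split|exact: ideal_add_sub|exact: ideal_add_mem].
  - exact: ideal_add_ideal.
  - by apply: subset_trans IP _; apply: ideal_add_sub.
  - by move=> z Pz Sz; apply: H; exists z.
have [_ [m Pm [c Ac ->]] S1'] := meets a Aa Pa.
have [_ [m' Pm' [c' Ac' ->]] S2'] := meets b Ab Pb.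
have PA := iP.1.
apply: (PS _ _ (SM _ _ S1' S2')).
have -> : (m + c * a) * (m' + c' * b) = (m' + c' * b) * m + ((c * a) * m' + (c * c') * (a * b)).
  by ring.
apply: idealD => //.
  by apply: idealM => //; apply: subringD => //; [exact: PA|exact: subringM].
by apply: idealD => //; apply: idealM => //; apply: subringM.
Qed.

Lemma prime_over (I : set K) : ideal I -> ~ I 1 ->
  exists2 P, prime_ideal A P & I `<=` P.
Proof.
move=> iI I1; have [||z Iz /= z1|P [pP IP _]] := @prime_disjoint I [set 1] iI => //.
- by move=> a b -> ->; rewrite mulr1.
- by apply: I1; rewrite -z1.
- by exists P.
Qed.

Lemma unit_ideal (I : set K) : ideal I ->
  (forall P, prime_ideal A P -> exists2 c, I c & ~ P c) -> I 1.
Proof.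
move=> iI H; apply: contrapT => /(prime_over iI)[P pP IP].
by have [c /IP] := H P pP.
Qed.

Lemma prime_radical (I : set K) b : ideal I -> A b ->
  (forall P, prime_ideal A P -> I `<=` P -> P b) -> exists n, I (b ^+ n).
Proof.
move=> iI Ab H; apply: contrapT => nI.
have [||z Iz [n _ zn]|P [pP IP PS]] := @prime_disjoint I [set b ^+ n | n in setT] iI.
- by exists 0%N.
- by move=> _ _ [n _ <-] [m _ <-]; exists (n + m)%N => //; rewrite exprD.
- by apply: nI; exists n; rewrite zn.
- by apply: (PS b (H _ pP IP)); exists 1%N => //; rewrite expr1.
Qed.

(** Noetherian induction. A maximal counterexample M is not prime; if ab is in M with a and b
    outside, the primes over M are those over M + Aa or over M + Ab. *)
Lemma finite_minimal_primes (I : set K) : ideal I ->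
  exists F : set (set K), [/\ finite_set F, forall P, F P -> I `<=` P &
    forall Q, prime_ideal A Q -> I `<=` Q -> exists2 P, F P & prime_ideal A P /\ P `<=` Q].
Proof.
move=> iI0; apply: contrapT => bad.
pose G I := exists F : set (set K), [/\ finite_set F, forall P, F P -> I `<=` P &
    forall Q, prime_ideal A Q -> I `<=` Q -> exists2 P, F P & prime_ideal A P /\ P `<=` Q].
have [J []//||M [iM badM] Mmax] := @ideal_max [set I | ideal I /\ ~ G I] I; first by split.
have M1 : ~ M 1.
  move=> M1; apply: badM; exists set0; split=> //.
  by move=> Q [_ _ _ Q1 _] MQ; case: Q1; apply: MQ.
have nprime : ~ prime_ideal A M.
  move=> pM; apply: badM; exists [set M]; split.
  - exact: finite_set1.
  - by move=> P ->.
  - by move=> Q pQ MQ; exists M.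
have [a [b [Aa Ab Mab Ma Mb]]] : exists a b, [/\ A a, A b, M (a * b), ~ M a & ~ M b].
  apply: contrapT => H; apply: nprime; split=> //.
  - by split; [case: iM|exact: ideal0].
  - by move=> a b; apply: idealD.
  - by move=> a b; apply: idealM.
  - move=> a b Aa Ab Mab; apply: contrapT => /not_orP[Ma Mb]; apply: H.
    by exists a, b.
have good c : A c -> ~ M c -> G (ideal_add M c).
  move=> Ac Mc; apply: contrapT => nG; apply: Mc.
  apply: (Mmax (ideal_add M c)); [split|exact: ideal_add_sub|exact: ideal_add_mem] => //.
  exact: ideal_add_ideal.
have [F1 [fF1 F1M F1P]] := good a Aa Ma.
have [F2 [fF2 F2M F2P]] := good b Ab Mb.
apply: badM; exists (F1 `|` F2); split.
- by rewrite finite_setU.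
- move=> P [/F1M|/F2M]; apply: subset_trans; exact: ideal_add_sub.
move=> Q pQ MQ; have iQ := prime_ideal_ideal pQ.
have addQ c : Q c -> ideal_add M c `<=` Q.
  move=> Qc _ [m Mm [d Ad ->]]; apply: idealD => //; first exact: MQ.
  exact: idealM.
case: (pQ) => _ _ _ _ /(_ a b Aa Ab (MQ _ Mab))[/addQ|/addQ] h.
  by have [P F1P' HP] := F1P Q pQ h; exists P => //; left.
by have [P F2P' HP] := F2P Q pQ h; exists P => //; right.
Qed.

End Ideals.

(** * Localizations and charts *)

Section Localization.
Variable K : fieldType.
Implicit Types (A P O : set K).

Lemma loc_subring A P : subring A -> prime_ideal A P -> subring (localization A P).
Proof.
move=> rA [[PA P0] PD PM P1 Pp].
have nz b : ~ P b -> b != 0 by move=> Pb; apply/eqP => b0; apply: Pb; rewrite b0.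
have nPM a b : A a -> A b -> ~ P a -> ~ P b -> ~ P (a * b).
  by move=> Aa Ab Pa Pb /(Pp _ _ Aa Ab)[].
split.
- by exists 1, 1; rewrite divr1; split=> //; apply: subring1.
- move=> _ _ [a [b [Aa Ab Pb ->]]] [c [d [Ac Ad Pd ->]]].
  exists (a * d - c * b), (b * d); split; rewrite ?nPM //.
  + by apply: subringB => //; apply: subringM.
  + exact: subringM.
  + exact: nPM.
  + by field; rewrite !nz.
- move=> _ _ [a [b [Aa Ab Pb ->]]] [c [d [Ac Ad Pd ->]]].
  exists (a * c), (b * d); split; rewrite ?nPM //; try exact: subringM.
  + exact: nPM.
  + by field; rewrite !nz.
Qed.

Lemma loc_sub A P : subring A -> prime_ideal A P -> A `<=` localization A P.
Proof.
move=> rA [_ _ _ P1 _] a Aa; exists a, 1; rewrite divr1; split=> //; exact: subring1.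
Qed.

Lemma prime_nz A P b : prime_ideal A P -> ~ P b -> b != 0.
Proof. by move=> [[_ P0] _ _ _ _] Pb; apply/eqP => b0; apply: Pb; rewrite b0. Qed.

Lemma loc_nonunitE A P a b : subring A -> prime_ideal A P -> A a -> A b -> ~ P b ->
  nonunits (localization A P) (a / b) <-> P a.
Proof.
move=> rA pP Aa Ab Pb; have b0 := prime_nz pP Pb; have [[PA P0] PD PM P1 Pp] := pP.
split=> [[_ nu]|Pa].
  apply: contrapT => Pa; apply: nu; have a0 := prime_nz pP Pa.
  split; first by rewrite mulf_neq0 ?invr_eq0.
    by exists a, b.
  by exists b, a; split=> //; rewrite invf_div.
split; first by exists a, b.
move=> [ab0 _ [c [d [Ac Ad Pd]]]]; rewrite invf_div => /eqP.
have d0 := prime_nz pP Pd.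
have a0 : a != 0 by apply: contraNneq ab0 => ->; rewrite mul0r.
rewrite eqr_div // => /eqP e; have /(Pp _ _ Ab Ad)[] // : P (b * d).
by rewrite e; apply: PM.
Qed.

Lemma loc_nonunit A P a : subring A -> prime_ideal A P -> A a ->
  nonunits (localization A P) a <-> P a.
Proof.
move=> rA pP Aa; rewrite -{1}[a]divr1; apply: loc_nonunitE => //; first exact: subring1.
by case: pP.
Qed.

Definition local_ring O := subring O /\ prime_ideal O (nonunits O).

Lemma nonunitsP O z : O z -> ~ nonunits O z -> [/\ z != 0, O z & O z^-1].
Proof. by move=> Oz nu; apply: contrapT => h; apply: nu; split. Qed.

Lemma loc_local A P : subring A -> prime_ideal A P -> local_ring (localization A P).
Proof.
move=> rA pP; have rO := loc_subring rA pP; split=> //.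
have [[PA P0] PD PM P1 Pp] := pP.
split.
- split=> [z []//|]; apply/(loc_nonunit rA pP) => //; exact: subring0.
- move=> _ _ [[a [b [Aa Ab Pb ->]]] nu1] [[c [d [Ac Ad Pd ->]]] nu2].
  have b0 := prime_nz pP Pb; have d0 := prime_nz pP Pd.
  have Pa : P a by apply/(loc_nonunitE rA pP Aa Ab Pb); split=> //; exists a, b.
  have Pc : P c by apply/(loc_nonunitE rA pP Ac Ad Pd); split=> //; exists c, d.
  rewrite addf_div //; apply/loc_nonunitE => //.
  + by apply: subringD => //; apply: subringM.
  + exact: subringM.
  + by move/(Pp _ _ Ab Ad) => [].
  + by apply: PD; rewrite mulrC; apply: PM.
- move=> _ _ [a [b [Aa Ab Pb ->]]] [[c [d [Ac Ad Pd ->]]] nu2].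
  have Pc : P c by apply/(loc_nonunitE rA pP Ac Ad Pd); split=> //; exists c, d.
  rewrite mulf_div; apply/loc_nonunitE => //; try exact: subringM.
  + by move/(Pp _ _ Ab Ad) => [].
  + exact: PM.
- by move/(loc_nonunit rA pP (subring1 rA)).
- move=> _ _ [a [b [Aa Ab Pb ->]]] [c [d [Ac Ad Pd ->]]].
  rewrite mulf_div !loc_nonunitE //; try exact: subringM.
    exact: Pp.
  by move/(Pp _ _ Ab Ad) => [].
Qed.

Lemma sub_loc A P O : subring A -> prime_ideal A P -> local_ring O -> A `<=` O ->
  (forall a, A a -> ~ P a -> ~ nonunits O a) -> localization A P `<=` O.
Proof.
move=> rA pP [rO _] AO PO _ [a [b [Aa Ab Pb ->]]].
have [_ _ Ob] := nonunitsP (AO _ Ab) (PO _ Ab Pb).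
by apply: subringM => //; apply: AO.
Qed.

Lemma prime_preim A O : subring A -> local_ring O -> A `<=` O ->
  prime_ideal A (A `&` nonunits O).
Proof.
move=> rA [rO [[_ P0] PD PM P1 Pp]] AO; split.
- by split=> [z []//|]; split=> //; apply: subring0.
- by move=> a b [Aa Pa] [Ab Pb]; split; [exact: subringD|exact: PD].
- by move=> a b Aa [Ab Pb]; split; [exact: subringM|apply: PM => //; exact: AO].
- by case.
- by move=> a b Aa Ab [_ /(Pp _ _ (AO _ Aa) (AO _ Ab))[]]; [left|right].
Qed.

Lemma zero_prime A : subring A -> prime_ideal A [set 0].
Proof.
move=> rA; split.
- by split=> // _ ->; apply: subring0.
- by move=> _ _ -> ->; rewrite addr0.
- by move=> a _ _ ->; rewrite mulr0.
- by move/eqP; rewrite oner_eq0.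
- by move=> a b _ _ /eqP; rewrite mulf_eq0 => /orP[/eqP|/eqP]; [left|right].
Qed.

(** The denominators c with cz in A form an ideal, which is contained in no prime ideal. *)
Lemma mem_all_loc A z : subring A -> noeth A ->
  (forall P, prime_ideal A P -> localization A P z) -> A z.
Proof.
move=> rA nA H; pose I : set K := [set c | A c /\ A (c * z)].
suff : I 1 by case; rewrite mul1r.
apply: (unit_ideal rA nA).
  split; first by move=> c [].
  split; first by split; rewrite ?mul0r; apply: subring0.
  move=> a c d Aa [Ac Acz] [Ad Adz]; rewrite /GRing.scale /=; split.
    by apply: subringD => //; apply: subringM.
  by rewrite mulrDl -mulrA; apply: subringD => //; apply: subringM.
move=> P pP; have [a [b [Aa Ab Pb zE]]] := H P pP.
by exists b => //; split=> //; rewrite zE mulrC divfK // (prime_nz pP).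
Qed.

Lemma noeth_loc A P : subring A -> noeth A -> prime_ideal A P -> noeth (localization A P).
Proof.
move=> rA nA pP I IO mI; have rO := loc_subring rA pP.
have AO := loc_sub rA pP.
have [||s sI Is] := nA (A `&` I).
- by move=> z [].
- split; first by split; [exact: subring0|case: mI].
  move=> a b c Aa [Ab Ib] [Ac Ic]; split.
    by rewrite /GRing.scale /=; apply: subringD => //; apply: subringM.
  by case: mI => _; apply=> //; apply: AO.
exists s; first by move=> z /sI[].
move=> z Iz; have [a [b [Aa Ab Pb zE]]] := IO _ Iz.
have b0 := prime_nz pP Pb.
have /Is Sa : (A `&` I) a.
  split=> //; have -> : a = b * z by rewrite zE mulrC divfK.
  exact: (@submodZ K K^o _ I b z mI (AO _ Ab) Iz).
have -> : z = b^-1 * a by rewrite zE mulrC.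
apply: (@SpanS K K^o) => //; first by exists 1, b; rewrite mul1r; split=> //; exact: subring1.
apply: (@Span_sub K K^o A _ [set` s] [set` s] rO AO _ _ Sa).
by move=> w ws; apply: Span_id.
Qed.

End Localization.

(** * Homogeneous forms and affine charts *)

Section Forms.
Variables (K : fieldType) (J : finType) (x : J -> K).
Hypothesis x_neq0 : forall j, x j != 0.
Implicit Types (R : set K) (m : {ffun J -> nat}).

Definition monomial m : K := \prod_j x j ^+ m j.
Definition mdegree m : nat := (\sum_j m j)%N.

(** Forms are represented by their values in K, so that the relations between the coordinates are
    built in. *)
Definition forms R d : set K :=
  @Span K K^o R [set z | exists2 m, mdegree m = d & z = monomial m].

(** This is R[x_j / x_i]. The ring R varies: besides the constants, it is the image of a local ring
    under the endomorphism, in [integral_over_pt]. *)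
Definition chartR R i : set K := [set z | exists d, forms R d (z * x i ^+ d)].

Lemma monomialD m m' : monomial m * monomial m' = monomial [ffun j => (m j + m' j)%N].
Proof. by rewrite -big_split; apply: eq_bigr => j _; rewrite ffunE exprD. Qed.

Lemma mdegreeD m m' : mdegree [ffun j => (m j + m' j)%N] = (mdegree m + mdegree m')%N.
Proof. by rewrite -big_split; apply: eq_bigr => j _; rewrite ffunE. Qed.

Lemma forms_mono R m : subring R -> forms R (mdegree m) (monomial m).
Proof. by move=> rR; apply: Span_id => //; exists m. Qed.

Lemma formsX R i d : subring R -> forms R d (x i ^+ d).
Proof.
move=> rR; pose m := [ffun j => if j == i then d else 0%N].
have <- : monomial m = x i ^+ d.
  rewrite /monomial (bigD1 i) //= big1 ?mulr1 ?ffunE ?eqxx // => j /negbTE ji.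
  by rewrite ffunE ji.
have <- : mdegree m = d.
  rewrite /mdegree (bigD1 i) //= big1 ?addn0 ?ffunE ?eqxx // => j /negbTE ji.
  by rewrite ffunE ji.
exact: forms_mono.
Qed.

Lemma formsZ R d a z : subring R -> R a -> forms R d z -> forms R d (a * z).
Proof. by move=> rR Ra; apply: (@SpanS K K^o). Qed.

Lemma formsM R d e F G : subring R -> forms R d F -> forms R e G -> forms R (d + e) (F * G).
Proof.
move=> rR SF SG; elim: SF => [|a _ w Ra [m <- ->] _ IH]; first by rewrite mul0r; apply: Span0.
rewrite mulrDl; apply: SpanD => //; rewrite /GRing.scale /= -mulrA.
apply: formsZ => //; elim: SG => [|b _ v Rb [m' <- ->] _ IH']; first by rewrite mulr0; apply: Span0.
rewrite mulrDr; apply: SpanD => //; rewrite /GRing.scale /= mulrCA.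
by apply: formsZ => //; rewrite monomialD -mdegreeD; apply: forms_mono.
Qed.

Lemma forms0 R a : subring R -> R a -> forms R 0 a.
Proof. by move=> rR Ra; rewrite -[a]mulr1; apply: formsZ => //; apply: (Span_id rR);
  exists [ffun=> 0%N]; rewrite /mdegree /monomial ?big1 // => j _; rewrite ffunE. Qed.

Lemma chartR_up R i d e z : subring R -> (d <= e)%N ->
  forms R d (z * x i ^+ d) -> forms R e (z * x i ^+ e).
Proof.
move=> rR de Fz; rewrite -(subnKC de) exprD mulrA.
by apply: formsM => //; apply: formsX.
Qed.

Lemma chartR_subring R i : subring R -> subring (chartR R i).
Proof.
move=> rR; split.
- by exists 0%N; rewrite mul1r; apply: formsX.
- move=> a b [d Fa] [e Fb]; exists (d + e)%N; rewrite mulrBl; apply: SpanB => //.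
    by apply: chartR_up Fa; rewrite // leq_addr.
  by apply: chartR_up Fb; rewrite // leq_addl.
- move=> a b [d Fa] [e Fb]; exists (d + e)%N; rewrite exprD mulrACA.
  exact: formsM.
Qed.

Lemma chartR_sub R i : subring R -> R `<=` chartR R i.
Proof. by move=> rR a Ra; exists 0%N; rewrite mulr1; apply: forms0. Qed.

Lemma chartR_ratio R i j : subring R -> chartR R i (x j / x i).
Proof. by move=> rR; exists 1%N; rewrite expr1 divfK //; apply: (formsX j 1 rR). Qed.

Lemma chartR_form R i d F : forms R d F -> chartR R i (F / x i ^+ d).
Proof. by move=> FF; exists d; rewrite divfK ?expf_neq0. Qed.

Lemma chartR_min R i C : subring R -> subring C -> R `<=` C ->
  (forall j, C (x j / x i)) -> chartR R i `<=` C.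
Proof.
move=> rR rC RC xC z [d Fz].
have -> : z = z * x i ^+ d / x i ^+ d by rewrite mulfK ?expf_neq0.
elim: Fz => [|a _ w Ra [m md ->] _ IH]; first by rewrite mul0r; apply: subring0.
rewrite mulrDl; apply: subringD => //; rewrite /GRing.scale /= -mulrA.
apply: subringM => //; first exact: RC.
have -> : monomial m / x i ^+ d = \prod_j (x j / x i) ^+ m j.
  rewrite -md /monomial /mdegree -prodrXr -prodf_div.
  by apply: eq_bigr => j _; rewrite expr_div_n.
by apply: subring_prod => // j _; apply: subringX.
Qed.

Lemma chartR_noeth R i : subring R -> noeth R -> noeth (chartR R i).
Proof.
move=> rR nR; have [B [rB nB RB sB Bmin]] := noeth_fg [seq x j / x i | j <- enum J] rR nR.
suff -> : chartR R i = B by [].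
apply/seteqP; split.
  apply: chartR_min => // j; apply: sB.
  have : x j / x i \in [seq x j / x i | j <- enum J] by apply: map_f; rewrite mem_enum.
  exact.
apply: Bmin; [exact: chartR_subring|exact: chartR_sub|].
by move=> z /mapP[j _ ->]; apply: chartR_ratio.
Qed.

(* The forms of degree #|J| d form a finite module that y maps to itself, since
   each monomial of this degree has a factor x i ^+ d. *)
Lemma integral_of_charts R y : subring R -> (0 < #|J|)%N -> (forall i, chartR R i y) ->
  exists ns : seq K, forall l, @Span K K^o R [set` ns] (y ^+ l).
Proof.
move=> rR J0 yR; have [d dP] : exists d, forall i, forms R d (y * x i ^+ d).
  have [g gP] : exists g : J -> nat, forall i, forms R (g i) (y * x i ^+ g i).
    by have /choice[g gP] := yR; exists g.
  exists (\sum_i g i)%N => i; apply: chartR_up (gP i) => //.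
  by rewrite (bigD1 i) //= leq_addr.
pose D := (#|J| * d)%N.
have yM z : forms R D z -> forms R D (y * z).
  elim=> [|a _ w Ra [m md ->] _ IH]; first by rewrite mulr0; apply: Span0.
  rewrite mulrDr; apply: SpanD => //; rewrite /GRing.scale /= mulrCA.
  apply: formsZ => //.
  have [i mi] : exists i, (d <= m i)%N.
    apply: contrapT => /forallNP h.
    have [d0|d0] := posnP d.
      by case/card_gt0P: J0 => i _; apply: (h i); rewrite d0.
    have : (\sum_j m j <= \sum_(j : J) d.-1)%N.
      by apply: leq_sum => j _; have /negP := h j; rewrite -ltnNge; lia.
    rewrite sum_nat_const -/(mdegree m) md /D leq_pmul2l //; lia.
  pose m' := [ffun j => if j == i then (m j - d)%N else m j].
  have mE : monomial m = x i ^+ d * monomial m'.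
    rewrite /monomial (bigD1 i) //= [in RHS](bigD1 i) //= mulrA ffunE eqxx -exprD subnKC //.
    by congr (_ * _); apply: eq_bigr => j /negbTE ji; rewrite ffunE ji.
  have mD : D = (d + mdegree m')%N.
    rewrite -md /mdegree (bigD1 i) //= [in RHS](bigD1 i) //= addnA ffunE eqxx subnKC //.
    by congr (_ + _)%N; apply: eq_bigr => j /negbTE ji; rewrite ffunE ji.
  by rewrite mE mulrA [in forms R D]mD; apply: formsM => //; apply: forms_mono.
have [i0 _] := card_gt0P J0.
pose ms := [seq [ffun j => val (m j)] | m : {ffun J -> 'I_D.+1}].
exists [seq monomial m / x i0 ^+ D | m <- ms] => l.
have : forms R D (y ^+ l * x i0 ^+ D).
  elim: l => [|l IH]; first by rewrite mul1r; apply: formsX.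
  by rewrite exprS -mulrA; apply: yM.
suff gen z : forms R D z ->
    @Span K K^o R [set` [seq monomial m / x i0 ^+ D | m <- ms]] (z / x i0 ^+ D).
  by move/gen; rewrite mulfK ?expf_neq0.
elim=> [|a _ w Ra [m md ->] _ IH]; first by rewrite mul0r; apply: Span0.
rewrite mulrDl; apply: SpanD => //; rewrite /GRing.scale /= -mulrA.
apply: (@SpanS K K^o) => //; apply: Span_id => //.
have mm : m \in ms.
  apply/mapP; exists [ffun j => inord (m j)]; first by rewrite mem_enum.
  by apply/ffunP => j; rewrite !ffunE /= inordK // ltnS -md /mdegree (bigD1 j) //= leq_addr.
have : monomial m / x i0 ^+ D \in [seq monomial m / x i0 ^+ D | m <- ms] by apply: map_f.
exact.
Qed.

End Forms.

(** * Points of a projective model *)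

Section FiniteSets.
Variable T : Type.

Lemma finite_set_ind (P : set T -> Prop) : P set0 ->
  (forall a F, P F -> P (a |` F)) -> forall F, finite_set F -> P F.
Proof.
move=> P0 PU F /(@finite_seqP {classic T})[s ->]; elim: s => [|a s IH].
  suff -> : [set` ([::] : seq {classic T})] = set0 by [].
  by apply/seteqP; split.
suff -> : [set` (a :: s)] = a |` [set` s] by apply: PU.
apply/seteqP; split=> z; rewrite /= in_cons; first by case/orP => [/eqP|]; [left|right].
by move=> [->|zs]; rewrite ?eqxx // [X in _ || X]zs orbT.
Qed.

Lemma finite_bound (F : set T) (g : T -> nat) : finite_set F ->
  exists N, forall a, F a -> (g a <= N)%N.
Proof.
move: F; apply: finite_set_ind => [|a F [N FN]]; first by exists 0%N.
by exists (maxn (g a) N) => b [->|/FN h]; rewrite leq_max ?leqnn ?h ?orbT.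
Qed.

Lemma finite_common_multiple (F : set T) (g : T -> nat) : finite_set F ->
  (forall a, F a -> 0 < g a)%N ->
  exists2 N, (0 < N)%N & forall a, F a -> (g a %| N)%N.
Proof.
move: F; apply: finite_set_ind => [|a F IH] H; first by exists 1%N.
have [|N N0 FN] := IH; first by move=> b Fb; apply: H; right.
exists (g a * N)%N; first by rewrite muln_gt0 N0 H //; left.
by move=> b [->|/FN h]; [apply: dvdn_mulr|apply: dvdn_mull].
Qed.

End FiniteSets.

Lemma noeth_image (L M : comNzRingType) (f : {rmorphism L -> M}) (A : set L) :
  injective f -> noeth A -> noeth (f @` A).
Proof.
move=> injf nA I IA mI; have [||s sI Is] := nA [set a : L^o | A a /\ I (f a)].
- by move=> a [].
- split.
    split; last by rewrite rmorph0; case: mI.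
    have [a0 Aa0 fa0] := IA _ mI.1.
    by have -> : 0 = a0 :> L by apply: injf; rewrite fa0 rmorph0.
  move=> a b c Aa [Ab Ib] [Ac Ic]; have Ic' : I (f (a *: b + c)).
    rewrite rmorphD rmorphM; apply: (mI.2 (f a) (f b) (f c)) => //.
  by split=> //; have [d Ad /injf <-] := IA _ Ic'.
exists [seq f a | a <- s].
  by move=> z /mapP[a /sI[_ Ifa] ->].
move=> z Iz; have [a Aa az] := IA _ Iz.
have /Is : [set a : L^o | A a /\ I (f a)] a by split => //; rewrite az.
rewrite -{}az; elim=> [|b c d Ab sc _ IH].
  by rewrite [f _](rmorph0 f); apply: Span0.
have -> : f (b *: c + d) = f b *: (f c : M^o) + f d by rewrite rmorphD rmorphM.
apply: SpanZ => //.
have : f c \in [seq f a | a <- s] by apply: map_f.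
exact.
Qed.

Lemma image_subring (L M : comNzRingType) (f : {rmorphism L -> M}) (A : set L) :
  subring A -> subring (f @` A).
Proof.
move=> rA; split.
- by exists 1; [exact: subring1|exact: rmorph1].
- by move=> _ _ [a Aa <-] [b Ab <-]; exists (a - b); rewrite ?rmorphB //; exact: subringB.
- by move=> _ _ [a Aa <-] [b Ab <-]; exists (a * b); rewrite ?rmorphM //; exact: subringM.
Qed.

(** A projective model with all coordinates nonzero; for a variety, the charts with x_i = 0 are
    empty and are left out of the index set. *)
Record chart_data (K : fieldType) (R0 : set K) (J : finType) (x : J -> K) : Prop := ChartData {
  cd_subring : subring R0;
  cd_noeth : noeth R0;
  cd_neq0 : forall j, x j != 0;
  cd_frac : exists i, forall z, exists a b,
    [/\ chartR x R0 i a, chartR x R0 i b, b != 0 & z = a / b] }.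

Section ChartPoints.
Variables (K : fieldType) (R0 : set K) (J : finType) (x : J -> K).
Hypothesis cd : chart_data R0 x.

Let rR0 : subring R0. Proof. exact: cd_subring cd. Qed.
Let nR0 : noeth R0. Proof. exact: cd_noeth cd. Qed.
Let x_neq0 : forall j, x j != 0. Proof. exact: cd_neq0 cd. Qed.
Let fracJ := cd_frac cd.

Let A := chartR x R0.
Let rA i : subring (A i). Proof. exact: chartR_subring. Qed.
Let nA i : noeth (A i). Proof. exact: chartR_noeth. Qed.

Definition chart_points : set (set K) :=
  [set O | exists i P, prime_ideal (A i) P /\ O = localization (A i) P].
Let pt := chart_points.
Implicit Types (O E : set K) (U : set (set K)).

Lemma pt_local O : pt O -> local_ring O.
Proof. by move=> [i [P [pP ->]]]; apply: loc_local. Qed.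

Lemma pt_subring O : pt O -> subring O. Proof. by move/pt_local=> []. Qed.

Lemma pt_noeth O : pt O -> noeth O.
Proof. by move=> [i [P [pP ->]]]; apply: noeth_loc. Qed.

Lemma pt_chart O : pt O -> exists i, A i `<=` O.
Proof. by move=> [i [P [pP ->]]]; exists i; apply: loc_sub. Qed.

Lemma pt_const O : pt O -> R0 `<=` O.
Proof. by move/pt_chart=> [i AO]; apply: subset_trans AO; apply: chartR_sub. Qed.

Lemma chart_prime O i : pt O -> A i `<=` O -> prime_ideal (A i) (A i `&` nonunits O).
Proof. by move=> ptO AO; apply: prime_preim => //; apply: pt_local. Qed.

(* If z is a unit of a local ring V containing O = (A_i)_P and P consists of
   nonunits of V, then z is already a unit of O. *)
Lemma loc_preim_unit i V z : local_ring V -> A i `<=` V ->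
  localization (A i) (A i `&` nonunits V) z -> z != 0 -> V z^-1 ->
  localization (A i) (A i `&` nonunits V) z^-1.
Proof.
move=> lV AV [a [b [Aa Ab Pb ->]]] ab0; rewrite invf_div => Vba.
have b0 : b != 0 by apply: contraNneq ab0 => ->; rewrite invr0 mulr0.
have a0 : a != 0 by apply: contraNneq ab0 => ->; rewrite mul0r.
exists b, a; split=> // -[_ [_ nua]]; apply: Pb; split=> //.
have [rV [_ _ PM _ _]] := lV.
have -> : b = b / a * a by rewrite divfK.
by apply: PM => //; split=> //; exact: AV.
Qed.

(** A point given in a chart l is seen in each chart i whose ring it contains: x_l / x_i is a unit
    of O, hence of (A_i)_P by [loc_preim_unit], so that (A_i)_P contains A_l. *)
Lemma pt_chartE O i : pt O -> A i `<=` O -> O = localization (A i) (A i `&` nonunits O).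
Proof.
move=> ptO AO; have lO := pt_local ptO; have pP := chart_prime ptO AO.
apply/seteqP; split; last first.
  by apply: sub_loc => // a Aa h nua; apply: h.
set O' := localization _ _; have rO' : subring O' by apply: loc_subring.
have O'A : A i `<=` O' by apply: loc_sub.
have [l [P [pP' OE]]] := ptO.
have lO' : local_ring O' by apply: loc_local.
have O'l : A l `<=` O'.
  apply: chartR_min => //; first by apply: subset_trans O'A; apply: chartR_sub.
  move=> j; have -> : x j / x l = x j / x i * (x l / x i)^-1.
    by rewrite invf_div mulrA divfK.
  apply: subringM => //; first by apply: O'A; apply: chartR_ratio.
  apply: loc_preim_unit => //.
  - by apply: O'A; apply: chartR_ratio.
  - by rewrite mulf_neq0 ?invr_eq0.
  - by rewrite invf_div OE; apply: loc_sub => //; apply: chartR_ratio.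
rewrite {1}OE; apply: sub_loc => // a Ala Pa; have a0 := prime_nz pP' Pa.
have Oa : O a^-1 by rewrite OE; exists 1, a; rewrite mul1r; split=> //; exact: subring1.
move=> [_]; apply; split=> //; first exact: O'l.
by apply: loc_preim_unit => //; apply: O'l.
Qed.

Lemma ratio_chart O i : pt O -> (forall j, O (x j / x i)) -> A i `<=` O.
Proof.
by move=> ptO Ox; apply: chartR_min => //; [exact: pt_subring|exact: pt_const].
Qed.

Definition dominated (T : set K) O :=
  forall z, O z -> T z /\ (z != 0 -> T z^-1 -> O z^-1).

(** Separatedness, for any ring T that dominates both points. If O1' contains A_i and O2' contains
    A_l, then x_l / x_i is a unit of T, hence of O1', which therefore contains A_l and its
    localization O2'. *)
Lemma pt_sep O1 O2 T : pt O1 -> pt O2 -> dominated T O1 -> dominated T O2 -> O1 = O2.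
Proof.
suff sub O1' O2' : pt O1' -> pt O2' -> dominated T O1' -> dominated T O2' -> O2' `<=` O1'.
  by move=> *; apply/seteqP; split; apply: sub.
move=> {O1 O2} pt1 pt2 d1 d2; have r1 := pt_subring pt1.
have [i Ai] := pt_chart pt1; have [l Al] := pt_chart pt2.
have O1il : O1' (x i / x l).
  rewrite -invf_div; have [] := d1 (x l / x i).
    by apply: Ai; apply: chartR_ratio.
  move=> _; apply; first by rewrite mulf_neq0 ?invr_eq0.
  rewrite invf_div; have [] // := d2 (x i / x l); first by apply: Al; apply: chartR_ratio.
have Al1 : A l `<=` O1'.
  apply: ratio_chart => // j; have -> : x j / x l = x j / x i * (x i / x l) by rewrite mulrA divfK.
  by apply: subringM => //; apply: Ai; apply: chartR_ratio.
rewrite (pt_chartE pt2 Al); apply: sub_loc => //.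
- exact: chart_prime.
- exact: pt_local.
move=> a Aa h [_]; apply; have [a0 O2a O2a'] : unit_in O2' a.
  apply: nonunitsP; first exact: Al.
  by move=> nu; apply: h; split.
split=> //; first exact: Al1.
have [_ ] := d1 a (Al1 _ Aa); apply=> //.
by have [] := d2 _ O2a'.
Qed.

Lemma pt_gen O Q : pt O -> prime_ideal O Q -> pt (localization O Q).
Proof.
move=> ptO pQ; have rO := pt_subring ptO; have [i Ai] := pt_chart ptO.
have [[QO Q0] QD QM Q1 Qp] := pQ.
have pP : prime_ideal (A i) (A i `&` Q).
  split.
  - by split=> [z []//|]; split=> //; exact: subring0.
  - by move=> a b [Aa Qa] [Ab Qb]; split; [exact: subringD|exact: QD].
  - by move=> a b Aa [Ab Qb]; split; [exact: subringM|apply: QM => //; exact: Ai].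
  - by case.
  - by move=> a b Aa Ab [_ /(Qp _ _ (Ai _ Aa) (Ai _ Ab))[]]; [left|right].
exists i, (A i `&` Q); split=> //; apply/seteqP; split; last first.
  move=> _ [a [b [Aa Ab Pb ->]]]; exists a, b; split; try exact: Ai; last by [].
  by move=> Qb; apply: Pb.
apply: sub_loc => //; first exact: loc_local.
  rewrite {1}(pt_chartE ptO Ai); apply: sub_loc => //.
  - exact: chart_prime.
  - exact: loc_local.
  - exact: loc_sub.
  move=> a Aa h /(loc_nonunit _ pP Aa)[//|_ Qa]; apply: h; split=> //.
  split; first exact: Ai.
  move=> [a0 _ Oa]; apply: Q1; rewrite -(mulVf a0); exact: QM.
move=> a Oa Qa; have := Oa; rewrite {1}(pt_chartE ptO Ai) => -[c [d [Ac Ad Pd aE]]].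
have d0 : d != 0 by apply: (prime_nz (chart_prime ptO Ai)) Pd.
have Qd : ~ (A i `&` Q) d.
  move=> [_ Qd]; apply: Pd; split=> //; split; first exact: Ai.
  move=> [_ _ Od]; apply: Q1; rewrite -(mulVf d0); exact: QM.
rewrite aE => /(loc_nonunitE _ pP Ac Ad Qd)[//|_ Qc].
have : Q (d * a) by rewrite aE mulrC divfK.
by move/(Qp _ _ (Ai _ Ad) Oa) => [] // Qd'; apply: Qd.
Qed.

Lemma fracA i z : exists a b, [/\ A i a, A i b, b != 0 & z = a / b].
Proof.
have [l H] := fracJ; have [a [b [Aa Ab b0 ->]]] := H z.
have [d Fa] := Aa; have [e Fb] := Ab.
have xn n : (x i) ^+ n != 0 by rewrite expf_neq0.
have xn' n : (x l) ^+ n != 0 by rewrite expf_neq0.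
have Fa' := chartR_up rR0 (leq_addr e d) Fa.
have Fb' := chartR_up rR0 (leq_addl d e) Fb.
exists (a * x l ^+ (d + e) / x i ^+ (d + e)), (b * x l ^+ (d + e) / x i ^+ (d + e)); split.
- exact: chartR_form.
- exact: chartR_form.
- by rewrite !mulf_neq0 ?invr_eq0.
- by field; rewrite xn xn' b0.
Qed.

Lemma pt_generic : pt setT.
Proof.
have [i _] := fracJ; exists i, [set 0]; split; first exact: zero_prime.
apply/seteqP; split=> // z _; have [a [b [Aa Ab b0 ->]]] := fracA i z.
by exists a, b; split=> //= b0'; move: b0; rewrite b0' eqxx.
Qed.

Lemma card_charts : (0 < #|J|)%N.
Proof. by have [i _] := fracJ; apply/card_gt0P; exists i. Qed.

Definition zopen U := U `<=` pt /\
  forall O, U O -> exists s : seq K, [set` s] `<=` O /\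
    forall O', pt O' -> [set` s] `<=` O' -> U O'.

Lemma zopen_sup U O O' : zopen U -> U O -> pt O' -> O `<=` O' -> U O'.
Proof.
by move=> [Upt UO] /UO[s [sO sU]] ptO' OO'; apply: sU => //; apply: subset_trans OO'.
Qed.

Lemma zopen_pt : zopen pt.
Proof. by split=> // O ptO; exists [::]; split. Qed.

Lemma zopenI U V : zopen U -> zopen V -> zopen (U `&` V).
Proof.
move=> [Upt Uo] [Vpt Vo]; split=> [O [/Upt]//|O [/Uo[s [sO sU]] /Vo[t [tO tV]]]].
exists (s ++ t); split=> [z|O' ptO' stO'].
  by rewrite /= mem_cat => /orP[/sO|/tO].
split; first by apply: sU => // z zs; apply: stO'; rewrite /= mem_cat [X in X || _]zs.
by apply: tV => // z zt; apply: stO'; rewrite /= mem_cat [X in _ || X]zt orbT.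
Qed.

Lemma zopen_mem (z : K) : zopen [set O | pt O /\ O z].
Proof.
split=> [O []//|O [ptO Oz]]; exists [:: z]; split.
  by move=> y; rewrite /= inE => /eqP ->.
by move=> O' ptO' h; split=> //; apply: h; rewrite /= inE.
Qed.

Lemma zopen_avoid U (F : set (set K)) : zopen U -> finite_set F ->
  zopen [set O | U O /\ forall E, F E -> ~ O `<=` E].
Proof.
move=> oU; move: F; apply: finite_set_ind => [|E F oF].
  have -> : [set O | U O /\ forall E, set0 E -> ~ O `<=` E] = U.
    by apply/seteqP; split=> [O []//|O UO]; split.
  exact: oU.
split=> [O [/(oU.1)]//|O [UO FO]].
have [z Oz Ez] : exists2 z, O z & ~ E z.
  apply: contrapT => h; apply: (FO E); first by left.
  by move=> z Oz; apply: contrapT => Ez; apply: h; exists z.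
have [s [sO sP]] : exists s : seq K, [set` s] `<=` O /\
    forall O', pt O' -> [set` s] `<=` O' -> U O' /\ forall E, F E -> ~ O' `<=` E.
  by apply: (oF.2 O); split=> // E' FE'; apply: FO; right.
exists (z :: s); split=> [y|O' ptO' zsO'].
  by rewrite /= in_cons => /orP[/eqP ->|/sO].
have [|UO' FO'] := sP O' ptO'.
  by move=> y ys; apply: zsO'; rewrite /= in_cons [X in _ || X]ys orbT.
split=> // E' [->|/FO' //] O'E; apply: Ez; apply: O'E; apply: zsO'.
exact: mem_head.
Qed.

Lemma zopen_generic U : zopen U -> U !=set0 -> U setT.
Proof. by move=> oU [O UO]; apply: (zopen_sup oU UO) => //; apply: pt_generic. Qed.

(** On the chart i, the b whose basic open set is contained in a single W O' lie in no common prime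
    ideal; writing 1 as a finite combination of them leaves finitely many O'. *)
Lemma quasi_compact (W : set K -> set (set K)) :
  (forall O, pt O -> zopen (W O) /\ W O O) ->
  exists F, [/\ finite_set F, F `<=` pt & forall O, pt O -> exists2 O', F O' & W O' O].
Proof.
move=> HW.
have chartF i : exists F, [/\ finite_set F, F `<=` pt &
    forall O, pt O -> A i `<=` O -> exists2 O', F O' & W O' O].
  pose S : set K := [set b | A i b /\ exists2 O', pt O' &
    forall O, pt O -> A i `<=` O -> ~ nonunits O b -> W O' O].
  have SF z : @Span K K^o (A i) S z -> A i z /\ exists F, [/\ finite_set F, F `<=` pt &
      forall O, pt O -> A i `<=` O -> ~ nonunits O z -> exists2 O', F O' & W O' O].
    elim=> [|a v w Aa [Av [O' ptO' O'P]] _ [Aw [F [fF Fpt FP]]]].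
      split; first exact: subring0.
      exists set0; split=> // O ptO AO; case; split; first by apply: AO; apply: subring0.
      by case; rewrite eqxx.
    split; first by apply: subringD => //; apply: subringM.
    exists (O' |` F); split.
    - by rewrite finite_setU; split=> //; apply: finite_set1.
    - by move=> O [->|/Fpt].
    move=> O ptO AO nu; have [rO [_ PD PM _ _]] := pt_local ptO.
    have [nuv|nuv] := pselect (nonunits O v); last first.
      by exists O'; [left|apply: O'P].
    have [|O2 FO2 WO2] := FP O ptO AO; last by exists O2 => //; right.
    by move=> nuw; apply: nu; apply: PD => //; apply: PM => //; apply: AO.
  have S1 : @Span K K^o (A i) S 1.
    apply: (unit_ideal (rA i) (@nA i)).
      by split; [move=> z /SF[]|exact: Span_submod].
    move=> P pP; set O := localization (A i) P.
    have ptO : pt O by exists i, P.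
    have [oW WO] := HW O ptO; have [s [sO sW]] := oW.2 O WO.
    have [b Ab [Pb sb]] : exists2 b, A i b & ~ P b /\
        forall z, z \in s -> forall O', pt O' -> A i `<=` O' -> ~ nonunits O' b -> O' z.
      elim: s sO {sW} => [|z s IH] sO.
        by exists 1; [exact: subring1|split=> //; case: pP].
      have [|b Ab [Pb bP]] := IH.
        by move=> y ys; apply: sO; rewrite /= in_cons [X in _ || X]ys orbT.
      have [c [d [Ac Ad Pd zE]]] : O z by apply: sO; apply: mem_head.
      exists (b * d); first exact: subringM.
      split; first by case: pP => _ _ _ _ h /(h _ _ Ab Ad)[].
      move=> y ys O' ptO' AO' nu; have [rO' [_ _ PM _ _]] := pt_local ptO'.
      move: ys; rewrite in_cons => /orP[/eqP ->|ys]; last first.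
        apply: (bP _ ys) => // nub; apply: nu; rewrite mulrC; apply: PM => //; exact: AO'.
      rewrite zE; apply: subringM => //; first exact: AO'.
      have [] // := @nonunitsP K O' d; first exact: AO'.
      by move=> nud; apply: nu; apply: PM => //; exact: AO'.
    exists b => //; apply: Span_id => //; split=> //; exists O => // O' ptO' AO' nub.
    by apply: sW => // z zs; apply: (sb z).
  have [_ [F [fF Fpt FP]]] := SF _ S1; exists F; split=> // O ptO AO.
  by apply: FP => //; case: (pt_local ptO) => _ [].
have /choice[Fi FiP] := chartF.
exists (\bigcup_(i in [set: J]) Fi i); split.
- by apply: bigcup_finite => // i _; case: (FiP i).
- by move=> O [i _]; case: (FiP i) => _ Fpt _ /Fpt.
- move=> O ptO; have [i Ai] := pt_chart ptO; have [_ _ h] := FiP i.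
  by have [O' FO' WO'] := h O ptO Ai; exists O' => //; exists i.
Qed.

Definition local_hom (g : K -> K) O O' :=
  forall z, O' z -> O (g z) /\ (unit_in O (g z) -> unit_in O' z).

Section Morphism.
Variable f : {rmorphism K -> K}.
Hypothesis f_const : forall c, R0 c -> f c = c.
Hypothesis f_pt : forall O, pt O -> exists2 O', pt O' & local_hom f O O'.

Lemma local_hom_dominated O O' : local_hom f O O' -> dominated [set z | O (f z)] O'.
Proof.
move=> d z O'z; have [Ofz u] := d z O'z; split=> // z0; rewrite /= fmorphV => Ofz'.
by have [] : unit_in O' z by apply: u; split=> //; rewrite fmorph_eq0.
Qed.

Lemma local_hom_uniq O O1 O2 : pt O1 -> pt O2 ->
  local_hom f O O1 -> local_hom f O O2 -> O1 = O2.
Proof.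
by move=> p1 p2 d1 d2; exact: pt_sep p1 p2 (local_hom_dominated d1) (local_hom_dominated d2).
Qed.

Lemma preim_prime O V : subring O -> local_ring V -> (forall z, O z -> V (f z)) ->
  prime_ideal O [set z | O z /\ nonunits V (f z)].
Proof.
move=> rO [rV [[_ N0] ND NM N1 Np]] OV; split.
- by split=> [z []//|]; split; rewrite ?rmorph0 //; exact: subring0.
- by move=> a b [Oa Na] [Ob Nb]; split; [exact: subringD|rewrite rmorphD; exact: ND].
- by move=> a b Oa [Ob Nb]; split; [exact: subringM|rewrite rmorphM; apply: NM => //; exact: OV].
- by case; rewrite rmorph1.
- by move=> a b Oa Ob [_]; rewrite rmorphM => /(Np _ _ (OV _ Oa) (OV _ Ob))[]; [left|right].
Qed.

(** The localization at Q is the center of V on Spec O along f. Together with [pt_sep], this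
    computes images of points. *)
Lemma preim_dominated O V : pt O -> local_ring V -> (forall z, O z -> V (f z)) ->
  let Q := [set z | O z /\ nonunits V (f z)] in
  dominated [set z | V (f z)] (localization O Q).
Proof.
move=> ptO lV OV Q _ [a [b [Oa Ob Qb ->]]]; have [rV [_ _ NM N1 _]] := lV.
have [fb0 _ Vb] : unit_in V (f b).
  by apply: nonunitsP; [exact: OV|move=> nu; apply: Qb].
split; first by rewrite /= rmorphM fmorphV; apply: subringM => //; exact: OV.
move=> ab0; rewrite /= invf_div rmorphM fmorphV => Vba.
exists b, a; split=> // -[_ nua]; apply: Qb; split=> //.
have a0 : f a != 0 by apply: contraNneq ab0 => /eqP; rewrite fmorph_eq0 => /eqP ->; rewrite mul0r.
by rewrite -(divfK a0 (f b)); apply: NM.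
Qed.

Lemma local_hom_mono O E O1 E1 : pt O -> pt E -> pt O1 -> pt E1 -> O `<=` E ->
  local_hom f O O1 -> local_hom f E E1 -> O1 `<=` E1.
Proof.
move=> ptO ptE pt1 ptE1 OE d d'.
have O1E z : O1 z -> E (f z) by move=> O1z; apply: OE; have [] := d z O1z.
have pQ := preim_prime (pt_subring pt1) (pt_local ptE) O1E.
have /= dQ := preim_dominated pt1 (pt_local ptE) O1E.
rewrite (pt_sep ptE1 (pt_gen pt1 pQ) (local_hom_dominated d') dQ).
by apply: loc_sub => //; exact: pt_subring.
Qed.

(* Each prime of O1[x_j / x_i] lies over a point of the i-th chart, whose image
   is a generization of O1. *)
Lemma integral_over_pt O1 y : pt O1 ->
  (forall O' O'', pt O' -> pt O'' -> local_hom f O' O'' -> O1 `<=` O'' -> O' y) ->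
  exists ns : seq K, forall l, @Span K K^o (f @` O1) [set` ns] (y ^+ l).
Proof.
move=> pt1 H; have r1 := pt_subring pt1; set R := f @` O1.
have rR : subring R by apply: image_subring.
have nR : noeth R by apply: noeth_image; [exact: fmorph_inj|exact: pt_noeth].
apply: (integral_of_charts x_neq0) => //; first exact: card_charts.
move=> i; have rT : subring (chartR x R i) by apply: chartR_subring.
apply: mem_all_loc => //; first exact: chartR_noeth.
move=> Q pQ; set V := localization _ Q.
have lV : local_ring V by apply: loc_local.
have TV : chartR x R i `<=` V by apply: loc_sub.
have RT : R `<=` chartR x R i by apply: chartR_sub.
have AV : A i `<=` V.
  apply: subset_trans TV; apply: chartR_min => //; last by move=> j; apply: chartR_ratio.
  by move=> c R0c; apply: RT; exists c; [exact: pt_const|exact: f_const].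
have pP := prime_preim (rA i) lV AV.
have ptO' : pt (localization (A i) (A i `&` nonunits V)) by exists i, (A i `&` nonunits V).
set O' := localization _ _ in ptO'.
have O'V : O' `<=` V by apply: sub_loc => // a Aa h nu; apply: h.
have [O'' ptO'' d] := f_pt ptO'.
apply: (O'V); apply: (H _ _ ptO' ptO'' d).
have OV z : O1 z -> V (f z) by move=> Oz; apply: TV; apply: RT; exists z.
have d1 : dominated [set z | V (f z)] O''.
  move=> z O''z; have [O'fz u] := d z O''z; split; first exact: (O'V _ O'fz).
  move=> z0; rewrite /= fmorphV => Vz.
  have [] // : unit_in O'' z.
  apply: u; split=> //; first by rewrite fmorph_eq0.
  by apply: loc_preim_unit => //; rewrite fmorph_eq0.
have pQ1 := preim_prime r1 lV OV; have /= d2 := preim_dominated pt1 lV OV.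
rewrite (pt_sep ptO'' (pt_gen pt1 pQ1) d1 d2).
exact: loc_sub.
Qed.

End Morphism.

End ChartPoints.

(** * Discrete valuation rings *)

Section Integrality.
Variable K : fieldType.
Implicit Types (A E : set K).

Lemma Span_seq A (V : lmodType K) (s : seq V) v : subring A -> Span A [set` s] v ->
  exists2 c : 'I_(size s) -> K, (forall i, A (c i)) & v = \sum_(i < size s) c i *: s`_i.
Proof.
move=> rA; elim=> [|a w v' Aa sw _ [c Ac ->]].
  exists (fun=> 0); first by move=> _; apply: subring0.
  by rewrite big1 // => i _; rewrite scale0r.
have ws : (index w s < size s)%N by rewrite index_mem.
exists (fun i => c i + (if i == Ordinal ws then a else 0)).
  by move=> i; apply: subringD => //; case: ifP => // _; apply: subring0.
under [RHS]eq_bigr do rewrite scalerDl.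
rewrite big_split /= addrC; congr (_ + _).
rewrite (bigD1 (Ordinal ws)) //= eqxx nth_index // big1 ?addr0 // => i /negbTE ->.
by rewrite scale0r.
Qed.

Lemma poly_subring A : subring A -> subring [set q : {poly K} | forall i, A q`_i].
Proof.
move=> rA; split=> [i|q r Aq Ar i|q r Aq Ar i].
- by rewrite coef1; apply: subring_nat.
- by rewrite coefB; apply: subringB.
- by rewrite coefM; apply: subring_sum => // j _; apply: subringM.
Qed.

Lemma det_subring (L : comNzRingType) (A : set L) n (M : 'M[L]_n) : subring A ->
  (forall i j, A (M i j)) -> A (\det M).
Proof.
move=> rA AM; apply: subring_sum => // s _; apply: subringM => //.
  by apply: subringX => //; apply: (subringN rA); apply: subring1.
exact: subring_prod.
Qed.

Lemma char_poly_subring A n (M : 'M[K]_n) : subring A -> (forall i j, A (M i j)) ->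
  forall i, A (char_poly M)`_i.
Proof.
move=> rA AM; apply: (det_subring (poly_subring rA)) => i j k; rewrite !mxE coefB coefMn coefX coefC.
apply: subringB => //; first by rewrite -[_ *+ (i == j)]mulr_natr; exact: (subringM rA (subring_nat rA _) (subring_nat rA _)).
by case: ifP => // _; apply: subring0.
Qed.

Lemma polyOver_set A (q : {poly K}) : (forall i, A q`_i) -> q \is a polyOver (mem A).
Proof. by move=> Aq; rewrite qualifE; apply/(all_nthP 0) => i _; apply/mem_set/Aq. Qed.

(** Determinant trick: y is an eigenvalue, with eigenvector s, of a matrix over A, hence a root of
    its characteristic polynomial. *)
Lemma faithful_integral A (s : seq K) y : subring A -> int_closed A ->
  (exists2 z, z \in s & z != 0) ->
  (forall z, z \in s -> @Span K K^o A [set` s] (y * z)) -> A y.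
Proof.
move=> rA clA [z0 z0s z00] H.
have /choice[c cP] : forall i : 'I_(size s), exists c : 'I_(size s) -> K,
    (forall j, A (c j)) /\ y * s`_i = \sum_(j < size s) c j * s`_j.
  move=> i; have [c Ac cE] := @Span_seq A K^o s (y * s`_i) rA (H _ (mem_nth 0 (ltn_ord i))).
  by exists c.
pose C := \matrix_(j, i) c i j.
apply: (clA y (char_poly C)); first exact: char_poly_monic.
  by apply: polyOver_set; apply: char_poly_subring => // a b; rewrite mxE; case: (cP b).
rewrite -eigenvalue_root_char; apply/eigenvalueP.
exists (\row_i s`_i).
  apply/rowP => i; rewrite !mxE; have [_ ->] := cP i.
  by apply: eq_bigr => j _; rewrite !mxE mulrC.
apply: contraNneq z00 => /rowP h.
have zs : (index z0 s < size s)%N by rewrite index_mem.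
by have := h (Ordinal zs); rewrite !mxE nth_index // => ->.
Qed.

End Integrality.

Section DVR.
Variable K : fieldType.
Implicit Types (E : set K) (z : K).

Definition dvr E := subring E /\ exists2 t, uniformizer E t & t != 0 /\
  forall z, z != 0 -> exists u (m : int), unit_in E u /\ z = u * t ^ m.

(** Take b outside aE with a maximal colon ideal (aE : b). This ideal is prime and contains a, so it
    is the maximal ideal m, and y = b / a satisfies ym in E but is not in E. If ym were in m, y
    would be integral by [faithful_integral]; thus yt is a unit for some t in m, and t generates
    m. *)
Lemma normal_dvr E : local_ring E -> noeth E -> int_closed E -> dim1_local E ->
  (forall z, exists a b, [/\ E a, E b, b != 0 & z = a / b]) -> dvr E.
Proof.
move=> [rE pm] nE clE [EK dim1] frac; have [[mE m0] mD mM m1 mp] := pm.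
have [a ma a0] : exists2 a, nonunits E a & a != 0.
  apply: contrapT => h; apply: EK; apply/seteqP; split=> // z _.
  have [b [c [Eb Ec c0 ->]]] := frac z; apply: subringM => //.
  have [] // : unit_in E c.
  apply: nonunitsP => // nuc; apply: h; by exists c.
pose Ia c : set K := [set z | exists2 e, E e & z = c * e].
have idIa c : E c -> ideal E (Ia c).
  move=> Ec; split; first by move=> _ [e Ee ->]; apply: subringM.
  split; first by exists 0; [exact: subring0|rewrite mulr0].
  move=> d _ _ Ed [e Ee ->] [e' Ee' ->]; exists (d * e + e').
    by apply: subringD => //; apply: subringM.
  by rewrite /GRing.scale /=; ring.
have Ea : E a by apply: mE.
have Ia1 : ~ Ia a 1.
  move=> [e Ee e1]; apply: m1; rewrite e1 mulrC; exact: mM.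
pose col c : set K := [set z | E z /\ Ia a (c * z)].
have idcol c : ideal E (col c).
  split; first by move=> z [].
  split; first by split; [exact: subring0|rewrite mulr0; exact: ideal0 (idIa _ Ea)].
  move=> d z w Ed [Ez Iz] [Ew Iw]; rewrite /GRing.scale /=; split.
    by apply: subringD => //; apply: subringM.
  rewrite mulrDr mulrCA; apply: (idealD rE (idIa _ Ea)) => //.
  exact: (idealM (idIa _ Ea)).
pose F : set (set K) := [set I | exists c, [/\ E c, ~ Ia a c & I = col c]].
have [||M [b [Eb Ib ->]] Mmax] := @ideal_max K E rE nE F (col 1).
- by move=> _ [c [_ _ ->]].
- by exists 1; split=> //; exact: subring1.
have colp : prime_ideal E (col b).
  split.
  - by split; [case: (idcol b)|exact: ideal0 (idcol b)].
  - by move=> z w; apply: (idealD rE (idcol b)).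
  - by move=> z w; apply: (idealM (idcol b)).
  - by move=> [_]; rewrite mulr1.
  move=> z w Ez Ew [_ Izw]; have [Iz|Iz] := pselect (Ia a (b * z)); first by left.
  right; apply: (Mmax (col (b * z))).
  - by exists (b * z); split=> //; apply: subringM.
  - move=> y [Ey Iy]; split=> //; rewrite mulrAC mulrC.
    exact: (idealM (idIa _ Ea)).
  - by split=> //; rewrite -mulrA.
have cola : col b a by split=> //; exists b => //; rewrite mulrC.
have colm : col b = nonunits E.
  case: (dim1 _ colp) => // c0; move: cola; rewrite c0 => /eqP; by rewrite (negbTE a0).
pose y := b / a.
have ym z : nonunits E z -> E (y * z).
  rewrite -colm => -[Ez [e Ee be]]; have -> : y * z = e by rewrite /y mulrAC be mulrAC divff // mul1r.
  by [].
have Ey : ~ E y.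
  by move=> Ey; apply: Ib; exists y => //; rewrite /y mulrC divfK.
have idm : ideal E (nonunits E) by apply: prime_ideal_ideal.
have [s sm ms] := nE _ idm.1 idm.2.
have [t mt ut] : exists2 t, nonunits E t & unit_in E (y * t).
  apply: contrapT => h; apply: Ey; apply: (@faithful_integral K E s) => //.
    apply: contrapT => hs; move: a0; have := ms _ ma.
    suff S0 z : @Span K K^o E [set` s] z -> z = 0 by move/S0 ->; rewrite eqxx.
    elim=> // c v w Ec sv _ ->; rewrite addr0; have [->|v0] := eqVneq v 0; first exact: mulr0.
    by case: hs; exists v.
  move=> z zs; apply: ms; apply: contrapT => nu; apply: h; exists z; first exact: sm.
  apply: nonunitsP => //; apply: ym; exact: sm.
have t0 : t != 0 by case: ut; rewrite mulf_eq0 negb_or => /andP[].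
have unift : uniformizer E t.
  split; first exact: mE.
  apply/seteqP; split=> [z mz|_ [z Ez <-]]; last by rewrite mulrC; apply: mM.
  have [yt0 _ Eyt] := ut; exists (y * z * (y * t)^-1); first by apply: subringM => //; apply: ym.
  have y0 : y != 0 by move: yt0; rewrite mulf_eq0 negb_or => /andP[].
  by field; rewrite y0 t0.
split=> //; exists t => //; split=> //.
(* Division by t stops after at most N steps, because z divides t ^+ N. *)
have fact N z : (exists2 c, E c & z * c = t ^+ N) -> E z ->
    exists u (n : nat), unit_in E u /\ z = u * t ^+ n.
  elim: N z => [|N IH] z [c Ec zc] Ez.
    exists z, 0%N; rewrite mulr1; split=> //.
    have z0 : z != 0 by apply/eqP => z0; move/eqP: zc; rewrite z0 mul0r expr0 eq_sym oner_eq0.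
    by split=> //; rewrite -[z^-1]mulr1 -[X in _ * X]/(t ^+ 0) -zc mulrA mulVf // mul1r.
  have [mz|nz] := pselect (nonunits E z); last first.
    by exists z, 0%N; rewrite mulr1; split=> //; exact: nonunitsP.
  have [_ mt'] := unift; move: mz zc; rewrite mt' => -[z' Ez' <-] zc.
  have [||u [n [uu ->]]] := IH z' => //.
    by exists c => //; apply: (mulfI t0); rewrite mulrA zc exprS.
  by exists u, n.+1; split=> //; rewrite exprS mulrCA.
(* No prime ideal but m contains z, so t lies in the radical of zE. *)
have factE z : E z -> z != 0 -> exists u (n : nat), unit_in E u /\ z = u * t ^+ n.
  move=> Ez z0; have [N [c Ec ct]] : exists N, Ia z (t ^+ N).
    apply: (prime_radical rE nE (idIa z Ez)); first exact: mE.
    move=> P pP IP; case: (dim1 P pP) => [P0|->//].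
    have : P z by apply: IP; exists 1; [exact: subring1|rewrite mulr1].
    by rewrite P0 => /eqP; rewrite (negbTE z0).
  by apply: (fact N z) => //; exists c.
move=> z z0; have [c [d [Ec Ed d0 zE]]] := frac z.
have c0 : c != 0 by apply: contraNneq z0 => c0; rewrite zE c0 mul0r.
have [u [n [[u0 Eu Eu'] cE]]] := factE c Ec c0; have [u' [n' [[u0' Eu2 Eu2'] dE]]] := factE d Ed d0.
exists (u / u'), (n%:Z - n'%:Z); split.
  split; first by rewrite mulf_neq0 ?invr_eq0.
    exact: subringM.
  by rewrite invf_div; apply: subringM.
rewrite zE cE dE expfzDr // -exprnP -exprnN; field; rewrite u0' expf_neq0 //.
Qed.

Section Valuation.
Variables (E : set K) (dE : dvr E).
Let v := vord E.
Let rE : subring E. Proof. by case: dE. Qed.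

Lemma unit_inM a b : unit_in E a -> unit_in E b -> unit_in E (a * b).
Proof.
move=> [a0 Ea Ea'] [b0 Eb Eb']; split; rewrite ?mulf_neq0 ?invfM //; exact: subringM.
Qed.

Lemma unit_inV a : unit_in E a -> unit_in E a^-1.
Proof. by move=> [a0 Ea Ea']; split; rewrite ?invr_eq0 ?invrK. Qed.

Lemma unit_inXz a (m : int) : unit_in E a -> unit_in E (a ^ m).
Proof.
have X n : unit_in E a -> unit_in E (a ^+ n).
  by move=> [a0 Ea Ea']; split; rewrite ?expf_neq0 -?exprVn //; exact: subringX.
by move=> ua; case: m => n; rewrite ?NegzE -?exprnN; [exact: X|apply/unit_inV/X].
Qed.

Lemma uniformizer_exp t u (m : int) : uniformizer E t -> t != 0 ->
  unit_in E u -> unit_in E (u * t ^ m) -> m = 0.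
Proof.
move=> [Et mt] t0 uu uut.
have utm : unit_in E (t ^ m).
  have -> : t ^ m = u^-1 * (u * t ^ m) by rewrite mulrA mulVf ?mul1r //; case: uu.
  by apply: unit_inM => //; exact: unit_inV.
have pos n : ~ unit_in E (t ^+ n.+1).
  move=> [_ _ Etn]; have : nonunits E t by rewrite mt; exists 1; [exact: subring1|rewrite mulr1].
  move=> [_]; apply; split=> //; have -> : t^-1 = t ^+ n * (t ^+ n.+1)^-1.
    by rewrite exprS invfM mulrC mulfVK // expf_neq0.
  by apply: subringM => //; exact: subringX.
case: m utm {uut} => [[|n]|n] utm //; first by case: (pos n).
by case: (pos n); rewrite -[_ ^+ _]invrK; apply: unit_inV.
Qed.

Lemma vordE t u (m : int) : uniformizer E t -> unit_in E u -> v (u * t ^ m) = m.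
Proof.
move=> ut uu; have [_ [t1 ut1 [t10 fact]]] := dE.
have nz t' : uniformizer E t' -> t' != 0.
  move=> [Et' mt']; apply/eqP => t'0; have : nonunits E t1.
    by case: ut1 => Et1 ->; exists 1; [exact: subring1|rewrite mulr1].
  by rewrite mt' => -[z _]; rewrite t'0 mul0r => /esym/eqP; rewrite (negbTE t10).
have t0 := nz _ ut.
rewrite /v /vord; set S := [set _ | _]; have Sm : S m by exists t, u.
case: xgetP => [m' _ [t' [u' [ut' uu' e]]]|h]; last by case: (h m).
have t'0 := nz _ ut'.
have [w uw tE] : exists2 w, unit_in E w & t' = w * t.
  have div a b : uniformizer E a -> uniformizer E b -> exists2 w, E w & b = w * a.
    move=> [_ ma] [Eb mb]; have : nonunits E b.
      by rewrite mb; exists 1; [exact: subring1|rewrite mulr1].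
    by rewrite ma => -[w Ew <-]; exists w; rewrite // mulrC.
  have [w Ew tE] := div _ _ ut ut'; have [w' Ew' tE'] := div _ _ ut' ut.
  have ww : w' * w = 1 by apply: (mulIf t0); rewrite mul1r -mulrA -tE -tE'.
  have w0 : w != 0 by apply/eqP => w0; move/eqP: ww; rewrite w0 mulr0 eq_sym oner_eq0.
  by exists w => //; split=> //; rewrite -[w^-1]mul1r -ww mulfK.
have : unit_in E (u' * w ^ m' * t ^ (m' - m)).
  suff -> : u' * w ^ m' * t ^ (m' - m) = u by [].
  have [w0 _ _] := uw; move: e; rewrite tE exprMz_comm ?unitfE //; last exact: mulrC.
  rewrite expfzDr // -invr_expz mulrA => e; rewrite mulrA -e mulfK //.
  exact: expfz_neq0.
move=> uu2; have := uniformizer_exp ut t0 (unit_inM uu' (unit_inXz m' uw)) uu2.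
by move/eqP; rewrite subr_eq0 => /eqP.
Qed.

Lemma vordP z : z != 0 -> exists t u, [/\ uniformizer E t, t != 0, unit_in E u & z = u * t ^ v z].
Proof.
move=> z0; have [_ [t ut [t0 fact]]] := dE; have [u [m [uu zE]]] := fact z z0.
by exists t, u; split=> //; rewrite {2}zE vordE.
Qed.

Lemma unit1 : unit_in E 1.
Proof. by split; rewrite ?oner_neq0 ?invr1 //; exact: subring1. Qed.

Lemma vordM a b : a != 0 -> b != 0 -> v (a * b) = v a + v b.
Proof.
move=> a0 b0; have [_ [t ut [t0 fact]]] := dE.
have [u [m [uu aE]]] := fact a a0; have [u' [m' [uu' bE]]] := fact b b0.
rewrite aE bE mulrACA -expfzDr // !vordE //; exact: unit_inM.
Qed.

Lemma vord_unit a : unit_in E a -> v a = 0.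
Proof. by move=> ua; have [_ [t ut _]] := dE; rewrite -[a]mulr1 -(expr0z t) vordE. Qed.

Lemma vord1 : v 1 = 0. Proof. exact: vord_unit unit1. Qed.

Lemma vordV a : a != 0 -> v a^-1 = - v a.
Proof.
move=> a0; have a0' : a^-1 != 0 by rewrite invr_eq0.
by have := vordM a0 a0'; rewrite divff // vord1 => h; lia.
Qed.

Lemma vordX a n : a != 0 -> v (a ^+ n) = v a *+ n.
Proof.
move=> a0; elim: n => [|n IH]; first exact: vord1.
by rewrite exprS vordM ?expf_neq0 // IH mulrS.
Qed.

Lemma vordXz a (m : int) : a != 0 -> v (a ^ m) = v a * m.
Proof.
move=> a0; case: m => n; first by rewrite -exprnP vordX // -mulr_natr natz.
by rewrite NegzE -exprnN vordV ?expf_neq0 // vordX // mulrN -mulr_natr natz.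
Qed.

Lemma vord_uniformizer t : uniformizer E t -> v t = 1.
Proof. by move=> ut; rewrite -[t]mul1r -[t]expr1z vordE //; exact: unit1. Qed.

(** Encodes v(0) = infinity: [vord E 0] is only the default value 0 of [xget]. *)
Definition vge (m : int) z := (z == 0) || (m <= v z).

Lemma vge0 m : vge m 0. Proof. by rewrite /vge eqxx. Qed.

Lemma mem_vge z : E z <-> vge 0 z.
Proof.
have [->|z0] := eqVneq z 0; first by split=> _; [exact: vge0|exact: subring0].
rewrite /vge (negbTE z0) /=; have [t [u [ut t0 uu zE]]] := vordP z0.
have [u0 Eu Eu'] := uu; have Et := ut.1.
split=> [Ez|]; last first.
  by rewrite zE vordE // => m0; apply: subringM => //; case: (v z) m0 => // n _; apply: subringX.
rewrite leNgt; apply/negP; case vz: (v z) => [n|n] // _.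
have : unit_in E (t ^ (- n.+1%:Z)).
  split; first exact: expfz_neq0.
    have -> : t ^ (- n.+1%:Z) = u^-1 * z by rewrite zE vz NegzE mulrA mulVf ?mul1r.
    exact: subringM.
  by rewrite -exprnN invrK; apply: subringX.
by rewrite -[_ ^ _]mul1r => h; have := uniformizer_exp ut t0 unit1 h; lia.
Qed.

Lemma vge_le m n z : m <= n -> vge n z -> vge m z.
Proof. by rewrite /vge; case: eqP => //= _; apply: le_trans. Qed.

Lemma vgeM m n a b : vge m a -> vge n b -> vge (m + n) (a * b).
Proof.
rewrite /vge mulf_eq0; have [//|a0] := eqVneq a 0; have [//|b0] := eqVneq b 0.
by rewrite /= vordM //; apply: lerD.
Qed.

Lemma vge_eq m z : z != 0 -> vge m z = (m <= v z).
Proof. by rewrite /vge => /negbTE ->. Qed.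

Lemma vge_shift m c z : c != 0 -> vge (m + v c) (z * c) = vge m z.
Proof.
move=> c0; rewrite /vge mulf_eq0 (negbTE c0) orbF; case: eqP => //= /eqP z0.
by rewrite vordM // lerD2r.
Qed.

Lemma vgeE m c z : c != 0 -> v c = m -> vge m z <-> E (z / c).
Proof.
move=> c0 vc; rewrite mem_vge -(@vge_shift 0 c) // divfK // add0r vc; by split.
Qed.

Lemma exists_vord m : exists2 c, c != 0 & v c = m.
Proof.
have [_ [t ut [t0 _]]] := dE; exists (t ^ m); first exact: expfz_neq0.
by rewrite -[_ ^ _]mul1r vordE //; exact: unit1.
Qed.

Lemma vgeD m a b : vge m a -> vge m b -> vge m (a + b).
Proof.
have [c c0 vc] := exists_vord m.
have h z := vgeE z c0 vc => /h Ea /h Eb; apply/h.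
by rewrite mulrDl; apply: subringD.
Qed.

Lemma vgeN m a : vge m (- a) = vge m a.
Proof.
have h1 : vge 0 (-1) by apply/mem_vge; apply: (subringN rE); exact: subring1.
have sub b : vge m b -> vge m (- b) by move=> h; have := vgeM h1 h; rewrite add0r mulN1r.
by apply/idP/idP => /sub //; rewrite opprK.
Qed.

Lemma vgeX m a n : vge m a -> vge (m *+ n) (a ^+ n).
Proof.
move=> ma; elim: n => [|n IH]; first by apply/mem_vge; exact: subring1.
by rewrite exprS mulrS; apply: vgeM.
Qed.

Lemma vge_sum m I (r : seq I) (P : pred I) F :
  (forall i, P i -> vge m (F i)) -> vge m (\sum_(i <- r | P i) F i).
Proof. by move=> H; apply: (big_ind (vge m)) => //; [exact: vge0|move=> a b; exact: vgeD]. Qed.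

Lemma vge_vord z : vge (v z) z. Proof. by rewrite /vge lexx orbT. Qed.

Lemma exists_vbound (s : seq K) : exists N : nat, forall z, z \in s -> vge (- N%:Z) z.
Proof.
elim: s => [|z s [N NP]]; first by exists 0%N.
exists (maxn N `|v z|%N) => y; rewrite in_cons => /orP[/eqP ->|/NP]; last first.
  by apply: vge_le; rewrite lerN2 lez_nat leq_maxl.
apply: (vge_le _ (vge_vord z)); apply: (@le_trans _ _ (- `|v z|%N%:Z)); last by lia.
by rewrite lerN2 lez_nat leq_maxr.
Qed.

Lemma nonunits_vge z : nonunits E z <-> vge 1 z.
Proof.
have [_ [t [Et mt] [t0 _]]] := dE; rewrite mt.
rewrite (vgeE z t0); last exact: vord_uniformizer.
split=> [[a Ea <-]|Ezt]; first by rewrite mulrAC divff // mul1r.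
by exists (z / t) => //; rewrite mulrC divfK.
Qed.

Lemma unit_vord z : z != 0 -> v z = 0 -> unit_in E z.
Proof.
by move=> z0 vz; split=> //; apply/mem_vge; rewrite vge_eq ?invr_eq0 ?vordV ?vz // oppr0.
Qed.

Lemma dvr_maximal E' : subring E' -> E `<=` E' -> E' = E \/ E' = setT.
Proof.
move=> rE' EE'; have [[z E'z Ez]|h] := pselect (exists2 z, E' z & ~ E z); last first.
  by left; apply/seteqP; split=> // z E'z; apply: contrapT => Ez; apply: h; exists z.
right; have z0 : z != 0 by apply/eqP => z0; apply: Ez; rewrite z0; exact: subring0.
have vz : v z < 0.
  by rewrite ltNge; apply/negP => vz; apply/Ez/mem_vge; rewrite vge_eq.
apply/seteqP; split=> // y _.
have -> : y = z ^+ `|v y|%N * (y / z ^+ `|v y|%N) by rewrite mulrC divfK // expf_neq0.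
apply: subringM => //; first exact: subringX.
apply: EE'; apply/mem_vge; have [->|y0] := eqVneq y 0; first by rewrite mul0r vge0.
rewrite vge_eq ?mulf_neq0 ?invr_eq0 ?expf_neq0 // vordM ?invr_eq0 ?expf_neq0 //.
rewrite vordV ?expf_neq0 // vordX // -mulr_natr.
move: (v z) (v y) vz => a b; nia.
Qed.

End Valuation.
End DVR.

(** * Prime divisors and sections *)

Lemma ext_prime (K : fieldType) (A P Q : set K) : subring A -> prime_ideal A P ->
  prime_ideal A Q -> P `<=` Q ->
  prime_ideal (localization A Q) [set z | exists a b, [/\ P a, A b, ~ Q b & z = a / b]].
Proof.
move=> rA pP pQ PQ; have [[PA P0] PD PM P1 Pp] := pP; have [_ _ _ Q1 Qp] := pQ.
have nQ a b : A a -> A b -> ~ Q a -> ~ Q b -> ~ Q (a * b).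
  by move=> Aa Ab Qa Qb /(Qp _ _ Aa Ab)[].
split.
- split=> [_ [a [b [Pa Ab Qb ->]]]|]; first by exists a, b; split=> //; apply: PA.
  by exists 0, 1; rewrite mul0r; split=> //; apply: subring1.
- move=> _ _ [a [b [Pa Ab Qb ->]]] [c [d [Pc Ad Qd ->]]].
  have b0 := prime_nz pQ Qb; have d0 := prime_nz pQ Qd.
  exists (a * d + c * b), (b * d); split; rewrite ?addf_div //.
  + by apply: PD; rewrite mulrC; apply: PM.
  + exact: subringM.
  + exact: nQ.
- move=> _ _ [a [b [Aa Ab Qb ->]]] [c [d [Pc Ad Qd ->]]].
  exists (a * c), (b * d); split; rewrite ?mulf_div //.
  + exact: PM.
  + exact: subringM.
  + exact: nQ.
- move=> [a [b [Pa Ab Qb]]] h; apply: Qb; apply: PQ.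
  have b0 : b != 0 by apply/eqP => b0; move/eqP: h; rewrite b0 invr0 mulr0 oner_eq0.
  by rewrite -[b]mul1r h divfK.
move=> _ _ [a [b [Aa Ab Qb ->]]] [c [d [Ac Ad Qd ->]]] [e [g [Pe Ag Qg]]].
have b0 := prime_nz pQ Qb; have d0 := prime_nz pQ Qd; have g0 := prime_nz pQ Qg.
rewrite mulf_div => /eqP; rewrite eqr_div ?mulf_neq0 // => /eqP h.
have : P (a * c * g) by rewrite h mulrC; apply: PM => //; apply: subringM.
case/(Pp _ _ (subringM rA Aa Ac) Ag); last by move/PQ.
by case/(Pp _ _ Aa Ac) => Px; [left; exists a, b|right; exists c, d].
Qed.

(** Used to clear poles: c is invertible at the point P and vanishes to order n along finitely many
    divisors that do not pass through P. It is a product of n-th powers of elements outside P, each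
    a nonunit of one E. *)
Lemma avoid_finite (K : fieldType) (A P : set K) (F : set (set K)) (n : nat) :
  subring A -> prime_ideal A P -> finite_set F ->
  (forall E, F E -> [/\ dvr E, A `<=` E & ~ localization A P `<=` E]) ->
  exists c, [/\ A c, ~ P c & forall E, F E -> vge E n c].
Proof.
move=> rA pP; move: F; apply: finite_set_ind => [|E F IH] H.
  by exists 1; split=> //; [exact: subring1|case: pP].
have [|c [Ac Pc cF]] := IH; first by move=> E' FE'; apply: H; right.
have [dE AE PE] := H E (or_introl erefl); have [rE _] := dE.
have [d [Ad Pd nd]] : exists d, [/\ A d, ~ P d & nonunits E d].
  apply: contrapT => h; apply: PE => _ [a [b [Aa Ab Pb ->]]].
  apply: subringM => //; first exact: AE.
  have [] // : unit_in E b.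
  apply: nonunitsP; first exact: AE.
  by move=> nb; apply: h; exists b.
have Pdn : ~ P (d ^+ n).
  have [[PA _] _ _ P1 Pp] := pP; elim: n {IH cF H} => [|n IH] //.
  by rewrite exprS => /(Pp _ _ Ad (subringX rA n Ad))[].
exists (c * d ^+ n); split.
- by apply: subringM => //; exact: subringX.
- by have [_ _ _ _ h] := pP => /(h _ _ Ac (subringX rA n Ad))[].
move=> E' [->|FE'].
  rewrite -[n%:Z]add0r; apply: vgeM => //; first by apply/(mem_vge dE); apply: AE.
  by move/(nonunits_vge dE): nd => /(vgeX dE n); rewrite natz.
have [dE' AE' _] := H E' (or_intror FE').
by rewrite -[n%:Z]addr0; apply: vgeM => //; [exact: cF|apply/(mem_vge dE'); apply: AE'; exact: subringX].
Qed.

Section PrimeDivisors.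
Variables (K : fieldType) (R0 : set K) (J : finType) (x : J -> K).
Hypothesis cd : chart_data R0 x.
Let rR0 : subring R0. Proof. exact: cd_subring cd. Qed.
Let nR0 : noeth R0. Proof. exact: cd_noeth cd. Qed.
Let x_neq0 : forall j, x j != 0. Proof. exact: cd_neq0 cd. Qed.
Let A := chartR x R0.
Let rA i : subring (A i). Proof. exact: chartR_subring. Qed.
Let nA i : noeth (A i). Proof. exact: chartR_noeth. Qed.
Let pt := chart_points R0 x.
Hypothesis normal : forall O, pt O -> int_closed O.
Implicit Types (O E : set K) (U : set (set K)) (G : set K -> int).

Definition pdiv E := chart_points R0 x E /\ dim1_local E.

Lemma pdiv_dvr E : pdiv E -> dvr E.
Proof.
move=> [ptE d1]; apply: normal_dvr => //.
- exact: pt_local ptE.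
- exact: pt_noeth ptE.
- exact: normal.
move=> z; have [i Ai] := pt_chart cd ptE.
have [a [b [Aa Ab b0 ->]]] := fracA cd i z.
by exists a, b; split=> //; apply: Ai.
Qed.

Lemma pdiv_neqT E : pdiv E -> E <> setT. Proof. by move=> [_ []]. Qed.

Lemma pdiv_eq E E' : pdiv E -> pdiv E' -> E `<=` E' -> E = E'.
Proof.
move=> pE pE' EE'; have rE' : subring E' by case: (pdiv_dvr pE').
by have [//|] := dvr_maximal (pdiv_dvr pE) rE' EE'; move/(pdiv_neqT pE').
Qed.

(** By [ext_prime], P extends to a nonzero prime ideal of E, which can only be the maximal one. *)
Lemma pdiv_minimal i E P : pdiv E -> A i `<=` E -> prime_ideal (A i) P ->
  P `<=` nonunits E -> (exists2 a, P a & a != 0) -> E = localization (A i) P.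
Proof.
move=> [ptE d1] AE pP PE [a Pa a0].
have pQ := chart_prime cd ptE AE; have EE := pt_chartE cd ptE AE.
rewrite {1}EE; congr localization; apply/seteqP; split; last first.
  by move=> z Pz; split; [case: pP => -[PA _] _ _ _ _; apply: PA|apply: PE].
have PQ : P `<=` A i `&` nonunits E.
  by move=> z Pz; split; [case: pP => -[PA _] _ _ _ _; apply: PA|apply: PE].
have := ext_prime (rA i) pP pQ PQ; rewrite -EE; set PP := (X in prime_ideal E X) => pPP.
have PPa : PP a by exists a, 1; rewrite divr1; split=> //; [exact: subring1|case: pQ].
case: (d1.2 PP pPP) => [PP0|PPE].
  by move: PPa; rewrite PP0 => /eqP; rewrite (negbTE a0).
move=> z [Az]; rewrite -PPE => -[c [d [Pc Ad Qd zE]]].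
have d0 := prime_nz pQ Qd; have [_ _ _ _ Pp] := pP.
have : P (z * d) by rewrite zE divfK.
by case/(Pp _ _ Az Ad) => // /PQ.
Qed.

(** In a chart, a divisor where a function a of A_i has nonzero order is the localization at a
    minimal prime ideal over a, and these are finite in number. *)
Lemma finite_div z : z != 0 -> finite_set [set E | pdiv E /\ vord E z != 0].
Proof.
move=> z0; have fin1 i a : A i a -> a != 0 ->
    finite_set [set E | [/\ pdiv E, A i `<=` E & vord E a != 0]].
  move=> Aa a0; pose I : set K := [set b | exists2 c, A i c & b = c * a].
  have iI : ideal (A i) I.
    split; first by move=> _ [c Ac ->]; apply: subringM.
    split; first by exists 0; [exact: subring0|rewrite mul0r].
    move=> b _ _ Ab [c Ac ->] [d Ad ->]; exists (b * c + d).
      by apply: subringD => //; apply: subringM.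
    by rewrite /GRing.scale /= mulrDl mulrA.
  have [F [fF FI FP]] := finite_minimal_primes (rA i) (@nA i) iI.
  apply: (sub_finite_set _ (finite_image (localization (A i)) fF)).
  move=> E [pE AE va]; have dE := pdiv_dvr pE.
  have Ea : nonunits E a.
    by split; [exact: AE|move=> ua; move: va; rewrite vord_unit].
  have pQ := chart_prime cd pE.1 AE.
  have [|P FP' [pP PQ]] := FP _ pQ.
    move=> _ [c Ac ->]; split; first exact: subringM.
    have [_ [_ _ NM _ _]] := pt_local cd pE.1.
    by apply: NM => //; exact: AE.
  exists P => //; apply/esym/pdiv_minimal => //; first by move=> b /PQ[].
  by exists a => //; apply: (FI P FP'); exists 1; [exact: subring1|rewrite mul1r].
have fini i : finite_set [set E | [/\ pdiv E, A i `<=` E & vord E z != 0]].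
  have [a [b [Aa Ab b0 zE]]] := fracA cd i z.
  have a0 : a != 0 by apply: contraNneq z0 => a0; rewrite zE a0 mul0r.
  apply: (@sub_finite_set _ _ ([set E | [/\ pdiv E, A i `<=` E & vord E a != 0]] `|`
    [set E | [/\ pdiv E, A i `<=` E & vord E b != 0]])); last first.
    by rewrite finite_setU; split; apply: fin1.
  move=> E [pE AE]; have dE := pdiv_dvr pE.
  rewrite zE (vordM dE) ?(vordV dE) ?invr_eq0 // => h. have [va|va] := eqVneq (vord E a) 0; last by left.
  by right; split=> //; apply: contraNneq h => vb; rewrite va vb.
apply: (@sub_finite_set _ _ (\bigcup_(i in [set: J])
  [set E | [/\ pdiv E, A i `<=` E & vord E z != 0]])); last first.
  by apply: bigcup_finite => // i _; apply: fini.
by move=> E [pE vz]; have [i Ai] := pt_chart cd pE.1; exists i.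
Qed.

Definition fsupp G := finite_set [set E | pdiv E /\ G E != 0].

Lemma fsupp_comb G G' (m m' : int) : fsupp G -> fsupp G' -> fsupp (fun E => m * G E + m' * G' E).
Proof.
move=> fG fG'; apply: (@sub_finite_set _ _ ([set E | pdiv E /\ G E != 0] `|`
   [set E | pdiv E /\ G' E != 0])); last by rewrite finite_setU.
move=> E [pE]; have [->|GE] := eqVneq (G E) 0; last by left.
have [->|GE'] := eqVneq (G' E) 0; last by right.
by rewrite !mulr0 addr0 eqxx.
Qed.

Lemma fsupp0 : fsupp (fun=> 0).
Proof.
rewrite /fsupp (_ : [set _ | _] = set0) //.
by apply/seteqP; split=> // E [_]; rewrite eqxx.
Qed.

Lemma fsupp_ext G G' : (forall E, pdiv E -> G E = G' E) -> fsupp G -> fsupp G'.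
Proof. by move=> GG'; apply: sub_finite_set => E [pE]; rewrite -GG'. Qed.

Definition sec U G z := forall E, U E -> pdiv E -> vge E (- G E) z.

Lemma finite_bad G z : fsupp G -> z != 0 -> finite_set [set E | pdiv E /\ (G E != 0 \/ vord E z != 0)].
Proof.
move=> fG z0; apply: (@sub_finite_set _ _ ([set E | pdiv E /\ G E != 0] `|`
   [set E | pdiv E /\ vord E z != 0])); last by rewrite finite_setU; split=> //; exact: finite_div.
by move=> E [pE [|]]; [left|right].
Qed.

(** A section z of O(G) over the locus where y generates O(Y) extends after multiplication by a
    power of y. Only the finitely many E where G or z is nontrivial constrain T: there either y
    generates, or v(y) + Y is at least 1 and a large T wins. *)
Lemma clear_poles G (Y : set K -> int) y z : fsupp G -> y != 0 ->
  (forall E, pdiv E -> - Y E <= vord E y) ->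
  (forall E, pdiv E -> vord E y = - Y E -> vge E (- G E) z) ->
  exists T0, forall T, (T0 <= T)%N ->
    forall E, pdiv E -> vge E (- (G E + Y E *+ T)) (y ^+ T * z).
Proof.
move=> fG y0 Yy Hz; have [z0|z0] := eqVneq z 0.
  by exists 0%N => T _ E _; rewrite z0 mulr0 vge0.
have [T0 T0P] := finite_bound (fun E => `|G E|%N + `|vord E z|%N)%N (finite_bad fG z0).
exists T0 => T T0T E pE; have dE := pdiv_dvr pE.
rewrite vge_eq ?mulf_neq0 ?expf_neq0 // vordM ?expf_neq0 // vordX //.
have := Yy E pE; have := Hz E pE; rewrite vge_eq // -[Y E *+ T]mulr_natr.
rewrite -[vord E y *+ T]mulr_natr natz.
have [bad|good] := pselect (G E != 0 \/ vord E z != 0).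
  have {}T0P := leq_trans (T0P E (conj pE bad)) T0T.
  case: (eqVneq (vord E y) (- Y E)) => [->|ne] => [/(_ erefl)|_ le]; first lia.
  have {ne}le : - Y E + 1 <= vord E y by move/eqP: ne; lia.
  move: (G E) (Y E) (vord E y) (vord E z) T0P le => g y' w v' h le.
  have : 0 <= (w + y' - 1) * T by apply: mulr_ge0; lia.
  lia.
have G0 : G E = 0 by apply/eqP; apply: contrapT => /negP h; apply: good; left.
have v0 : vord E z = 0 by apply/eqP; apply: contrapT => /negP h; apply: good; right.
move=> _ le; rewrite G0 v0.
have : 0 <= (vord E y + Y E) * T by apply: mulr_ge0; lia.
lia.
Qed.

(** Each local ring is the intersection of the discrete valuation rings of divisors through it;
    [strong_hartogs] supplies this. *)
Hypothesis hartogs : forall O z, pt O -> (forall E, pdiv E -> O `<=` E -> E z) -> O z.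

Lemma chart_sec i z : (forall E, pdiv E -> A i `<=` E -> E z) -> A i z.
Proof.
move=> Hz; apply: mem_all_loc => // P pP; apply: hartogs; first by exists i, P.
by move=> E pE OE; apply: Hz => //; apply: subset_trans OE; apply: loc_sub.
Qed.

(** A function c with zeros of order at least G bounds the sections inside the A_i-module generated
    by 1 / c, and A_i is Noetherian. *)
Lemma sec_chart_fg i G : fsupp G -> exists s : seq K,
  forall z, sec [set E | A i `<=` E] G z <-> @Span K K^o (A i) [set` s] z.
Proof.
move=> fG; have [N NP] := finite_bound (fun E => `|G E|%N) fG.
have [||c [Ac c0 cP]] := @avoid_finite K (A i) [set 0]
   [set E | A i `<=` E /\ (pdiv E /\ G E != 0)] N (rA i) (zero_prime (rA i)).
- by apply: (sub_finite_set _ fG) => E [].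
- move=> E [AE [pE GE]]; split=> //; first exact: pdiv_dvr.
  move=> KE; apply: (pdiv_neqT pE); apply/seteqP; split=> // z _; apply: KE.
  have [a [b [Aa Ab b0 ->]]] := fracA cd i z.
  by exists a, b; split=> //= bz; move: b0; rewrite bz eqxx.
have {}c0 : c != 0 by apply/eqP.
have vc E : pdiv E -> A i `<=` E -> G E <= vord E c.
  move=> pE AE; have dE := pdiv_dvr pE.
  have [G0|G0] := eqVneq (G E) 0.
    by rewrite G0 -(vge_eq _ _ c0); apply/(mem_vge dE); apply: AE.
  have h := cP E (conj AE (conj pE G0)); rewrite vge_eq // in h.
  have := NP E (conj pE G0); lia.
pose N' : set K := sec [set E | A i `<=` E] G.
have mN : @submod K K^o (A i) N'.
  split; first by move=> E _ _; apply: vge0.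
  move=> a z w Aa Nz Nw E AE pE; apply: (vgeD (pdiv_dvr pE)); last exact: Nw.
  rewrite -[- _]add0r; apply: (vgeM (pdiv_dvr pE)); last exact: Nz.
  by apply/(mem_vge (pdiv_dvr pE)); apply: AE.
have [|t tN Nt] := @noeth_submod K (A i) K^o [:: c^-1] N' (rA i) (@nA i) mN.
  move=> z Nz; have Acz : A i (c * z).
    apply: chart_sec => E pE AE; have dE := pdiv_dvr pE; apply/(mem_vge dE).
    apply: (@vge_le _ _ _ (vord E c - G E)); first by rewrite subr_ge0; exact: vc.
    by apply: vgeM => //; [exact: vge_vord|exact: Nz].
  have -> : z = (c * z) *: (c^-1 : K^o) + 0 by rewrite addr0 /GRing.scale /=; field.
  by apply: SpanZ => //=; [rewrite inE|exact: Span0].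
exists t => z; split; first exact: Nt.
by apply: Span_min.
Qed.

(* The hyperplane divisor: x_i is a section of O(B) which generates it exactly
   over the i-th chart. *)
Definition Bdiv E : int := xget 0 [set b : int |
  (forall j, - b <= vord E (x j)) /\ exists j, vord E (x j) = - b].

Lemma BdivP E : pdiv E -> (forall j, - Bdiv E <= vord E (x j)) /\
  exists j, vord E (x j) = - Bdiv E.
Proof.
move=> pE; have [i Ai] := pt_chart cd pE.1.
rewrite /Bdiv; case: xgetP => [b _ //|h]; case: (h (- vord E (x i))); rewrite /= opprK.
split; last by exists i.
move=> j; have : E (x j / x i) by apply: Ai; apply: chartR_ratio.
have dE := pdiv_dvr pE.
by move/(mem_vge dE); rewrite vge_eq ?mulf_neq0 ?invr_eq0 // vordM ?vordV ?invr_eq0 // subr_ge0.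
Qed.

Lemma Bdiv_chart E i : pdiv E -> A i `<=` E <-> vord E (x i) = - Bdiv E.
Proof.
move=> pE; have dE := pdiv_dvr pE; have [Bge [j Bj]] := BdivP pE.
split=> [AE|vi].
  apply/eqP; rewrite eq_le Bge andbT -Bj -subr_ge0 -vordV // -vordM ?invr_eq0 //.
  rewrite -(@vge_eq _ _ _ (x j / x i)) ?mulf_neq0 ?invr_eq0 //.
  by apply/(mem_vge dE); apply: AE; apply: chartR_ratio.
apply: (ratio_chart cd pE.1) => l; apply/(mem_vge dE).
rewrite vge_eq ?mulf_neq0 ?invr_eq0 // vordM ?vordV ?invr_eq0 // subr_ge0 vi; exact: Bge.
Qed.

Lemma fsupp_Bdiv : fsupp Bdiv.
Proof.
apply: (@sub_finite_set _ _ (\bigcup_(j in [set: J]) [set E | pdiv E /\ vord E (x j) != 0])).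
  move=> E [pE BE]; have [_ [j vj]] := BdivP pE; exists j => //; split=> //.
  by rewrite vj oppr_eq0.
by apply: bigcup_finite => // j _; exact: finite_div.
Qed.

End PrimeDivisors.

(** * Koszul complexes *)

Section Koszul.
Variables (K : fieldType) (J : finType).
Implicit Types (i l : J) (I L : {set J}) (c : J -> K) (z : {set J} -> K).

Definition sgn i I : K := (-1) ^+ #|[set l in I | (enum_rank l < enum_rank i)%N]|.

(** With c = 1 this is the Cech differential on cochains indexed by sets of charts; with c = x it is
    the Koszul differential, multiplication by the sum of the x_i e_i in the exterior algebra. *)
Definition koszul c z I : K := \sum_(i in I) sgn i I * c i * z (I :\ i).

Definition contract i z I : K := if i \in I then 0 else sgn i (i |: I) * z (i |: I).

Lemma sgn_sq i I : sgn i I * sgn i I = 1.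
Proof. by rewrite -expr2 sqrr_sign. Qed.

Lemma sgn_rem i l I : l \in I -> l != i ->
  sgn i (I :\ l) = (if (enum_rank l < enum_rank i)%N then - sgn i I else sgn i I).
Proof.
move=> lI li; rewrite /sgn.
have -> : [set l' in I :\ l | (enum_rank l' < enum_rank i)%N] =
    [set l' in I | (enum_rank l' < enum_rank i)%N] :\ l.
  by apply/setP => l'; rewrite !inE andbA.
case: ifP => lti.
  rewrite [in RHS](cardsD1 l) !inE lI lti /= exprS mulN1r opprK.
  by [].
rewrite [in RHS](cardsD1 l) !inE lI lti /=.
by [].
Qed.

Lemma sgn_swap i l I : i \in I -> l \in I -> i != l ->
  sgn i I * sgn l (I :\ i) = - (sgn l I * sgn i (I :\ l)).
Proof.
move=> iI lI il; rewrite !sgn_rem // 1?eq_sym //.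
have : enum_rank i != enum_rank l by rewrite (inj_eq enum_rank_inj).
rewrite -(inj_eq val_inj) neq_ltn => /orP[h|h].
  by rewrite h ltnNge (ltnW h) /= mulrN [X in - X]mulrC.
by rewrite h ltnNge (ltnW h) /= mulrN opprK mulrC.
Qed.

Lemma koszulD c z z' I : koszul c (fun L => z L + z' L) I = koszul c z I + koszul c z' I.
Proof. by rewrite -big_split; apply: eq_bigr => i _; rewrite mulrDr. Qed.

Lemma koszulB c z z' I : koszul c (fun L => z L - z' L) I = koszul c z I - koszul c z' I.
Proof. by rewrite -sumrB; apply: eq_bigr => i _; rewrite mulrBr. Qed.

Lemma koszulZ c a z I : koszul c (fun L => a * z L) I = a * koszul c z I.
Proof. by rewrite mulr_sumr; apply: eq_bigr => i _; rewrite mulrCA. Qed.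

Lemma koszul_sum c (T : finType) (z : T -> {set J} -> K) I :
  koszul c (fun L => \sum_t z t L) I = \sum_t koszul c (z t) I.
Proof.
by rewrite exchange_big; apply: eq_bigr => i _; rewrite mulr_sumr.
Qed.

Lemma koszul0 c z I : (forall L, z L = 0) -> koszul c z I = 0.
Proof. by move=> z0; rewrite /koszul big1 // => i _; rewrite z0 mulr0. Qed.

Lemma eq_koszul c z z' I : z =1 z' -> koszul c z I = koszul c z' I.
Proof. by move=> e; apply: eq_bigr => i _; rewrite e. Qed.

Lemma koszulK c z I : koszul c (koszul c z) I = 0.
Proof.
pose a i l := sgn i I * sgn l (I :\ i) * (c i * c l * z (I :\ i :\ l)).
have -> : koszul c (koszul c z) I =
    \sum_(il | [&& il.1 \in I, il.2 \in I & il.1 != il.2]) a il.1 il.2.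
  rewrite -(pair_big_dep (mem I) (fun i l => (l \in I) && (i != l)) a) /=.
  apply: eq_bigr => i iI; rewrite mulr_sumr; apply: eq_big => [l|l _].
    by rewrite !inE andbC eq_sym.
  by rewrite /a; ring.
pose lt (il : J * J) := (enum_rank il.1 < enum_rank il.2)%N.
pose Pil (il : J * J) := [&& il.1 \in I, il.2 \in I & il.1 != il.2].
have swK : involutive (fun il : J * J => (il.2, il.1)) by case.
have e2 : \sum_(il | Pil il && ~~ lt il) a il.1 il.2 = \sum_(il | Pil il && lt il) a il.2 il.1.
  rewrite (reindex_inj (can_inj swK)) /=; apply: eq_bigl => -[i l].
  rewrite /Pil /lt /= [l == i]eq_sym andbCA; case: (eqVneq i l) => [->|il].
    by rewrite /= !andbF.
  rewrite -leqNgt leq_eqVlt.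
  have /negbTE -> // : val (enum_rank i) != val (enum_rank l).
  by rewrite (inj_eq val_inj) (inj_eq enum_rank_inj).
rewrite (bigID lt) /= [X in _ + X]e2 -big_split big1 // => -[i l] /andP[/and3P[/= iI lI il] _].
rewrite /a /= (sgn_swap iI lI il).
have -> : I :\ l :\ i = I :\ i :\ l.
  by apply/setP => m; rewrite !inE andbCA.
by ring.
Qed.

(** The homotopy formula for the interior product. Where c_i is invertible it makes the complex
    exact; where only [contract] is available it shows that c_i kills cohomology. *)
Lemma koszul_contract c i z I :
  koszul c (contract i z) I + contract i (koszul c z) I = c i * z I.
Proof.
rewrite {2}/contract; have [iI|iI] := boolP (i \in I).
  rewrite addr0 /koszul (bigD1 i) //= big1 ?addr0; last first.
    by move=> l /andP[lI li]; rewrite /contract !inE eq_sym li iI /= mulr0.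
  rewrite /contract !inE eqxx /= finset.setD1K //.
  have -> : sgn i I * c i * (sgn i I * z I) = sgn i I * sgn i I * (c i * z I) by ring.
  by rewrite sgn_sq mul1r.
rewrite {2}/koszul big_setU1 //= mulrDr !mulrA sgn_sq mul1r finset.setU1K // addrCA [X in _ + X](_ : _ = 0) ?addr0 //.
rewrite mulr_sumr /koszul -big_split big1 //= => l lI.
have li : l != i by apply: contraNneq iI => <-.
have lI' : l \in i |: I by rewrite !inE lI orbT.
have iI' : i \in i |: I by rewrite !inE eqxx.
have := sgn_swap iI' lI' (_ : i != l); rewrite eq_sym => /(_ li).
rewrite finset.setU1K // /contract.
have -> : (i \in I :\ l) = false by rewrite !inE (negbTE iI) andbF.
have -> : i |: I :\ l = (i |: I) :\ l.
  by apply/setP => m; rewrite !inE; case: eqVneq => // ->; rewrite eq_sym (negbTE li).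
set s1 := sgn i (i |: I); set s2 := sgn l I; set s3 := sgn l (i |: I); set s4 := sgn i _.
move=> e.
have e1 : s1 * s3 = - (s2 * s4).
  have : s1 * s1 * (s3 * s3) = 1 by rewrite !sgn_sq mulr1.
  have q4 : s4 * s4 = 1 by apply: sgn_sq.
  have q1 : s1 * s1 = 1 by apply: sgn_sq.
  have q3 : s3 * s3 = 1 by apply: sgn_sq.
  have -> : s2 * s4 = s1 * (s1 * s2) * s4 by rewrite mulrA q1 mul1r.
  by rewrite e mulrN mulNr opprK -[s1 * (s3 * s4) * s4]mulrA -[s3 * s4 * s4]mulrA q4 mulr1.
have -> : s2 * c l * (s4 * z ((i |: I) :\ l)) + s1 * (s3 * c l * z ((i |: I) :\ l)) =
   (s1 * s3 + s2 * s4) * (c l * z ((i |: I) :\ l)) by ring.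
by rewrite e1 addNr mul0r.
Qed.

End Koszul.

Lemma koszul_exchange (K : fieldType) (J : finType) (c c' : J -> K)
    (u : {set J} -> {set J} -> K) I L :
  koszul c (fun L' => koszul c' (fun I' => u I' L') I) L =
  koszul c' (fun I' => koszul c (fun L' => u I' L') L) I.
Proof.
rewrite /koszul; under eq_bigr do rewrite mulr_sumr.
rewrite exchange_big; apply: eq_bigr => i _; rewrite mulr_sumr; apply: eq_bigr => l _.
by ring.
Qed.

Section Zigzag.
Variables (K : fieldType) (J : finType) (x : J -> K).
(** [Gam j I] stands for the sections, over the intersection of the charts in I, of a fixed sheaf
    twisted by -j: multiplying by x_i lowers j, and dividing by x_i, for i in I, raises it. *)
Variable Gam : nat -> {set J} -> set K.
Hypothesis x0 : forall i, x i != 0.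
Hypothesis Gam0 : forall j I, Gam j I 0.
Hypothesis GamB : forall j I a b, Gam j I a -> Gam j I b -> Gam j I (a - b).
Hypothesis GamS : forall j (I I' : {set J}) a, I \subset I' -> Gam j I a -> Gam j I' a.
Hypothesis GamX : forall j I i a, Gam j.+1 I a -> Gam j I (x i * a).
Hypothesis GamV : forall j (I : {set J}) i a, i \in I -> Gam j I a -> Gam j.+1 I (a / x i).
Implicit Types (I L : {set J}) (z y : {set J} -> K).

Notation n := #|J|.
Notation fullJ := (finset.setTfor J).
Notation delta := (koszul (fun _ : J => 1 : K)).

Definition cochain j s z := (forall I, Gam j I (z I)) /\ (forall I, z I != 0 -> #|I| = s).

Definition exact_at s j := forall z, cochain j s z -> (forall I, delta z I = 0) ->
  exists2 y, cochain j s.-1 y & forall I, delta y I = z I.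

Lemma GamN j I a : Gam j I a -> Gam j I (- a).
Proof. by move=> Ga; rewrite -sub0r; apply: GamB. Qed.

Lemma GamD j I a b : Gam j I a -> Gam j I b -> Gam j I (a + b).
Proof. by move=> Ga Gb; rewrite -[b]opprK; apply: GamB => //; exact: GamN. Qed.

Lemma Gam_sgn j I i L a : Gam j I a -> Gam j I (sgn K i L * a).
Proof.
by rewrite /sgn -signr_odd; case: odd => Ga; rewrite ?expr1 ?mulN1r ?mul1r //; exact: GamN.
Qed.

Lemma Gam_sum j I (T : finType) (P : pred T) F :
  (forall t, P t -> Gam j I (F t)) -> Gam j I (\sum_(t | P t) F t).
Proof. by move=> H; apply: (big_ind (Gam j I)) => // a b; exact: GamD. Qed.

Lemma Gam_delta j z I : (forall I, Gam j I (z I)) -> Gam j I (delta z I).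
Proof.
move=> Gz; apply: Gam_sum => i iI; rewrite mulr1; apply: Gam_sgn.
by apply: GamS (Gz _); exact: subD1set.
Qed.

Lemma Gam_koszul j z I L : (forall L, Gam j.+1 I (z L)) -> Gam j I (koszul x z L).
Proof.
by move=> Gz; apply: Gam_sum => i iI; rewrite -mulrA; apply: Gam_sgn; exact: GamX.
Qed.

Lemma koszul_neq0 (c : J -> K) z I : koszul c z I != 0 -> exists2 i, i \in I & z (I :\ i) != 0.
Proof.
move=> nz; apply: contrapT => h; move: nz; rewrite /koszul big1 ?eqxx // => i iI.
have [->|zi] := eqVneq (z (I :\ i)) 0; first by rewrite mulr0.
by case: h; exists i.
Qed.

(* The double complex with Cech differential in the first index and Koszul
   differential (rows, exact because x_i is invertible on U_I for i in I) in the
   second: a class that is a Koszul cycle lifts along the Koszul differential as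
   soon as the obstructions, in higher Cech degrees, vanish. *)
Lemma zigzag m s j0 j (w : {set J} -> {set J} -> K) : (n < s + m)%N -> (0 < s)%N ->
  (forall i, (s + i < n)%N -> exact_at (s + i).+1 (j0 + j + i).+2) ->
  (forall I L, Gam (j0 + j) I (w I L)) ->
  (forall I L, w I L != 0 -> #|I| = s /\ (#|L| + j = n)%N) ->
  (forall I L, delta (w^~ L) I = 0) -> (forall I L, koszul x (w I) L = 0) ->
  exists v : {set J} -> {set J} -> K,
  [/\ forall I L, Gam (j0 + j).+1 I (v I L),
      forall I L, v I L != 0 -> #|I| = s /\ (#|L| + j.+1 = n)%N,
      forall I L, delta (v^~ L) I = 0 & forall I L, koszul x (v I) L = w I L].
Proof.
elim: m s j w => [|m IH] s j w nsm s0 HE Gw Sw dw kw.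
  have w0 I L : w I L = 0.
    apply/eqP; apply: contrapT => /negP/Sw[Is _].
    by have := max_card (mem I); rewrite Is; move: nsm; rewrite addn0 ltnNge => /negP.
  exists (fun _ _ => 0); split=> // I L; rewrite ?eqxx //; first exact: koszul0.
  by rewrite koszul0.
(* A lift of w along the Koszul differential, by the homotopy of some index i in I. The choice of i
   spoils the Cech cocycle condition; the defect [w2] has one more Cech degree and is lifted by
   induction. *)
pose u I L := if [pick i in I] is Some i then (x i)^-1 * contract i (w I) L else 0.
have Gu I L : Gam (j0 + j.+1) I (u I L).
  rewrite /u addnS; case: pickP => [i iI|//]; rewrite mulrC; apply: GamV => //.
  by rewrite /contract; case: ifP => // _; apply: Gam_sgn.
have Su I L : u I L != 0 -> #|I| = s /\ (#|L| + j.+1 = n)%N.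
  rewrite /u; case: pickP => [i iI|_]; last by rewrite eqxx.
  rewrite mulf_eq0 negb_or /contract => /andP[_]; case: ifP => iL; first by rewrite eqxx.
  by rewrite mulf_eq0 negb_or => /andP[_ /Sw[-> <-]]; rewrite cardsU1 iL; split=> //; lia.
have ku I L : koszul x (u I) L = w I L.
  rewrite /u; case: pickP => [i iI|I0].
    rewrite koszulZ; have := koszul_contract x i (w I) L.
    have -> : contract i (koszul x (w I)) L = 0.
      by rewrite /contract; case: ifP => // _; rewrite kw mulr0.
    by rewrite addr0 => ->; rewrite mulKf.
  rewrite koszul0 //; apply/esym/eqP; apply: contrapT => /negP/Sw[Is _].
  by move: s0; rewrite -Is card_gt0 => /set0Pn[i]; rewrite I0.
pose w2 I L := delta (u^~ L) I.
have [|||||||v' [Gv' Sv' dv' kv']] := IH s.+1 j.+1 w2 => //.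
- by rewrite addSnnS.
- by move=> i sin; have := HE i.+1; rewrite !addnS !addSn; apply; rewrite -addSn.
- by move=> I L; apply: Gam_delta.
- move=> I L /koszul_neq0[i iI /Su[Is Lj]]; split=> //.
  by move: Is; rewrite (cardsD1 i I) iI => ->.
- by move=> I L; apply: koszulK.
- move=> I L; rewrite /w2 (koszul_exchange x (fun=> 1) u I L) -(dw I L).
  by apply: eq_koszul => I'; rewrite ku.
(* The lift v' of the defect is a Cech coboundary by [HE]; when s is at least n it is zero, its Cech
   degree s + 1 being too large. The Koszul differential of y is the correction to u. *)
have /choice[y yP] : forall L, exists y, [/\ forall I, Gam (j0 + j).+2 I (y I),
    forall I, y I != 0 -> #|I| = s /\ (#|L| + j.+2 = n)%N &
    forall I, delta y I = v' I L].
  move=> L; have [Lj|Lj] := eqVneq (#|L| + j.+2)%N n; last first.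
    exists (fun=> 0); split=> // I; rewrite ?eqxx // koszul0 //.
    apply/esym/eqP; apply: contrapT => /negP/Sv'[_ h]; move/eqP: Lj; lia.
  have [sn|sn] := ltnP s n.
    have [|||y [Gy Sy] dy] := HE 0%N _ (v'^~ L); rewrite ?addn0 //.
    - split; first by move=> I; have := Gv' I L; rewrite addnS.
      by move=> I /Sv'[].
    exists y; split=> [I|I yI|//]; first by have := Gy I; rewrite addn0.
    by split=> //; rewrite (Sy _ yI) addn0.
  exists (fun=> 0); split=> // I; rewrite ?eqxx // koszul0 //.
  apply/esym/eqP; apply: contrapT => /negP/Sv'[h _].
  by have := max_card (mem I); rewrite h; lia.
exists (fun I L => u I L - koszul x (fun L' => y L' I) L); split=> I L.
- apply: GamB; first by have := Gu I L; rewrite addnS.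
  by apply: Gam_koszul => L'; case: (yP L').
- have [u0|/Su //] := eqVneq (u I L) 0; rewrite u0 sub0r oppr_eq0.
  move=> /koszul_neq0[i iL]; case: (yP (L :\ i)) => _ h _ /h[Is Lj]; split=> //.
  by rewrite (cardsD1 i L) iL; lia.
- rewrite koszulB -(koszul_exchange x (fun=> 1) (fun I L => y L I) I L).
  have -> : koszul x (fun L' => koszul (fun=> 1) [eta y L'] I) L = koszul x (v' I) L.
    by apply: eq_koszul => L'; case: (yP L').
  by rewrite kv' subrr.
- by rewrite koszulB koszulK subr0 ku.
Qed.

(** The zigzag starts from z placed at L = J, the top Koszul degree, where every element is a Koszul
    cycle. *)
Lemma cocycle_lift s j z : (0 < s)%N -> cochain j s z -> (forall I, delta z I = 0) ->
  (forall i, (s + i < n)%N -> exact_at (s + i).+1 (j + i).+2) ->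
  exists v : J -> {set J} -> K, [/\ forall i, cochain j.+1 s (v i),
    forall i I, delta (v i) I = 0 & forall I, z I = \sum_i sgn K i fullJ * (x i * v i I)].
Proof.
move=> s0 [Gz Sz] dz HE.
pose w I L := if L == fullJ then z I else 0.
have [|||||||v [Gv Sv dv kv]] := @zigzag n.+1 s j 0 w; rewrite ?addn0 //.
- lia.
- by move=> I L; rewrite /w; case: ifP.
- move=> I L; rewrite /w; case: (eqVneq L fullJ) => [->|_]; last by rewrite eqxx.
  by rewrite cardsT addn0 => /Sz.
- move=> I L; rewrite /w; case: (L == fullJ); last by rewrite koszul0.
  exact: dz.
- move=> I L; rewrite /koszul big1 // => i iL; rewrite /w.
  case: eqP => [/setP/(_ i)|_]; last by rewrite mulr0.
  by rewrite !inE eqxx.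
exists (fun i I => v I (fullJ :\ i)); split.
- by move=> i; split=> I; [have := Gv I (fullJ :\ i); rewrite addn0|move=> /Sv[]].
- by move=> i I; rewrite dv.
move=> I; have := kv I fullJ; rewrite /w eqxx => <-.
by rewrite /koszul; apply: eq_big => [i|i _]; [rewrite inE|rewrite mulrA].
Qed.

Variable jmax : nat.
Hypothesis killed : forall j s i v, (j <= jmax)%N -> (1 < s)%N -> cochain j.+1 s v ->
  (forall I, delta v I = 0) ->
  exists2 y, cochain j s.-1 y & forall I, delta y I = x i * v I.

(** Descending induction on the Cech degree s: vanishing in higher degrees lets z be written as a
    signed sum of x_i v_i with cocycles v_i, and each x_i v_i is a coboundary by [killed]. The
    obstructions have degree s + i + 1 and twist j + i + 2, whence the margin 2m. *)
Lemma vanishing m s j : (s + m = n.+1)%N -> (1 < s)%N -> (j + m.*2 <= jmax)%N -> exact_at s j.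
Proof.
have [k] := ubnP m; elim: k m s j => // k IH m s j /ltnSE mk sm s1 jm z Cz dz.
have [|i si|v [Cv dv zE]] := cocycle_lift _ Cz dz; first lia.
  by apply: (IH (m - i.+1)%N); lia.
have /choice[y yP] : forall i, exists y, cochain j s.-1 y /\ forall I, delta y I = x i * v i I.
  have jj : (j <= jmax)%N by lia.
  by move=> i; have [y Cy dy] := killed i jj s1 (Cv i) (dv i); exists y.
exists (fun I => \sum_i sgn K i fullJ * y i I).
  split=> I; first by apply: Gam_sum => i _; apply: Gam_sgn; case: (yP i) => -[].
  move=> nz; have [i] : exists i, y i I != 0.
    apply: contrapT => h; move: nz; rewrite big1 ?eqxx // => i _.
    have [->|yi] := eqVneq (y i I) 0; first by rewrite mulr0.
    by case: h; exists i.
  by case: (yP i) => -[_ Sy] _; apply: Sy.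
move=> I; rewrite koszul_sum zE; apply: eq_bigr => i _; rewrite koszulZ.
by case: (yP i) => _ ->.
Qed.

Lemma delta_set1 z i : delta z [set i] = z finset.set0.
Proof.
have e : #|[set l in finset.set1 i | (enum_rank l < enum_rank i)%N]| = 0%N.
  apply: eq_card0 => l; rewrite inE [RHS]finset.inE.
  have -> : (l \in finset.set1 i) = (l == i) by exact: finset.in_set1.
  by case: (eqVneq l i) => [->|//]; rewrite ltnn.
by rewrite /koszul big_set1 /sgn e !mul1r finset.setDv.
Qed.

(** A global section is a cochain on the empty set. Its differential is a 1-cocycle, which lifts to
    1-cocycles v_i, the obstructions having degree at least 2. A 1-cocycle takes the same value on
    all charts, so the v_i are global sections again. *)
Lemma generation (i0 : J) (z0 : K) : (n.*2 <= jmax)%N -> (forall i, Gam 0 [set i] z0) ->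
  exists y : J -> K, (forall i l, Gam 1 [set l] (y i)) /\ z0 = \sum_i x i * y i.
Proof.
move=> njm Gz0.
pose ze (I : {set J}) := if I == finset.set0 then z0 else 0.
have dze I : delta ze I = if #|I| == 1%N then z0 else 0.
  case: eqP => [/eqP/cards1P[i ->]|I1]; first by rewrite delta_set1 /ze eqxx.
  rewrite /koszul big1 // => i iI; rewrite /ze; case: eqP => [I0|]; last by rewrite mulr0.
  by case: I1; rewrite (cardsD1 i) iI I0 cards0.
have Cz : cochain 0 1 (delta ze).
  split=> I; rewrite dze; first by case: eqP => // /eqP/cards1P[i ->].
  by case: (#|I| =P 1%N) => // _; rewrite eqxx.
have [//||v [Cv dv zE]] := cocycle_lift _ Cz (fun I => koszulK _ ze I).
  by move=> i i1; apply: (@vanishing (n - i.+1)%N); lia.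
have vc (i l : J) : v i [set l]%SET = v i [set i0]%SET.
  have ct : contract i0 (delta (v i)) [set l]%SET = 0.
    by rewrite /contract; case: ifP => // _; rewrite dv mulr0.
  have := koszul_contract (fun=> 1) i0 (v i) [set l]%SET; rewrite ct addr0 mul1r => <-.
  rewrite delta_set1 /contract inE finset.setU0.
  by have := delta_set1 (fun=> 1) i0; rewrite /koszul big_set1 !mulr1 => ->; rewrite mul1r.
exists (fun i => sgn K i fullJ * v i [set i0]%SET); split.
  by move=> i l; apply: Gam_sgn; rewrite -(vc i l); case: (Cv i).
have := zE [set i0]%SET; rewrite dze cards1 eqxx => ->.
by apply: eq_bigr => i _; rewrite mulrCA.
Qed.

End Zigzag.

(** * Cech cohomology of graded modules *)

Section GradedCech.
Variables (K : fieldType) (J : finType) (x : J -> K) (R0 : set K).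
Hypotheses (x0 : forall i, x i != 0) (rR0 : subring R0) (nR0 : noeth R0).
Variables (ys : seq K) (t : nat) (gens : seq (K * nat * nat)).
Implicit Types (I : {set J}) (z : {set J} -> K).

Notation delta := (koszul (fun _ : J => 1 : K)).

(* The bigraded module over R0[x, y] generated by gens, inside K: x has degree
   (0, 1) and y has degree (t, 0). *)
Inductive bimod : nat -> nat -> K -> Prop :=
| BM0 a b : bimod a b 0
| BMD a b u v : bimod a b u -> bimod a b v -> bimod a b (u + v)
| BMZ a b c u : R0 c -> bimod a b u -> bimod a b (c * u)
| BMg g a b : (g, a, b) \in gens -> bimod a b g
| BMx a b i u : bimod a b u -> bimod a b.+1 (x i * u)
| BMy a b y u : y \in ys -> bimod a b u -> bimod (a + t) b (y * u).

Lemma bimodN a b u : bimod a b u -> bimod a b (- u).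
Proof.
by move=> Mu; rewrite -mulN1r; apply: BMZ => //; apply: (subringN rR0); exact: subring1.
Qed.

Lemma bimodB a b u v : bimod a b u -> bimod a b v -> bimod a b (u - v).
Proof. by move=> Mu Mv; apply: BMD => //; exact: bimodN. Qed.

Lemma bimod_sgn a b i I u : bimod a b u -> bimod a b (sgn K i I * u).
Proof.
by rewrite /sgn -signr_odd; case: odd => Mu; rewrite ?expr1 ?mulN1r ?mul1r //; exact: bimodN.
Qed.

Definition xpow (T : J -> nat) I : K := \prod_(i in I) x i ^+ T i.

(** Cochains of bidegree (a, b) with values in the localizations of the module, x_i being allowed in
    the denominator with exponent at most T i. *)
Definition twisted (T : J -> nat) a b z :=
  forall I, bimod a (b + \sum_(i in I) T i) (xpow T I * z I).

(** The bound b0 is uniform in a; the application takes a = b = p^e. *)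
Definition cech_exact T b0 := forall a b z, (b0 <= b)%N -> twisted T a b z ->
  (forall I, delta z I = 0) -> exists2 y, twisted T a b y & forall I, delta y I = z I.

Lemma xpow_neq0 T I : xpow T I != 0.
Proof. by apply/prodf_neq0 => i _; rewrite expf_neq0. Qed.

Section Exponent1.

Notation L := {poly {poly K}}.
Implicit Types (f g : {ffun {set J} -> L^o}).
(** The bidegree is recorded by the exponents of two variables, a on the inner one and b on the
    outer one, so that cochains of all bidegrees form one module over a polynomial algebra. *)
Let mon a b (u : K) : L := (u%:P * 'X^a)%:P * 'X^b.
Let xh i : L := ((x i)%:P)%:P * 'X.
Let yh (y : K) : L := (y%:P * 'X^t)%:P.
Let T1 : J -> nat := fun=> 1%N.

Let coef_mon a b u a' b' : (mon a b u)`_b'`_a' = if (a' == a) && (b' == b) then u else 0.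
Proof.
rewrite /mon coefCM coefXn mulrC; case: (b' == b); last by rewrite mul0r coef0 andbF.
by rewrite mul1r andbT coefCM coefXn; case: (a' == a); rewrite ?mulr1 ?mulr0.
Qed.

Let coef_xh i (f : L) a b : (xh i * f)`_b.+1`_a = x i * f`_b`_a.
Proof. by rewrite /xh -mulrA coefCM coefCM coefXM. Qed.

Let coef_xh0 i (f : L) : (xh i * f)`_0 = 0.
Proof. by rewrite /xh -mulrA coefCM coefXM mulr0. Qed.

Let coef_yh y (f : L) a b : (yh y * f)`_b`_a = if (a < t)%N then 0 else y * f`_b`_(a - t).
Proof.
by rewrite /yh coefCM -mulrA coefCM coefXnM; case: ifP; rewrite ?mulr0.
Qed.

Let xpow1 I : xpow T1 I = \prod_(i in I) x i.
Proof. by apply: eq_bigr. Qed.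

Let sum1 I : (\sum_(i in I) T1 i = #|I|)%N.
Proof. by rewrite sum1_card. Qed.

Let comp a b (f : {ffun {set J} -> L^o}) I : K := (xpow T1 I)^-1 * (f I : L)`_(b + #|I|)`_a.

Let N : set {ffun {set J} -> L^o} := [set f : {ffun {set J} -> L^o} | [/\
  forall I a b, bimod a b (f I : L)`_b`_a,
  forall I a b, (b < #|I|)%N -> (f I : L)`_b`_a = 0 &
  forall a b I, delta (comp a b f) I = 0]].

Let NB f g : N f -> N g -> N (f - g).
Proof.
move=> [Mf lf df] [Mg lg dg]; split.
- by move=> I a b; rewrite !ffunE !coefB; exact: bimodB.
- by move=> I a b bI; rewrite !ffunE !coefB lf // lg // subrr.
- move=> a b I; rewrite -[RHS](subrr 0) -{1}(df a b I) -(dg a b I) -koszulB.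
  by apply: eq_koszul => I'; rewrite /comp !ffunE !coefB mulrBr.
Qed.

Let comp_xh i f a b I : comp a b.+1 (xh i *: f) I = x i * comp a b f I.
Proof. by rewrite /comp ffunE addSn coef_xh mulrCA. Qed.

Let N_xh i f : N f -> N (xh i *: f).
Proof.
move=> [Mf lf df]; split.
- move=> I a [|b]; rewrite ffunE; first by rewrite coef_xh0 coef0; exact: BM0.
  by rewrite coef_xh; exact: BMx.
- move=> I a [|b] bI; rewrite ffunE; first by rewrite coef_xh0 coef0.
  by rewrite coef_xh lf ?mulr0 //; exact: ltn_trans bI.
- move=> a [|b] I.
    rewrite /koszul big1 // => i' iI; have [I0|I0] := posnP #|I :\ i'|.
      by rewrite /comp ffunE I0 coef_xh0 coef0 !mulr0.
    rewrite /comp ffunE -(prednK I0) add0n coef_xh lf ?mulr0 // prednK //.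
  by rewrite (eq_koszul _ _ (comp_xh i f a b)) koszulZ df mulr0.
Qed.

Let comp_yh y f a b I : comp (a + t) b (yh y *: f) I = y * comp a b f I.
Proof. by rewrite /comp ffunE coef_yh ltnNge leq_addl /= addnK mulrCA. Qed.

Let comp_yh0 y f a b I : (a < t)%N -> comp a b (yh y *: f) I = 0.
Proof. by move=> at'; rewrite /comp ffunE coef_yh at' mulr0. Qed.

Let N_yh y f : y \in ys -> N f -> N (yh y *: f).
Proof.
move=> yys [Mf lf df]; split.
- move=> I a b; rewrite ffunE coef_yh; case: ltnP => at'; first exact: BM0.
  by rewrite -{1}(subnK at'); apply: BMy.
- by move=> I a b bI; rewrite ffunE coef_yh lf // mulr0; case: ifP.
- move=> a b I; have [at'|at'] := ltnP a t.
    by rewrite koszul0 // => I'; exact: comp_yh0.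
  by rewrite -(subnK at') (eq_koszul _ _ (comp_yh y f (a - t) b)) koszulZ df mulr0.
Qed.

Let comp_c c f a b I : comp a b (c%:P%:P *: f) I = c * comp a b f I.
Proof. by rewrite /comp ffunE !coefCM mulrCA. Qed.

Let N_c c f : R0 c -> N f -> N (c%:P%:P *: f).
Proof.
move=> Rc [Mf lf df]; split.
- by move=> I a b; rewrite ffunE !coefCM; exact: BMZ.
- by move=> I a b bI; rewrite ffunE !coefCM lf // mulr0.
- by move=> a b I; rewrite (eq_koszul _ _ (comp_c c f a b)) koszulZ df mulr0.
Qed.

Let bnd a b z := exists2 y, twisted T1 a b y & forall I, delta y I = z I.

Let bndB a b z z' : bnd a b z -> bnd a b z' -> bnd a b (fun I => z I - z' I).
Proof.
move=> [y Cy dy] [y' Cy' dy']; exists (fun I => y I - y' I).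
  by move=> I; rewrite mulrBr; exact: bimodB.
by move=> I; rewrite koszulB dy dy'.
Qed.

Let bnd_ext a b z z' : z =1 z' -> bnd a b z -> bnd a b z'.
Proof. by move=> e [y Cy dy]; exists y => // I; rewrite dy. Qed.

Let bnd0 a b z : (forall I, z I = 0) -> bnd a b z.
Proof.
move=> z0; exists (fun=> 0); first by move=> I; rewrite mulr0; exact: BM0.
by move=> I; rewrite z0 koszul0.
Qed.

Let constL : {rmorphism K -> L} := (polyC \o polyC : K -> L).

(** Cleared of denominators, the cocycles of exponent 1 and of all bidegrees form a finite module
    over a Noetherian ring. Each x_i kills their classes: [contract] adds one factor x_i to the
    denominator, and multiplication by x_i removes it. Only the generators, whose degrees b are
    bounded, and their multiples by constants and by the y remain. *)
Lemma cech_exact1 : exists b0, cech_exact (fun=> 1%N) b0.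
Proof.
pose R0' := constL @` R0.
have injC : injective constL by move=> u v /polyC_inj/polyC_inj.
have rR0' : subring R0' by apply: image_subring.
have nR0' : noeth R0' by apply: noeth_image.
have [A [rA nA RA sA Amin]] := noeth_fg ([seq xh i | i <- enum J] ++ [seq yh y | y <- ys]) rR0' nR0'.
have A_ind (Q : set {ffun {set J} -> L^o}) : (forall f g, Q f -> Q g -> Q (f - g)) ->
    (forall c f, R0 c -> Q f -> Q (c%:P%:P *: f)) -> (forall i f, Q f -> Q (xh i *: f)) ->
    (forall y f, y \in ys -> Q f -> Q (yh y *: f)) ->
    forall s f, A s -> Q f -> Q (s *: f).
  move=> QB Qc Qx Qy s f As; move: f; apply: (Amin [set s | forall f, Q f -> Q (s *: f)]) As.
  - split=> [f|u v Qu Qv f Qf|u v Qu Qv f Qf]; first by rewrite scale1r.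
      by rewrite scalerBl; apply: (QB); [exact: Qu|exact: Qv].
    by rewrite -scalerA; apply: Qu; exact: Qv.
  - by move=> _ [c Rc <-] f; exact: Qc.
  - move=> u; rewrite /= mem_cat => /orP[/mapP[i _ ->]|/mapP[y yys ->]] f; first exact: Qx.
    exact: Qy.
have N0 : N 0.
  split=> [I a b|I a b _|a b I]; first by rewrite ffunE !coef0; exact: BM0.
    by rewrite ffunE !coef0.
  by rewrite koszul0 // => I'; rewrite /comp ffunE !coef0 mulr0.
have mN : submod A N.
  split=> // s f g As Nf Ng; have Nsf := A_ind N NB (@N_c) (@N_xh) (@N_yh) s f As Nf.
  by rewrite -[g]opprK; apply: NB => //; rewrite -sub0r; apply: NB.
pose h I (u : L) : {ffun {set J} -> L^o} := [ffun I' => if I' == I then u else 0].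
pose hg (I : {set J}) := [seq h I (mon e.1.2 e.2 e.1.1) | e <- gens].
pose S := flatten (map hg (enum (predT : pred {set J}))).
have NS : N `<=` Span A [set` S].
  move=> f [Mf _ _].
  have -> : f = \sum_(I : {set J}) h I (f I).
    apply/ffunP => I; rewrite sum_ffunE (bigD1 I) //= ffunE eqxx big1 ?addr0 //.
    by move=> I' /negbTE; rewrite ffunE eq_sym => ->.
  apply: Span_sum => // I _.
  have hsum T (r : seq T) (F : T -> L) : h I (\sum_(k <- r) F k) = \sum_(k <- r) h I (F k).
    apply/ffunP => I'; rewrite sum_ffunE !ffunE; case: ifP => I'I.
      by apply: eq_bigr => k _; rewrite ffunE I'I.
    by rewrite big1 // => k _; rewrite ffunE I'I.
  have -> : (f I : L) = \sum_(b < size (f I : L)) \sum_(a < size (f I : L)`_b) mon a b (f I : L)`_b`_a.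
    rewrite -{1}[f I]coefK poly_def; apply: eq_bigr => b _.
    rewrite -mul_polyC -{1}[(f I : L)`_b]coefK poly_def rmorph_sum mulr_suml.
    by apply: eq_bigr => a _; rewrite -mul_polyC.
  rewrite hsum; apply: Span_sum => // b _; rewrite hsum; apply: Span_sum => // a _.
  have hZ s (u : L) : h I (s * u) = s *: h I u.
    by apply/ffunP => I'; rewrite !ffunE; case: ifP => // _; rewrite [RHS]mulr0.
  suff gen a' b' u : bimod a' b' u -> Span A [set` S] (h I (mon a' b' u)) by apply: gen; exact: Mf.
  elim=> {a b a' b' u} [a b|a b u v _ Su _ Sv|a b c u Rc _ Su|g a b gg|a b i u _ Su|a b y u yys _ Su].
  - suff -> : h I (mon a b 0) = 0 by exact: Span0.
    by apply/ffunP => I'; rewrite !ffunE; case: ifP; rewrite // /mon polyC0 mul0r polyC0 mul0r.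
  - have -> : h I (mon a b (u + v)) = h I (mon a b u) + h I (mon a b v).
      apply/ffunP => I'; rewrite !ffunE; case: ifP; rewrite ?addr0 // /mon.
      by rewrite polyCD mulrDl polyCD mulrDl.
    exact: SpanD.
  - have -> : mon a b (c * u) = c%:P%:P * mon a b u by rewrite /mon !polyCM; ring.
    rewrite hZ.
    apply: SpanS => //; apply: RA; by exists c.
  - apply: Span_id => //.
    have : h I (mon a b g) \in S.
      apply/flattenP; exists (hg I).
        by apply/mapP; exists I; rewrite ?mem_enum.
      by apply/mapP; exists (g, a, b).
    exact.
  - have -> : mon a b.+1 (x i * u) = xh i * mon a b u by rewrite /mon /xh exprS !polyCM; ring.
    rewrite hZ.
    apply: SpanS => //; apply: sA.
    have : xh i \in [seq xh i | i <- enum J] ++ [seq yh y | y <- ys].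
      by rewrite mem_cat map_f ?mem_enum.
    exact.
  - have -> : mon (a + t) b (y * u) = yh y * mon a b u.
      by rewrite /mon /yh exprD !polyCM; ring.
    rewrite hZ.
    apply: SpanS => //; apply: sA.
    have : yh y \in [seq xh i | i <- enum J] ++ [seq yh y | y <- ys].
      by rewrite mem_cat [X in _ || X]map_f ?orbT.
    exact.
have [ts tsN Nts] := noeth_submod rA nA mN NS.
(* All components of the generators vanish from degree b0 on; b0 is positive, so that a multiple of
   x_i in the range comes from a component of degree one less. *)
pose b0 := (\sum_(f <- ts) \sum_(I : {set J}) size (f I : L)).+1%N.
exists b0.
pose Q : set {ffun {set J} -> L^o} := [set f : {ffun {set J} -> L^o} | N f /\
  forall a b, (b0 <= b)%N -> bnd a b (comp a b f)].
have QN : N `<=` Q.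
  have QB f g : Q f -> Q g -> Q (f - g).
    move=> [Nf bf] [Ng bg]; split; first exact: NB.
    move=> a b bb; apply: bnd_ext (bndB (bf a b bb) (bg a b bb)) => I.
    by rewrite /comp !ffunE !coefB mulrBr.
  have Q0 : Q 0.
    by split=> // a b _; apply: bnd0 => I; rewrite /comp ffunE !coef0 mulr0.
  have Qt f : f \in ts -> Q f.
    move=> fts; split; first exact: tsN.
    move=> a b bb; apply: bnd0 => I; rewrite /comp [(f I : L)`_ _]nth_default ?coef0 ?mulr0 //.
    apply: leq_trans (leq_addr _ _); apply: ltnW; apply: leq_trans bb.
    rewrite /b0 ltnS (big_rem f) //= (bigD1 I) //= -addnA leq_addr //.
  suff QA : forall s f, A s -> Q f -> Q (s *: f).
    move=> f /Nts; elim=> // s f' g As f's _ Qg.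
    rewrite -[g]opprK; apply: (QB); first by apply: (QA) => //; exact: Qt.
    by rewrite -sub0r; apply: (QB).
  apply: A_ind => //.
  - move=> c f Rc [Nf bf]; split; first exact: N_c.
    move=> a b bb; have [y Cy dy] := bf a b bb; exists (fun I => c * y I).
      by move=> I; rewrite mulrCA; exact: BMZ.
    by move=> I; rewrite koszulZ dy comp_c.
  - move=> i f [Nf _]; split; first exact: N_xh.
    move=> a [//|b] bb.
    exists (fun I => x i * contract i (comp a b f) I).
      move=> I; rewrite /contract; case: ifP => iI; first by rewrite !mulr0; exact: BM0.
      rewrite xpow1 sum1.
      have -> : (\prod_(l in I) x l) * (x i * (sgn K i (i |: I) * comp a b f (i |: I))) =
         sgn K i (i |: I) * (xpow T1 (i |: I) * comp a b f (i |: I)).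
        rewrite xpow1 big_setU1 ?iI //=; ring.
      apply: bimod_sgn; rewrite /comp mulVKf ?xpow_neq0 //.
      case: Nf => Mf _ _; have := Mf (i |: I) a (b + #|i |: I|)%N.
      by rewrite cardsU1 iI /= add1n addnS -addSn.
    move=> I; rewrite koszulZ comp_xh; congr (_ * _).
    have := koszul_contract (fun=> 1) i (comp a b f) I.
    have -> : contract i (delta (comp a b f)) I = 0.
      by rewrite /contract; case: ifP => // _; case: Nf => _ _ ->; rewrite mulr0.
    by rewrite addr0 mul1r.
  - move=> y f yys [Nf bf]; split; first exact: N_yh.
    move=> a b bb; have [at'|at'] := ltnP a t.
      by apply: bnd0 => I; exact: comp_yh0.
    have [u Cu du] := bf (a - t)%N b bb; exists (fun I => y * u I).
      by move=> I; rewrite mulrCA -{1}(subnK at'); apply: BMy.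
    by move=> I; rewrite koszulZ du -{2}(subnK at') comp_yh.
move=> a b z bb Cz dz.
pose f : {ffun {set J} -> L^o} := [ffun I : {set J} => mon a (b + #|I|) (xpow T1 I * z I)].
have cf a' b' I : comp a' b' f I = if (a' == a) && (b' == b) then z I else 0.
  rewrite /comp ffunE coef_mon eqn_add2r; case: ifP => _; last by rewrite mulr0.
  by rewrite mulKf ?xpow_neq0.
have Nf : N f.
  split=> [I a' b'|I a' b' bI|a' b' I].
  - rewrite ffunE coef_mon; case: andP => [[/eqP -> /eqP ->]|_]; last exact: BM0.
    by have := Cz I; rewrite sum1.
  - rewrite ffunE coef_mon.
    by rewrite [b' == _]ltn_eqF ?andbF // ltn_addl.
  - rewrite (eq_koszul _ _ (cf a' b')); case: ((a' == a) && (b' == b)).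
      exact: dz.
    by rewrite koszul0.
have [_ /(_ a b bb)] := QN f Nf.
by apply: bnd_ext => I; rewrite cf !eqxx.
Qed.

End Exponent1.

(** With x = x_i0, the cochain xz has exponents T in degree b + 1, so it is the coboundary of some
    y, and y / x has coboundary z but good denominators only on the sets that contain i0. Its part
    [p0] on the other sets has a coboundary with exponents T; replacing [p0] by a cochain u with
    exponents T and the same coboundary gives the solution. *)
Lemma cech_exactS T b0 i0 : (0 < T i0)%N -> cech_exact T b0 ->
  cech_exact (fun i => T i + (i == i0))%N b0.
Proof.
move=> T0 ex a b z bb Cz dz; set T' := (fun i => _) in Cz *.
have xpowT' I : xpow T' I = (if i0 \in I then x i0 else 1) * xpow T I.
  rewrite /xpow; case: ifP => iI; last first.
    rewrite mul1r; apply: eq_bigr => i iI'; rewrite /T'; case: (eqVneq i i0) => [e|_].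
      by move: iI; rewrite -e iI'.
    by rewrite addn0.
  rewrite (bigD1 i0) //= [in RHS](bigD1 i0) //= mulrA /T' eqxx addn1 exprS; congr (_ * _).
  by apply: eq_bigr => i /andP[_ /negbTE ->]; rewrite addn0.
have sumT' I : (\sum_(i in I) T' i = (i0 \in I) + \sum_(i in I) T i)%N.
  rewrite big_split /= addnC; congr (_ + _)%N.
  case: (boolP (i0 \in I)) => iI; last first.
    by rewrite big1 // => i iI'; case: eqP => // e; move: iI; rewrite -e iI'.
  by rewrite (bigD1 i0) //= eqxx big1 // => i /andP[_ /negbTE ->].
have [|I|I|y Cy dy] := ex a b.+1 (fun I => x i0 * z I); first exact: leqW.
- have := Cz I; rewrite xpowT' sumT'; case: (i0 \in I).
    by rewrite addSnnS mulrCA mulrA.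
  by rewrite mul1r add0n addSn => h; rewrite mulrCA; exact: BMx.
- by rewrite koszulZ dz mulr0.
pose th I := (x i0)^-1 * y I.
have dth I : delta th I = z I by rewrite koszulZ dy mulKf.
pose p0 I := if i0 \in I then 0 else th I.
have be I : delta p0 I = if i0 \in I then sgn K i0 I * th (I :\ i0) else z I.
  case: ifP => iI.
    rewrite /koszul (bigD1 i0) //= big1 ?addr0; last first.
      by move=> i /andP[iI' ii0]; rewrite /p0 !inE eq_sym ii0 iI mulr0.
    by rewrite /p0 !inE eqxx mulr1.
  rewrite -dth; apply: eq_bigr => i iI'; rewrite /p0 !inE iI andbF //.
have [||u Cu du] := ex a b (delta p0) bb; last 1 first.
- pose w I := th I - p0 I + u I; exists w.
    move=> I; rewrite /w mulrDr; apply: BMD.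
      rewrite /p0; case: ifP => iI; last by rewrite subrr mulr0; exact: BM0.
      rewrite subr0 xpowT' iI sumT' iI /th.
      have -> : x i0 * xpow T I * ((x i0)^-1 * y I) = xpow T I * y I by field; exact: x0.
      by rewrite addnA addn1; exact: Cy.
    rewrite xpowT' sumT'; case: (i0 \in I); last by rewrite mul1r add0n; exact: Cu.
    by rewrite -mulrA addnA addn1 addSn; apply: BMx; exact: Cu.
  by move=> I; rewrite koszulD koszulB du dth subrK.
- move=> I; rewrite be; case: ifP => iI; last first.
    by have := Cz I; rewrite xpowT' sumT' iI mul1r add0n.
  rewrite mulrCA; apply: bimod_sgn; rewrite /th.
  have hx : xpow T I = x i0 ^+ T i0 * xpow T (I :\ i0) by rewrite /xpow (big_setD1 i0).
  have hs : (\sum_(i in I) T i = T i0 + \sum_(i in I :\ i0) T i)%N by rewrite (big_setD1 i0).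
  have := Cy (I :\ i0); rewrite hx hs.
  set P := xpow T _; set s := (\sum_(_ in _) _)%N => My.
  have -> : x i0 ^+ T i0 * P * ((x i0)^-1 * y (I :\ i0)) = x i0 ^+ (T i0).-1 * (P * y (I :\ i0)).
    by rewrite -{1}(prednK T0) exprS; field; exact: x0.
  have -> : (b + (T i0 + s) = (T i0).-1 + (b.+1 + s))%N by lia.
  elim: (T i0).-1 => [|k IH]; first by rewrite mul1r.
  by rewrite exprS -mulrA addSn; exact: BMx.
- by move=> I; exact: koszulK.
Qed.

Lemma cech_exact_le T T' b0 : (forall i, (0 < T i <= T' i)%N) ->
  cech_exact T b0 -> cech_exact T' b0.
Proof.
have [n] := ubnP (\sum_i (T' i - T i))%N; elim: n T => // n IH T /ltnSE sn le ex.
have [/forallP e|/forallPn[i0]] := boolP [forall i, T' i == T i].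
  have eT I : xpow T' I = xpow T I by apply: eq_bigr => i _; rewrite (eqP (e i)).
  have eS I : (\sum_(i in I) T' i = \sum_(i in I) T i)%N by apply: eq_bigr => i _; rewrite (eqP (e i)).
  move=> a b z bb Cz dz; have [|y Cy dy] := ex a b z bb _ dz.
    by move=> I; rewrite -eT -eS; exact: Cz.
  by exists y => // I; rewrite eT eS; exact: Cy.
move=> ne; have lt : (T i0 < T' i0)%N by have /andP[_] := le i0; rewrite leq_eqVlt eq_sym (negbTE ne).
apply: (IH (fun i => T i + (i == i0))%N).
- apply: leq_trans sn; rewrite (bigD1 i0) //= [in X in (_ < X)%N](bigD1 i0) //= eqxx.
  rewrite -addSn; apply: leq_add; first lia.
  by apply: leq_sum => i /negbTE ->; rewrite addn0.
- by move=> i; have /andP[Ti le'] := le i; case: (eqVneq i i0) => [->|_]; rewrite ?addn0; lia.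
- by apply: cech_exactS => //; have /andP[] := le i0.
Qed.

Theorem graded_cech_vanishing : exists b0, forall a b z, (b0 <= b)%N ->
  (exists T, twisted (fun=> T) a b z) -> (forall I, delta z I = 0) ->
  exists2 y, (exists T, twisted (fun=> T) a b y) & forall I, delta y I = z I.
Proof.
have [b0 ex] := cech_exact1; exists b0 => a b z bb [T Cz] dz.
have exT : cech_exact (fun=> T.+1) b0 by apply: cech_exact_le ex.
have [|y Cy dy] := exT a b z bb _ dz; last by exists y => //; exists T.+1.
move=> I; have xT : xpow (fun=> T.+1) I = xpow (fun=> 1%N) I * xpow (fun=> T) I.
  by rewrite /xpow -big_split; apply: eq_bigr => i _; rewrite expr1 exprS.
have sT : (\sum_(i in I) T.+1 = #|I| + \sum_(i in I) T)%N.
  by rewrite !sum_nat_const mulnS.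
rewrite xT sT -mulrA /xpow addnCA; have := Cz I; set u := _ * z I; set c := (b + _)%N.
move: u c => u c; rewrite -sum1_card.
elim/big_rec2: _ => [|i m v _ IH Mu]; first by rewrite mul1r.
by rewrite expr1 -mulrA addSn; apply: BMx; exact: IH.
Qed.

End GradedCech.

(** * p-bases and the Cartier operator *)

Lemma pred_mod_inj p a b : (a < p)%N -> (b < p)%N ->
  ((b + (p.-1 - a)) %% p)%N = p.-1 -> a = b.
Proof.
move=> ap bp; have [ab|ab] := leqP b a; first by rewrite modn_small; lia.
by rewrite (_ : (b + (p.-1 - a) = p + (b - a).-1)%N) ?modnDl ?modn_small; lia.
Qed.

Section PBasis.
Variables (K : fieldType) (p n : nat) (charp : p \in [pchar K]).
Variable d : K -> 'rV[K]_n.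
Hypothesis dD : forall a b, d (a + b) = d a + d b.
Hypothesis dM : forall a b, d (a * b) = a *: d b + b *: d a.
Implicit Types (u : 'I_n -> K) (z : K) (b : 'I_n -> nat).

Let pp : prime p. Proof. by case/andP: charp. Qed.
Let p0 : (0 < p)%N. Proof. exact: prime_gt0. Qed.

Lemma frobD (x y : K) : (x + y) ^+ p = x ^+ p + y ^+ p.
Proof. by rewrite exprDn_pchar // pnatE. Qed.

Lemma frob_inj : injective (fun x : K => x ^+ p).
Proof.
move=> x y /= h; apply/eqP; rewrite -subr_eq0; have h2 : (x - y) ^+ p == 0.
  by rewrite -(addrK (y ^+ p) ((x - y) ^+ p)) -frobD subrK h subrr.
by move: h2; rewrite expf_eq0 => /andP[].
Qed.

Lemma frob0 : (0 : K) ^+ p = 0.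
Proof. by rewrite expr0n -[p == 0%N]negbK -lt0n p0. Qed.

Lemma frob_sum I (r : seq I) (P : pred I) (F : I -> K) :
  (\sum_(i <- r | P i) F i) ^+ p = \sum_(i <- r | P i) F i ^+ p.
Proof. exact: (big_morph (fun x : K => x ^+ p) frobD frob0). Qed.

Lemma natr_p : p%:R = 0 :> K. Proof. by case/andP: charp => _ /eqP. Qed.

Lemma frob_nat m : (m%:R : K) ^+ p = m%:R.
Proof.
elim: m => [|m IH]; first by rewrite expr0n -[p == 0%N]negbK -lt0n p0.
by rewrite -addn1 natrD frobD IH expr1n.
Qed.

Lemma nat_neq0 m : (0 < m < p)%N -> m%:R != 0 :> K.
Proof.
move=> /andP[m0 mp]; rewrite -(dvdn_pcharf charp); apply/negP => /(dvdn_leq m0).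
by rewrite leqNgt mp.
Qed.

Lemma d1 : d 1 = 0.
Proof. by have := dM 1 1; rewrite mulr1 scale1r -{1}[d 1]addr0 => /addrI/esym. Qed.

Lemma d0 : d 0 = 0.
Proof. by have := dD 0 0; rewrite addr0 -{1}[d 0]addr0 => /addrI/esym. Qed.

Lemma dX (a : K) m : d (a ^+ m) = (m%:R * a ^+ m.-1) *: d a.
Proof.
elim: m => [|m IH]; first by rewrite d1 mul0r scale0r.
rewrite exprS dM IH scalerA -scalerDl; congr (_ *: _).
case: m {IH} => [|m] /=; first by rewrite expr0; ring.
by rewrite exprS -[m.+2]addn1 natrD; ring.
Qed.

Lemma dp (a : K) : d (a ^+ p) = 0.
Proof. by rewrite dX natr_p mul0r scale0r. Qed.

Lemma dpM (a z : K) : d (a ^+ p * z) = a ^+ p *: d z.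
Proof. by rewrite dM dp scaler0 addr0. Qed.

Lemma d_nat m : d m%:R = 0.
Proof. by elim: m => [|m IH]; rewrite ?d0 // -natr1 dD IH d1 addr0. Qed.

Lemma d_natM m (z : K) : d (m%:R * z) = m%:R *: d z.
Proof. by rewrite dM d_nat scaler0 addr0. Qed.

Lemma d_sum I (r : seq I) (P : pred I) (F : I -> K) :
  d (\sum_(i <- r | P i) F i) = \sum_(i <- r | P i) d (F i).
Proof. exact: (big_morph d dD d0). Qed.

Definition tmono u b : K := \prod_i u i ^+ b i.

Definition wedge (z : 'I_n -> K) : K := \det (\matrix_(i < n) d (z i)).

(** The generating half of being a p-basis; independence comes from the nonvanishing of
    [wedge u]. *)
Definition pspan u := forall z, exists c : {ffun 'I_n -> 'I_p} -> K,
  z = \sum_a c a ^+ p * tmono u (fun i => a i).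

Definition upd (z : 'I_n -> K) i y : 'I_n -> K := fun l => if l == i then y else z l.

Lemma wedge_upd (z : 'I_n -> K) i y y' s s' x : d x = s *: d y + s' *: d y' ->
  wedge (upd z i x) = s * wedge (upd z i y) + s' * wedge (upd z i y').
Proof.
move=> e; apply: (@determinant_multilinear _ _ _ _ _ i).
- by apply/rowP => j; rewrite !mxE /upd eqxx e !mxE.
- by apply/matrixP => a j; rewrite !mxE /upd eq_sym (negbTE (neq_lift _ _)).
- by apply/matrixP => a j; rewrite !mxE /upd eq_sym (negbTE (neq_lift _ _)).
Qed.

Lemma wedge_scale (z : 'I_n -> K) i y s x : d x = s *: d y -> wedge (upd z i x) = s * wedge (upd z i y).
Proof.
move=> e; rewrite (@wedge_upd z i y y s 0 x) ?mul0r ?addr0 //.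
by rewrite scale0r addr0.
Qed.

Lemma upd_id (z : 'I_n -> K) i : upd z i (z i) = z.
Proof. by apply/funext => l; rewrite /upd; case: eqP => // ->. Qed.

Section Basis.
Variable u : 'I_n -> K.
Hypotheses (Wu : wedge u != 0) (spu : pspan u).

Let U := \matrix_(i < n) d (u i).
Let Uunit : U \in unitmx. Proof. by rewrite unitmxE unitfE. Qed.

Definition partial i z : K := (d z *m invmx U) 0 i.

Lemma d_partial z : d z = \sum_i partial i z *: d (u i).
Proof.
rewrite -{1}(mulmxKV Uunit (d z)) mulmx_sum_row.
by apply: eq_bigr => i _; rewrite rowK.
Qed.

Lemma partialD i (a b : K) : partial i (a + b) = partial i a + partial i b.
Proof. by rewrite /partial dD mulmxDl mxE. Qed.

Lemma partialM i (a b : K) : partial i (a * b) = a * partial i b + b * partial i a.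
Proof. by rewrite /partial dM mulmxDl -!scalemxAl !mxE. Qed.

Lemma partial_u i j : partial i (u j) = (i == j)%:R.
Proof.
have e : d (u j) = row j U by rewrite rowK.
by rewrite /partial e -row_mul mulmxV // !mxE eq_sym.
Qed.

Lemma partial_const i z : d z = 0 -> partial i z = 0.
Proof. by rewrite /partial => ->; rewrite mul0mx mxE. Qed.

Lemma partialX i (a : K) m : partial i (a ^+ m) = m%:R * a ^+ m.-1 * partial i a.
Proof. by rewrite /partial dX -scalemxAl mxE. Qed.

Lemma partial_iter i (y : K) a m : partial i y = 0 ->
  iter m (partial i) (y * u i ^+ a) = (a ^_ m)%:R * y * u i ^+ (a - m).
Proof.
move=> y0; elim: m => [|m IH]; first by rewrite mul1r subn0.
rewrite iterS IH partialM partialX partial_u eqxx mulr1 partialM y0 mulr0 add0r.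
rewrite (partial_const _ (d_nat _)) mulr0 mulr0 addr0 ffactnSr natrM subnS.
have [am|am] := leqP a m; last by ring.
by rewrite (eqP am : (a - m = 0)%N) mul0r mulr0 mulr0 !mul0r.
Qed.

(** Over all indices, the product of the ∂_i^(p-1) is K^p-linear and keeps only the coefficient of
    the top monomial u^(p-1). Being a differential operator, it preserves a local ring with
    coordinates u, which makes the Cartier operator integral in [Phi_in]. *)
Definition bigpartial (s : seq 'I_n) z : K := foldr (fun i y => iter p.-1 (partial i) y) z s.

Lemma iter_partialD i m (a b : K) : iter m (partial i) (a + b) = iter m (partial i) a + iter m (partial i) b.
Proof. by elim: m => //= m ->; rewrite partialD. Qed.

Lemma bigpartialD s (a b : K) : bigpartial s (a + b) = bigpartial s a + bigpartial s b.
Proof. by elim: s => //= i s ->; rewrite iter_partialD. Qed.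

Lemma bigpartial_mono s (c : K) b : uniq s -> bigpartial s (c ^+ p * tmono u b) =
  (\prod_(i <- s) ((b i) ^_ p.-1)%:R) * c ^+ p *
  tmono u (fun i => if i \in s then (b i - p.-1)%N else b i).
Proof.
elim: s => [|i s IH] /=; first by rewrite big_nil mul1r.
move=> /andP[iS us]; rewrite IH // big_cons.
set C := \prod_(_ <- s) _.
have dC : d C = 0.
  rewrite /C; elim: (s) => [|j r IHr]; first by rewrite big_nil d1.
  by rewrite big_cons dM IHr d_nat !scaler0 addr0.
pose b1 l := if l \in s then (b l - p.-1)%N else b l.
pose R : K := \prod_(l | l != i) u l ^+ b1 l.
have -> : tmono u b1 = R * u i ^+ b i.
  by rewrite /tmono (bigD1 i) //= mulrC /b1 (negbTE iS).
rewrite mulrA partial_iter; last first.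
  have R0 : partial i R = 0.
    rewrite /R; elim: (index_enum _) => [|l r IHr]; first by rewrite big_nil (partial_const _ d1).
    rewrite big_cons; case: ifP => // li; rewrite partialM IHr mulr0 add0r.
    by rewrite partialX partial_u eq_sym (negbTE li) !mulr0.
  by rewrite !partialM R0 (partial_const _ dC) (partial_const _ (dp c)) !(mulr0, addr0).
have -> : tmono u (fun l => if l \in i :: s then (b l - p.-1)%N else b l) = R * u i ^+ (b i - p.-1).
  rewrite /tmono (bigD1 i) //= mulrC in_cons eqxx; congr (_ * _).
  by apply: eq_bigr => l li; rewrite in_cons (negbTE li).
by ring.
Qed.

Let Op z : K := bigpartial (enum 'I_n) z.

Let fact_pm1 : ((p.-1)`!)%:R = -1 :> K.
Proof.
apply/eqP; rewrite -addr_eq0 -(natrD _ _ 1) addn1 -(dvdn_pcharf charp) -Wilson //.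
exact: prime_gt1.
Qed.

Lemma Op_mono (c : K) b : (forall i, (b i < p)%N) ->
  Op (c ^+ p * tmono u b) = if [forall i, b i == p.-1] then (-1) ^+ n * c ^+ p else 0.
Proof.
move=> bp; rewrite /Op bigpartial_mono ?enum_uniq // big_enum /=.
case: ifP => [/forallP ball|/negbT/forallPn[i bi]].
  have -> : \prod_(i < n) ((b i) ^_ p.-1)%:R = (-1) ^+ n :> K.
    rewrite -[n in RHS]card_ord -prodr_const; apply: eq_bigr => i _.
    by rewrite (eqP (ball i)) ffactnn fact_pm1.
  rewrite [tmono _ _]big1 ?mulr1 // => i _.
  by rewrite mem_enum (eqP (ball i)) subnn.
rewrite (bigD1 i) //= ffact_small ?mul0r //.
by have := bp i; rewrite -[p in X in X -> _](prednK p0) ltnS leq_eqVlt (negbTE bi).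
Qed.

(* The Cartier operator in the coordinates u, i.e. the p-th root of the coefficient
   of u^(p-1) in z; the sign is (p-1)!^n, by Wilson's theorem. *)
Definition Phi z : K := xget 0 [set c : K | c ^+ p = (-1) ^+ n * Op z].

Lemma PhiE z : Phi z ^+ p = (-1) ^+ n * Op z.
Proof.
rewrite /Phi; case: xgetP => [c _ //|h].
have [c zE] := spu z.
have OpD (a b : K) : Op (a + b) = Op a + Op b by exact: bigpartialD.
have Op0 : Op 0 = 0 by have := OpD 0 0; rewrite addr0 -{1}[Op 0]addr0 => /addrI/esym.
have [] := h (\sum_(a : {ffun 'I_n -> 'I_p} | [forall i, val (a i) == p.-1]) c a).
rewrite /= zE frob_sum (big_morph Op OpD Op0).
rewrite mulr_sumr big_mkcond; apply: eq_bigr => a _; rewrite Op_mono; last by move=> i.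
by case: ifP => _; rewrite ?mulr0 // mulrA -expr2 sqrr_sign mul1r.
Qed.

Lemma PhiD (a b : K) : Phi (a + b) = Phi a + Phi b.
Proof. by apply: frob_inj; rewrite /= frobD !PhiE /Op bigpartialD mulrDr. Qed.

Lemma Phi0 : Phi 0 = 0.
Proof. by have := PhiD 0 0; rewrite addr0 -{1}[Phi 0]addr0 => /addrI/esym. Qed.

Lemma Phi_sum I (r : seq I) (P : pred I) (F : I -> K) :
  Phi (\sum_(i <- r | P i) F i) = \sum_(i <- r | P i) Phi (F i).
Proof. exact: (big_morph Phi PhiD Phi0). Qed.

Lemma Phi_mono0 (c : K) b : (forall i, (b i < p)%N) ->
  Phi (c ^+ p * tmono u b) = if [forall i, b i == p.-1] then c else 0.
Proof.
move=> bp; apply: frob_inj; rewrite /= PhiE Op_mono //; case: ifP => _; last first.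
  by rewrite mulr0 expr0n -[p == 0%N]negbK -lt0n p0.
by rewrite mulrA -expr2 sqrr_sign mul1r.
Qed.

Lemma PhiZ (a z : K) : Phi (a ^+ p * z) = a * Phi z.
Proof.
have [c ->] := spu z; rewrite mulr_sumr !Phi_sum mulr_sumr; apply: eq_bigr => b _.
rewrite mulrA -exprMn !Phi_mono0 => [|i|i] //.
by case: ifP; rewrite ?mulr0.
Qed.

Lemma u_neq0 i : u i != 0.
Proof.
apply/eqP => ui0; move: Wu; rewrite -(upd_id u i) (@wedge_scale u i 0 0) ?mul0r ?eqxx //.
by rewrite ui0 d0 scaler0.
Qed.

Lemma tmonoD b b' : tmono u b * tmono u b' = tmono u (fun i => b i + b' i)%N.
Proof. by rewrite /tmono -big_split /=; apply: eq_bigr => i _; rewrite exprD. Qed.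

Lemma Phi_mono b : Phi (tmono u b) =
  if [forall i, b i %% p == p.-1]%N then tmono u (fun i => b i %/ p)%N else 0.
Proof.
have -> : tmono u b = tmono u (fun i => b i %/ p)%N ^+ p * tmono u (fun i => b i %% p)%N.
  rewrite /tmono -prodrXl -big_split /=; apply: eq_bigr => i _.
  by rewrite -exprM -exprD -divn_eq.
by rewrite Phi_mono0 // => i; rewrite ltn_mod.
Qed.

(** The monomials u^(p-1-a) are dual to the u^a under the pairing [Phi] of a product. *)
Lemma Phi_expand z : z = \sum_(a : {ffun 'I_n -> 'I_p})
  Phi (z * tmono u (fun i => p.-1 - a i)%N) ^+ p * tmono u (fun i => a i).
Proof.
have [c zE] := spu z; rewrite {1}zE; apply: eq_bigr => a _; congr (_ ^+ p * _).
rewrite zE mulr_suml Phi_sum (bigD1 a) //= big1 ?addr0 => [|b ba]; rewrite -mulrA tmonoD PhiZ Phi_mono.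
  have lt i : (a i + (p.-1 - a i) = p.-1)%N by rewrite subnKC // -ltnS prednK.
  have pm : (p.-1 < p)%N by rewrite prednK.
  case: ifP => [_|/negbT/forallPn[i]]; last by rewrite lt modn_small ?eqxx.
  rewrite [tmono _ _]big1 ?mulr1 // => i _; by rewrite lt divn_small.
case: ifP => [/forallP h|_]; last by rewrite mulr0.
case/eqP: ba; apply/ffunP => i; apply/val_inj => /=.
exact/esym/(pred_mod_inj (ltn_ord _) (ltn_ord _) (eqP (h i))).
Qed.

(** The entries of z are expanded in the p-basis one at a time; m counts those still arbitrary. *)
Lemma multi_ind (Q : ('I_n -> K) -> Prop) :
  (forall (z : 'I_n -> K) i y y', Q (upd z i y) -> Q (upd z i y') -> Q (upd z i (y + y'))) ->
  (forall (z : 'I_n -> K) i (a y : K), Q (upd z i y) -> Q (upd z i (a ^+ p * y))) ->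
  (forall b : 'I_n -> 'I_n -> nat, Q (fun i => tmono u (b i))) -> forall z : 'I_n -> K, Q z.
Proof.
move=> QD QZ Qm; have main m (z : 'I_n -> K) : (m <= n)%N ->
    (forall i : 'I_n, (m <= i)%N -> exists b, z i = tmono u b) -> Q z.
  elim: m z => [|m IH] z mn zm.
    have /choice[b bP] : forall i, exists b, z i = tmono u b by move=> i; exact: zm.
    by rewrite (_ : z = fun i => tmono u (b i)) //; apply/funext.
  pose i := Ordinal mn; rewrite -(upd_id z i).
  have Qmono b : Q (upd z i (tmono u b)).
    apply: IH => [|l ml]; first exact: ltnW.
    rewrite /upd; case: eqP => [_|/eqP li]; first by exists b.
    by apply: zm; rewrite ltn_neqAle eq_sym ml andbT; exact: li.
  have Qz (c : K) b : Q (upd z i (c ^+ p * tmono u b)) by apply: QZ.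
  have [c ->] := spu (z i); apply: (big_ind (fun y => Q (upd z i y))) => [|y y'|a _].
  - rewrite (_ : 0 = 0 ^+ p * tmono u (fun=> 0%N)); first exact: Qz.
    by rewrite expr0n -[p == 0%N]negbK -lt0n p0 mul0r.
  - exact: QD.
  - exact: Qz.
by move=> z; apply: (main n) => // i; rewrite leqNgt ltn_ord.
Qed.

(** P is ((y + y')^p - y^p - y'^p) / p, computed with the integers C(p, i) / p. *)
Lemma logform_add (y y' : K) : exists P,
  (y + y') ^+ p.-1 *: d (y + y') = y ^+ p.-1 *: d y + y' ^+ p.-1 *: d y' + d P.
Proof.
have [q pq] : exists q, p = q.+1 by exists p.-1; rewrite prednK.
pose c i := ('C(p, i) %/ p)%N.
have cE i : (0 < i < p)%N -> ('C(p, i) = c i * p)%N.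
  by move=> ip; rewrite /c divnK // prime_dvd_bin.
have cc i : (i < q)%N -> (c i.+1 * i.+1 = 'C(q, i))%N /\ (c i.+1 * (q - i) = 'C(q, i.+1))%N.
  move=> iq; have e : ('C(q.+1, i.+1) = c i.+1 * q.+1)%N by rewrite -pq; apply: cE; rewrite pq /= ltnS.
  have := mul_bin_diag q.+1 i; have := mul_bin_down q i.+1; rewrite /= e => h1 h2.
  split; first by nia.
  by have := mul_bin_left q i; nia.
exists (\sum_(i < q) (c i.+1)%:R * (y ^+ i.+1 * y' ^+ (q - i))).
rewrite d_sum pq /=.
have term (i : 'I_q) : d ((c i.+1)%:R * (y ^+ i.+1 * y' ^+ (q - i))) =
    ('C(q, i)%:R * (y ^+ i * y' ^+ (q - i))) *: d y +
    ('C(q, i.+1)%:R * (y ^+ i.+1 * y' ^+ (q - i.+1))) *: d y'.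
  have iq := ltn_ord i; have [c1 c2] := cc _ iq.
  rewrite d_natM dM !dX scalerDr !scalerA addrC; congr (_ *: _ + _ *: _).
    by rewrite -c1 natrM /=; ring.
  by rewrite -c2 natrM subnS /=; ring.
under eq_bigr do rewrite term.
rewrite big_split /= -!scaler_suml dD scalerDr.
have expand : (y + y') ^+ q = \sum_(i < q.+1) 'C(q, i)%:R * (y ^+ i * y' ^+ (q - i)).
  rewrite addrC exprDn; apply: eq_bigr => i _; rewrite mulr_natl.
  by rewrite [y ^+ _ * _]mulrC.
set A := \sum_(_ < q) _; set B := \sum_(_ < q) _.
have eA : (y + y') ^+ q = y ^+ q + A.
  by rewrite expand big_ord_recr /= binn subnn mulr1 mul1r addrC.
have eB : (y + y') ^+ q = y' ^+ q + B.
  by rewrite expand big_ord_recl /= bin0 subn0 !mul1r.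
by rewrite {1}eA eB !scalerDl addrACA.
Qed.

Let rat' (z : 'I_n -> K) := wedge z / wedge u.

Lemma d_tmono b : d (tmono u b) = \sum_j ((b j)%:R * tmono u b / u j) *: d (u j).
Proof.
have gen (r : seq 'I_n) : d (\prod_(i <- r) u i ^+ b i) =
    \sum_(j <- r) ((b j)%:R * (\prod_(i <- r) u i ^+ b i) / u j) *: d (u j).
  elim: r => [|i r IH]; first by rewrite !big_nil d1.
  rewrite !big_cons dM IH dX addrC scaler_sumr scalerA; congr (_ + _).
    congr (_ *: _); case: (b i) => [|m]; first by rewrite !mul0r mulr0.
    by rewrite /= exprS; field; exact: u_neq0.
  by apply: eq_bigr => j _; rewrite scalerA; congr (_ *: _); field; exact: u_neq0.
exact: gen.
Qed.

(** In the basis of the du_j / u_j, the logarithmic differential of a monomial has its exponents as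
    coordinates. *)
Lemma rat_tmono (b : 'I_n -> 'I_n -> nat) : rat' (fun i => tmono u (b i)) =
  (\prod_i tmono u (b i)) * (\prod_j u j)^-1 * \det (\matrix_(i, j) ((b i j)%:R : K)).
Proof.
rewrite /rat' /wedge.
have -> : \matrix_(i < n) d (tmono u (b i)) =
   diag_mx (\row_i tmono u (b i)) *m (\matrix_(i, j) ((b i j)%:R : K)) *m
   diag_mx (\row_j (u j)^-1) *m \matrix_(i < n) d (u i).
  apply/matrixP => i j; rewrite mul_diag_mx mul_mx_diag !mxE d_tmono summxE.
  by apply: eq_bigr => l _; rewrite !mxE; ring.
rewrite !det_mulmx !det_diag; under eq_bigr do rewrite mxE.
under [\prod_(i < n) (\row_j (u j)^-1) 0 i]eq_bigr do rewrite mxE.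
by rewrite prodfV mulfK //; ring.
Qed.

Lemma wedge_lin (z : 'I_n -> K) i : exists c : 'cV[K]_n,
  forall x, wedge (upd z i x) = (d x *m c) 0 0.
Proof.
pose A x := \matrix_(l < n) d (upd z i x l).
exists (\col_j cofactor (A 0) i j) => x.
rewrite /wedge (expand_det_row _ i) mxE; apply: eq_bigr => j _; rewrite !mxE /upd eqxx.
congr (_ * (_ * \det _)); apply/matrixP => a b; rewrite !mxE /upd.
by rewrite eq_sym (negbTE (neq_lift _ _)).
Qed.

Let L (S : {set 'I_n}) (z : 'I_n -> K) := \prod_(l | l \notin S) z l ^+ p.-1 * rat' z.
Let rest (S : {set 'I_n}) (z : 'I_n -> K) i :=
  \prod_(l | (l \notin S) && (l != i)) z l ^+ p.-1.

Let L_upd (S : {set 'I_n}) (z : 'I_n -> K) i (y : K) : L S (upd z i y) =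
  (if i \in S then 1 else y ^+ p.-1) * rest S z i * rat' (upd z i y).
Proof.
rewrite /L; congr (_ * _); have e : rest S z i =
    \prod_(l | (l \notin S) && (l != i)) upd z i y l ^+ p.-1.
  by apply: eq_bigr => l /andP[_ /negbTE li]; rewrite /upd li.
rewrite e; have [iS|iS] := boolP (i \in S).
  rewrite mul1r; apply: eq_bigl => l; case: eqP => [->|_]; last by rewrite andbT.
  by rewrite iS.
by rewrite (bigD1 i) //= /upd eqxx.
Qed.

Let rest_setU1 (S : {set 'I_n}) (z : 'I_n -> K) i : rest (i |: S)%SET z i = rest S z i.
Proof.
apply: eq_bigl => l; rewrite finset.in_setU1 negb_or.
by case: (l == i); rewrite /= ?andbF // andbT.
Qed.

Let prod_u_inv : (\prod_j u j)^-1 = (\prod_j u j)^-1 ^+ p * tmono u (fun=> p.-1).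
Proof.
rewrite /tmono; have -> : \prod_i u i ^+ p.-1 = (\prod_i u i) ^+ p.-1 by rewrite prodrXl.
have nz : \prod_j u j != 0 by apply/prodf_neq0 => j _; exact: u_neq0.
set P := \prod_j u j in nz *; have -> : P^-1 ^+ p = P^-1 * P^-1 ^+ p.-1 by rewrite -exprS prednK.
by rewrite -mulrA -exprMn mulVf // expr1n mulr1.
Qed.

Let det_rows_dvd (S : {set 'I_n}) (b : 'I_n -> 'I_n -> nat) : S != finset.set0 ->
  (forall j, p %| \sum_(i in S) b i j)%N -> \det (\matrix_(i, j) ((b i j)%:R : K)) = 0.
Proof.
case/finset.set0Pn => i iS h; apply/eqP/det0P; exists (\row_l (l \in S)%:R).
  by apply/eqP => /rowP /(_ i)/eqP; rewrite !mxE iS oner_eq0.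
apply/rowP => j; rewrite !mxE; under eq_bigr do rewrite !mxE mulr_natl mulrb.
by rewrite -big_mkcond -natr_sum /=; apply/eqP; rewrite -(dvdn_pcharf charp).
Qed.

(* The Cartier operator kills exact forms and fixes logarithmic ones, S being the
   set of the exact factors.  As y^(p-1) dy is additive in y modulo exact forms, it
   is enough to check this on monomials, by descending induction on S. *)
Lemma Phi_exact (S : {set 'I_n}) (z : 'I_n -> K) :
  Phi (\prod_(i | i \notin S) z i ^+ p.-1 * (wedge z / wedge u)) =
  if S == finset.set0 then wedge z / wedge u else 0.
Proof.
suff: Phi (L S z) = if S == finset.set0 then rat' z else 0 by [].
have [m] := ubnP #|finset.setC S|; elim: m S z => // m IH S z cS.
have ratD (z0 : 'I_n -> K) i y y' : rat' (upd z0 i (y + y')) = rat' (upd z0 i y) + rat' (upd z0 i y').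
  have [c cE] := wedge_lin z0 i.
  by rewrite /rat' -mulrDl !cE dD mulmxDl mxE.
move: z; apply: multi_ind => [z i y y' hy hy'|z i a y hy|b].
- have [iS|iS] := boolP (i \in S).
    have Sn : (S == finset.set0) = false by apply/negP => /eqP S0; rewrite S0 finset.inE in iS.
    move: hy hy'; rewrite Sn !L_upd iS => hy hy'.
    by rewrite ratD mulrDr PhiD hy hy' addr0.
  have [P Pe] := logform_add y y'; have [c cE] := wedge_lin z i.
  have LE : L S (upd z i (y + y')) = L S (upd z i y) + L S (upd z i y') +
      L (i |: S)%SET (upd z i P).
    pose g (v : 'rV[K]_n) := (v *m c) 0 0.
    have gD v v' : g (v + v') = g v + g v' by rewrite /g mulmxDl mxE.
    have gZ a v : g (a *: v) = a * g v by rewrite /g -scalemxAl mxE.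
    have := congr1 g Pe; rewrite gD gZ !gD !gZ => e.
    rewrite !L_upd (negbTE iS) finset.setU11 rest_setU1 mul1r /rat' !cE -!/(g _).
    rewrite (_ : _ * (g (d (y + y')) / _) =
      rest S z i / wedge u * ((y + y') ^+ p.-1 * (g (d (y + y'))))); last by ring.
    by rewrite e; ring.
  rewrite LE !PhiD hy hy' IH; last first.
    rewrite -ltnS; apply: leq_trans cS; rewrite ltnS; apply: proper_card; apply/properP; split.
      by apply/fintype.subsetP => l; rewrite !finset.inE negb_or => /andP[].
    by exists i; rewrite !finset.inE ?iS ?eqxx.
  have -> : ((i |: S)%SET == finset.set0) = false.
    by apply/negP => /eqP/setP /(_ i); rewrite !finset.inE eqxx.
  by rewrite addr0; case: ifP => // _; rewrite ?ratD ?addr0.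
- have rZ : rat' (upd z i (a ^+ p * y)) = a ^+ p * rat' (upd z i y).
    by rewrite /rat' (@wedge_scale z i y (a ^+ p)) ?dpM ?mulrA.
  have LZ : exists2 e : K, L S (upd z i (a ^+ p * y)) = e ^+ p * L S (upd z i y) &
      (i \notin S -> e = a ^+ p).
    have [iS|iS] := boolP (i \in S).
      by exists a => //; rewrite !L_upd iS rZ; ring.
    exists (a ^+ p) => //; rewrite !L_upd (negbTE iS) rZ exprMn.
    have -> : (a ^+ p) ^+ p = (a ^+ p) ^+ p.-1 * a ^+ p by rewrite -exprSr prednK.
    by ring.
  have [e eE ei] := LZ; rewrite eE PhiZ hy; case: ifP => [/eqP S0|_]; last by rewrite mulr0.
  by rewrite rZ ei // S0 finset.inE.
- set z : 'I_n -> K := fun i => _; set del := \det (\matrix_(i, j) ((b i j)%:R : K)).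
  have delp : del ^+ p = del.
    rewrite -[del ^+ p]/(pFrobenius_aut charp del) -det_map_mx; congr (\det _).
    by apply/matrixP => i j; rewrite !mxE; exact: frob_nat.
  have LE : L S z = (del * (\prod_(i | i \notin S) z i) * (\prod_j u j)^-1) ^+ p *
      tmono u (fun j => p.-1 + \sum_(i in S) b i j)%N.
    have tS : tmono u (fun j => \sum_(i in S) b i j)%N = \prod_(i in S) z i.
      rewrite /z /tmono exchange_big /=; apply: eq_bigr => j _.
      by rewrite expr_sum.
    rewrite -tmonoD tS /L rat_tmono -/del [in LHS]prod_u_inv !exprMn delp -prodrXl.
    rewrite [\prod_i tmono u (b i)](bigID (mem S)) /=.
    have -> : \prod_(i | i \notin S) z i ^+ p =
       \prod_(i | i \notin S) z i ^+ p.-1 * \prod_(i | i \notin S) z i.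
      by rewrite -big_split /=; apply: eq_bigr => i _; rewrite -exprSr prednK.
    by rewrite /z; ring.
  rewrite LE PhiZ Phi_mono; have pm : (p.-1 < p)%N by rewrite prednK.
  have [S0|Sn] := eqVneq S finset.set0.
    rewrite (_ : [forall i, _] = true); last first.
      by apply/forallP => i; rewrite S0 finset.big_set0 addn0 modn_small.
    rewrite [tmono _ _]big1 ?mulr1 => [|i _]; last first.
      by rewrite S0 finset.big_set0 addn0 divn_small.
    rewrite rat_tmono -/del S0; under eq_bigl do rewrite finset.inE.
    by rewrite /z /=; ring.
  (* The exponents are all p - 1 modulo p only if the rows of b in S add up to zero modulo p, and
     then the determinant vanishes. *)
  case: ifP => [/forallP h|_]; last by rewrite mulr0.
  rewrite /del (@det_rows_dvd S) ?mul0r // => j.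
  have := h j; rewrite -[X in _ == X](modn_small pm) -{2}[p.-1]addn0 eqn_modDl.
  by rewrite mod0n.
Qed.

End Basis.

Lemma wedge_scaled (u z : 'I_n -> K) (s : 'I_n -> K) : (forall i, d (z i) = s i *: d (u i)) ->
  wedge z = (\prod_i s i) * wedge u.
Proof.
move=> h; rewrite /wedge (_ : \matrix_(i < n) d (z i) = diag_mx (\row_i s i) *m \matrix_(i < n) d (u i)).
  by rewrite det_mulmx det_diag; under eq_bigr do rewrite mxE.
by apply/matrixP => i j; rewrite mul_diag_mx !mxE h mxE.
Qed.

(** The Cartier operator does not depend on the p-basis. By semilinearity only y = u'^a matters. If
    some a_i + 1 is invertible, u'^a du' has an exact factor and both sides vanish; if all a_i are p
    - 1, the form is a p-th power times a logarithmic one, which is fixed by [Phi_exact]. *)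
Lemma Phi_change u u' (y : K) : wedge u != 0 -> pspan u -> pspan u' ->
  Phi u (y * (wedge u' / wedge u)) = Phi u' y * (wedge u' / wedge u).
Proof.
move=> Wu spu spu'; have [W'0|W'n] := eqVneq (wedge u') 0.
  by rewrite W'0 mul0r !mulr0 (Phi0 Wu spu).
have [W WE] : exists W, W = wedge u' / wedge u by eexists.
have [c ->] := spu' y; rewrite -WE mulr_suml (Phi_sum Wu spu) (Phi_sum W'n spu') mulr_suml.
apply: eq_bigr => a _; rewrite -mulrA (PhiZ Wu spu) (Phi_mono0 W'n spu') => [|i] //.
pose S : {set 'I_n} := finset.finset (fun i => val (a i) != p.-1).
pose z i := if i \in S then u' i ^+ (a i).+1 else u' i.
pose s i : K := if i \in S then (a i).+1%:R * u' i ^+ a i else 1.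
have zs i : d (z i) = s i *: d (u' i).
  by rewrite /z /s; case: ifP => _; rewrite ?scale1r // dX.
pose N := \prod_(i in S) (a i).+1.
have ex : N%:R ^+ p * (tmono u' (fun i => a i) * (wedge u' / wedge u)) =
   \prod_(i | i \notin S) z i ^+ p.-1 * (wedge z / wedge u).
  rewrite (wedge_scaled zs)  frob_nat /tmono [\prod_i u' i ^+ a i](bigID (mem S)) /= /N natr_prod.
  rewrite [\prod_i s i](bigID (mem S)) /= [X in _ * (_ * X * _ / _)]big1 => [|i iS]; last first.
    by rewrite /s (negbTE iS).
  have -> : \prod_(i in S) s i = \prod_(i in S) (a i).+1%:R * \prod_(i in S) u' i ^+ a i.
    by rewrite -big_split; apply: eq_bigr => i iS; rewrite /s iS.
  have -> : \prod_(i | i \notin S) z i ^+ p.-1 = \prod_(i | i \notin S) u' i ^+ a i.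
    apply: eq_bigr => i iS; rewrite /z (negbTE iS).
    by move: iS; rewrite finset.inE negbK => /eqP ->.
  by ring.
rewrite -WE in ex; have Nn : N%:R != 0 :> K.
  rewrite natr_prod; apply/prodf_neq0 => i; rewrite finset.inE => ai.
  apply: nat_neq0; rewrite /= ltn_neqAle ltn_ord andbT.
  by apply: contra ai => /eqP h; rewrite -[X in _ == X.-1]h.
have := Phi_exact Wu spu S z; rewrite -ex (PhiZ Wu spu) => e.
case: (boolP [forall i, val (a i) == p.-1]) => [/forallP h|/forallPn[i hi]]; last first.
  have Sn : (S == finset.set0) = false.
    by apply/negP => /eqP/setP /(_ i); rewrite !finset.inE hi.
  by move: e; rewrite Sn => /eqP; rewrite mulf_eq0 (negbTE Nn) => /eqP ->; rewrite mulr0 mul0r.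
have S0 : S = finset.set0 by apply/setP => i; rewrite !finset.inE /= (h i).
move: e; rewrite S0 eqxx /N S0 finset.big_set0 mul1r => ->; rewrite WE; congr (_ * (wedge _ / _)).
by apply/funext => i; rewrite /z S0 finset.inE.
Qed.

Section Integral.
Variables (E : set K) (u : 'I_n -> K).
Hypotheses (rE : subring E) (nE : int_closed E) (Wu : wedge u != 0) (spu : pspan u).
Hypothesis uE : forall i, E (u i).
Hypothesis duE : forall a, E a -> exists2 c : 'I_n -> K,
  forall i, E (c i) & d a = \sum_(i < n) c i *: d (u i).

Lemma partial_in i a : E a -> E (partial u i a).
Proof.
move=> aE; have [c cE e] := duE aE.
have -> : partial u i a = c i; last exact: cE.
have h j : (d (u j) *m invmx (\matrix_(i < n) d (u i))) 0 i = (i == j)%:R.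
  exact: (partial_u Wu).
rewrite /partial e mulmx_suml summxE (bigD1 i) //= big1 ?addr0 => [|j ji].
  by rewrite -scalemxAl mxE h eqxx mulr1.
by rewrite -scalemxAl mxE h eq_sym (negbTE ji) mulr0.
Qed.

(** Up to sign, the p-th power of [Phi u z] is obtained from z by derivations that preserve E; so
    [Phi u z] is integral over E. *)
Lemma Phi_in z : E z -> E (Phi u z).
Proof.
move=> zE; have : E (Phi u z ^+ p).
  rewrite (PhiE Wu spu); apply: (subringM rE).
    by apply: (subringX rE); apply: (subringN rE); exact: subring1.
  elim: (enum _) => //= i r IH; move: IH; set y := bigpartial _ _ _.
  elim: p.-1 => //= m IHm yE; apply: partial_in; exact: IHm.
move=> h; apply: (nE (q := 'X^p - (Phi u z ^+ p)%:P)).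
- exact: monicXnsubC.
- apply: polyOver_set => i; rewrite coefB coefXn coefC; apply: (subringB rE).
    exact: subring_nat.
  by case: ifP => _ //; exact: subring0.
- by rewrite /root !hornerE subrr.
Qed.

Lemma Phi_dual z : (forall a, E a -> E (Phi u (a * z))) -> E z.
Proof.
move=> h; rewrite (Phi_expand Wu spu z); apply: (subring_sum rE) => a _.
apply: (subringM rE); first apply: (subringX rE).
  rewrite mulrC; apply: h; apply: (subring_prod rE) => i _; exact: (subringX rE).
by apply: (subring_prod rE) => i _; exact: (subringX rE).
Qed.

Lemma iter_PhiZ e a z : iter e (Phi u) (a ^+ (p ^ e) * z) = a * iter e (Phi u) z.
Proof.
elim: e a z => [|e IH] a z; first by rewrite expr1.
by rewrite iterSr expnSr exprM (PhiZ Wu spu) IH -iterSr.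
Qed.

Lemma iter_Phi_dual e z : E z <-> forall a, E a -> E (iter e (Phi u) (a * z)).
Proof.
split=> [zE a aE|].
  have : E (a * z) by exact: subringM.
  by elim: e => //= e IH h; apply: Phi_in; exact: IH.
elim: e z => [|e IH] z h; first by have := h 1 (subring1 rE); rewrite mul1r.
apply: Phi_dual => a aE; apply: IH => c cE.
by rewrite -(PhiZ Wu spu) -iterSr mulrA; apply: h; apply: (subringM rE) => //; exact: subringX.
Qed.
End Integral.
End PBasis.

(** * Derivations in purely inseparable extensions *)

Section PurelyInseparable.
Variables (K : fieldType) (p : nat) (charp : p \in [pchar K]).
Variables (F : set K) (rF : subring F) (Fp : forall x, F (x ^+ p)).
Implicit Types (P Q R S T : {poly K}).

Let pp : prime p. Proof. by case/andP: charp. Qed.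
Let p0 : (0 < p)%N. Proof. exact: prime_gt0. Qed.

Lemma subring_inv_frob y : F y -> F y^-1.
Proof.
move=> yF; have [->|y0] := eqVneq y 0; first by rewrite invr0; exact: subring0.
have -> : y^-1 = y ^+ p.-1 * y^-1 ^+ p.
  have -> : y^-1 ^+ p = y^-1 * y^-1 ^+ p.-1 by rewrite -exprS prednK.
  by rewrite mulrCA -exprMn mulfV // expr1n mulr1.
by apply: (subringM rF) => //; exact: subringX.
Qed.

Lemma poly_div_over m P : m \is monic -> (forall i, F m`_i) -> (forall i, F P`_i) ->
  exists Q R : {poly K}, [/\ forall i, F R`_i, P = Q * m + R & (size R < size m)%N].
Proof.
move=> mm mF; have [N] := ubnP (size P); elim: N P => // N IH P sP PF.
have m0 : (0 < size m)%N by rewrite lt0n size_poly_eq0 monic_neq0.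
have [Pm|mP] := ltnP (size P) (size m); first by exists 0, P; rewrite mul0r add0r.
pose c := lead_coef P; pose k := (size P - size m)%N.
have cF : F c by exact: PF.
pose P' := P - (c%:P * 'X^k) * m.
have P'F i : F P'`_i.
  rewrite coefB -mulrA coefCM; apply: (subringB rF) => //; apply: (subringM rF) => //.
  by rewrite mulrC coefMXn; case: ifP => _; [exact: subring0|exact: mF].
have [Q [R [RF PE sR]]] : exists Q R : {poly K}, [/\ forall i, F R`_i, P' = Q * m + R & (size R < size m)%N].
  apply: IH => //; rewrite -ltnS; apply: leq_trans sP.
  have P0 : P != 0 by rewrite -size_poly_gt0; exact: leq_trans m0 mP.
  have cX0 : c%:P * 'X^k != 0 by rewrite -size_poly_gt0 size_Cmul ?lead_coef_eq0 // size_polyXn.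
  have sc : size (c%:P * 'X^k * m) = size P.
    by rewrite size_Mmonic // size_Cmul ?lead_coef_eq0 // size_polyXn addSn /= /k subnK.
  have sP0 : (0 < size P)%N by rewrite size_poly_gt0.
  suff h : (size P' <= (size P).-1)%N by rewrite ltnS -(prednK sP0) ltnS.
  apply/leq_sizeP => j; rewrite leq_eqVlt => /orP[/eqP <-|jP]; rewrite /P'.
    have lc : lead_coef (c%:P * 'X^k * m) = c.
      by rewrite lead_coef_Mmonic // lead_coefM lead_coefC lead_coefXn mulr1.
    by rewrite coefB -{2}sc -!lead_coefE lc subrr.
  have jP' : (size P <= j)%N by rewrite -(prednK sP0).
  by rewrite coefB !nth_default ?subrr // sc.
exists (Q + c%:P * 'X^k), R; split=> //.
by rewrite mulrDl addrAC -PE /P' subrK.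
Qed.

Variable z : K.
Hypothesis zF : ~ F z.

Let m0 : {poly K} := ('X - z%:P) ^+ p.
Let m0E : m0 = 'X^p - (z ^+ p)%:P.
Proof.
have cp : p \in [pchar {poly K}] by rewrite pchar_poly.
by rewrite /m0 -[_ ^+ p]/(pFrobenius_aut cp _) rmorphB /= !pFrobenius_autE rmorphXn.
Qed.

(* The minimal polynomial of z over F is X^p - z^p, the derivative of which is 0. *)
Lemma deriv_kill P : (forall i, F P`_i) -> P.[z] = 0 -> P^`().[z] = 0.
Proof.
move=> PF Pz.
pose ann Q := [/\ forall i, F Q`_i, Q.[z] = 0 & Q != 0].
have m0ann : ann m0.
  split=> [i||]; rewrite ?expf_neq0 ?polyXsubC_eq0 //.
    rewrite m0E coefB coefXn coefC; apply: (subringB rF); first exact: subring_nat.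
    by case: ifP => // _; exact: subring0.
  by rewrite m0E !hornerE subrr.
have ex : exists n, `[< exists2 Q, ann Q & size Q = n >].
  by exists (size m0); apply/asboolP; exists m0.
have [n /asboolP[Q [QF Qz Q0] Qn] min] := ex_minnP ex.
pose c := (lead_coef Q)^-1; have c0 : c != 0 by rewrite invr_eq0 lead_coef_eq0.
pose m := c *: Q.
have mm : m \is monic by rewrite monicE lead_coefZ mulVf // lead_coef_eq0.
have mF i : F m`_i by rewrite coefZ; apply: (subringM rF) (QF i); apply: subring_inv_frob; exact: QF.
have mz : m.[z] = 0 by rewrite hornerZ Qz mulr0.
have dvd R : (forall i, F R`_i) -> R.[z] = 0 -> m %| R.
  move=> RF Rz; have [T [S [SF RE sS]]] := poly_div_over mm mF RF.
  suff S0 : S = 0 by rewrite RE S0 addr0 dvdp_mull.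
  apply/eqP; apply: contraT => Sn; have := min (size S).
  rewrite leqNgt -Qn; have -> : (size S < size Q)%N by rewrite -(size_scale Q c0).
  move=> h; suff: false by []; apply: h; apply/asboolP; exists S => //; split=> //.
  by move: Rz; rewrite RE hornerD hornerM mz mulr0 add0r.
have [m0F m0z _] := m0ann; have /dvdp_exp_XsubCP[k kp mk] := dvd _ m0F m0z.
have {}mk : m = ('X - z%:P) ^+ k.
  by apply/eqP; rewrite -eqp_monic // monic_exp // monicXsubC.
have kE : k = p.
  apply/eqP; rewrite eqn_leq kp leqNgt; apply/negP => kltp.
  have k0 : (0 < k)%N.
    by case: (k) mk => // e; move: mz; rewrite e expr0 hornerC => /eqP; rewrite oner_eq0.
  have kn : k%:R != 0 :> K by apply: (nat_neq0 charp); rewrite k0.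
  have cE : m`_k.-1 = - (k%:R * z).
    have {}mk : m = \prod_(x <- nseq k z) ('X - x%:P) by rewrite mk big_nseq -Monoid.iteropE.
    have := @coefPn_prod_XsubC _ (nseq k z); rewrite -mk size_nseq => ->; last by rewrite -lt0n.
    by rewrite big_nseq iter_addr_0 mulr_natl.
  apply: zF; rewrite -(mulKf kn z); apply: (subringM rF).
    by apply: subring_inv_frob; exact: subring_nat.
  by rewrite -[_ * _]opprK -cE; apply: (subringN rF).
have mE : m = m0 by rewrite mk kE.
have /dvdpP[S ->] := dvd _ PF Pz.
rewrite derivM mE hornerD !hornerM m0z mulr0 add0r m0E derivB derivC derivXn subr0.
by rewrite hornerMn -mulr_natr (natr_p charp) !mulr0.
Qed.
End PurelyInseparable.

Section PSpanRing.
Variables (K : fieldType) (p n : nat) (charp : p \in [pchar K]) (u : 'I_n -> K).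

Let p0 : (0 < p)%N. Proof. by case/andP: charp => /prime_gt0. Qed.

Definition psum : set K := [set z | exists c : {ffun 'I_n -> 'I_p} -> K,
  z = \sum_a c a ^+ p * tmono u (fun i => a i)].

Lemma psumD x y : psum x -> psum y -> psum (x + y).
Proof.
move=> [c ->] [c' ->]; exists (fun a => c a + c' a); rewrite -big_split /=.
by apply: eq_bigr => a _; rewrite (frobD charp) mulrDl.
Qed.

Lemma psumZ x y : psum y -> psum (x ^+ p * y).
Proof.
move=> [c ->]; exists (fun a => x * c a); rewrite mulr_sumr.
by apply: eq_bigr => a _; rewrite exprMn mulrA.
Qed.

Lemma psum_mono b : psum (tmono u b).
Proof.
pose a0 : {ffun 'I_n -> 'I_p} := [ffun i => Ordinal (ltn_pmod (b i) p0)].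
exists (fun a => if a == a0 then tmono u (fun i => b i %/ p)%N else 0).
rewrite (bigD1 a0) //= eqxx big1 ?addr0 => [|a /negbTE ->]; last by rewrite (frob0 charp) mul0r.
rewrite /tmono -prodrXl -big_split /=; apply: eq_bigr => i _.
by rewrite ffunE /= -exprM -exprD -divn_eq.
Qed.

Lemma psum0 : psum 0.
Proof. by rewrite -(mul0r (tmono u (fun=> 0%N))) -(frob0 charp); apply/psumZ/psum_mono. Qed.

Lemma psum_frob x : psum (x ^+ p).
Proof.
rewrite -[_ ^+ p]mulr1 (_ : 1 = tmono u (fun=> 0%N)); first exact/psumZ/psum_mono.
by rewrite /tmono big1.
Qed.

Lemma psum_subring : subring psum.
Proof.
split; first by rewrite -(expr1n _ p); exact: psum_frob.
- move=> x y hx hy; apply: psumD => //; have -> : - y = (-1) ^+ p * y.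
    by have /eqP := frobD charp (-1) 1; rewrite addNr (frob0 charp) expr1n eq_sym addr_eq0 => /eqP ->; rewrite mulN1r.
  exact: psumZ.
- move=> _ _ [c ->] [c' ->]; rewrite mulr_suml; apply: (big_ind psum) => [|x y|a _]; first exact: psum0.
    exact: psumD.
  rewrite mulr_sumr; apply: (big_ind psum) => [|x y|b _]; first exact: psum0.
    exact: psumD.
  by rewrite mulrACA -exprMn tmonoD; apply/psumZ/psum_mono.
Qed.

Lemma psum_gen i : psum (u i).
Proof.
have -> : u i = tmono u (fun l => (l == i)%N); last exact: psum_mono.
rewrite /tmono (bigD1 i) //= eqxx expr1 big1 ?mulr1 // => l /negbTE ->; exact: expr0.
Qed.

End PSpanRing.

Lemma foldl_adjoinP (L : comNzRingType) (zs : seq L) (F : set L) : subring F ->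
  [/\ subring (foldl (@adjoin L) F zs), F `<=` foldl (@adjoin L) F zs &
   forall z, z \in zs -> foldl (@adjoin L) F zs z].
Proof.
elim: zs F => [|z zs IH] F rF /=; first by split.
have [rG sub mem] := IH _ (adjoin_subring z rF); split=> // [x xF|x].
  by apply: sub; exact: adjoin_sub.
rewrite in_cons => /orP[/eqP ->|]; last exact: mem.
by apply: sub; exact: adjoin_mem.
Qed.

Section Universal.
Variables (k : fieldType) (p : nat) (perf : perfect_of_char k p) (X : projVariety k).
Variables (n : nat) (d : X -> 'rV[X]_n) (ud : universal_derivation d).

Lemma pchar_funField : p \in [pchar X].
Proof. by rewrite (fmorph_pchar (constants X)); case: perf. Qed.

Let charp := pchar_funField.

Lemma univ_dD a b : d (a + b) = d a + d b. Proof. by have [[h _ _] _] := ud. Qed.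
Lemma univ_dM a b : d (a * b) = a *: d b + b *: d a. Proof. by have [[_ h _] _] := ud. Qed.

Let mx (s : seq X) := \matrix_(i < size s) d s`_i.

(** If the differentials d a spanned a proper subspace, the projection onto its cokernel and the
    zero map would both induce the zero derivation, against uniqueness in the universal property. *)
Lemma ex_wedge_neq0 : exists t, wedge d t != 0.
Proof.
have grow s : (\rank (mx s) < n)%N -> exists s', (\rank (mx s) < \rank (mx s'))%N.
  move=> rs; have [[a da]|all] := pselect (exists a, ~~ (d a <= mx s)%MS).
    exists (a :: s); apply: rank_ltmx; apply/andP; split.
      apply/row_subP => i; have -> : row i (mx s) = row (lift ord0 i) (mx (a :: s)).
        by rewrite !rowK.
      exact: row_sub.
    apply: contra da => /(submx_trans _); apply.
    have -> : d a = row (@ord0 (size s)) (mx (a :: s)) by rewrite rowK.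
    exact: row_sub.
  have zero : derivation (fun _ : X => 0 : 'rV[X]_n).
    by apply: And3 => [a b|a b|c] //; rewrite ?addr0 ?scaler0 ?addr0.
  have [h [_ hu]] := ud.2 _ _ zero.
  have c0 a : d a *m cokermx (mx s) = 0.
    by apply/eqP; rewrite -submxE; apply: contrapT => /negP ha; apply: all; exists a.
  have e1 := hu (mulmxr (cokermx (mx s))) (fun a => esym (c0 a)).
  have e2 := hu (mulmxr (0 : 'M_n)) (fun a => esym (mulmx0 _ (d a))).
  have : cokermx (mx s) == 0.
    apply/eqP/row_matrixP => i; rewrite !rowE.
    by have := e1 (delta_mx 0 i); rewrite -e2 /=.
  by rewrite cokermx_eq0 /row_full => /eqP e; rewrite e ltnn in rs.
have [s fs] : exists s, row_full (mx s).
  have main m : (m <= n)%N -> exists s, (m <= \rank (mx s))%N.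
    elim: m => [|m IH] mn; first by exists [::].
    have [s ms] := IH (ltnW mn); have [h|h] := ltnP m (\rank (mx s)); first by exists s.
    have e : \rank (mx s) = m by apply/eqP; rewrite eqn_leq h ms.
    have rs : (\rank (mx s) < n)%N by rewrite e.
    by have [s' hs'] := grow s rs; exists s'; rewrite -e.
  have [s hs] := main n (leqnn n); exists s.
  by rewrite /row_full eqn_leq rank_leq_col.
exists (fun i => s`_(fullrankfun fs i)).
rewrite (_ : wedge _ _ = \det (rowsub (fullrankfun fs) (mx s))).
  by rewrite -unitfE -unitmxE fullrowsub_unit.
by congr (\det _); apply/matrixP => i j; rewrite !mxE.
Qed.

(** The span of the monomials is a field that contains K^p, hence the constants, as k is perfect;
    finitely many ratios of coordinates generate K over it. If K = F[z] with z outside F, the formal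
    derivative in z is well defined by [deriv_kill], kills the t_i and maps z to 1; but a derivation
    that kills the t_i is zero, as the d (t i) form a basis. *)
Lemma pspan_wedge t : wedge d t != 0 -> pspan p t.
Proof.
move=> Wt; have p0 : (0 < p)%N by case/andP: charp => /prime_gt0.
suff main (zs : seq X) (F : set X) : subring F -> (forall x, F (x ^+ p)) -> (forall i, F (t i)) ->
    foldl (@adjoin X) F zs = setT -> F = setT.
  have [i xi0 frac] := hcoord_frac X; pose zs := [seq hcoord X j / hcoord X i | j <- enum 'I_(ambientDim X).+1].
  have rP := psum_subring charp t.
  have [rG GP Gz] := foldl_adjoinP zs rP; set G := foldl _ _ _ in rG GP Gz.
  have GT : G = setT.
    apply/seteqP; split=> // z _; have [a [b [aC bC b0 ->]]] := frac z.
    have sub : chart (constants X) (hcoord X) i `<=` G.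
      apply: smallest_sub; first exact/subring_closedP.
      move=> _ [[c _ <-]|[j _ <-]].
        have [_ perf'] := perf; have [b' ->] := perf' c; rewrite rmorphXn.
        by apply: GP; exact: psum_frob.
      by apply: Gz; apply/mapP; exists j; rewrite ?mem_enum.
    apply: (subringM rG); first exact: sub.
    apply: (subring_inv_frob charp rG) (sub _ bC) => x; apply: GP; exact: psum_frob.
  have e := main zs (psum p t) rP (psum_frob charp t) (psum_gen charp t) GT.
  by move=> z; have : psum p t z by rewrite e.
elim: zs F => [//|z zs IH] F rF Fp Ft /= h.
have rFz := adjoin_subring z rF.
have subz := @adjoin_sub _ F z rF.
have FzT : adjoin F z = setT.
  by apply: IH h => [//|x|i]; apply: subz.
have [zF|zF] := pselect (F z).
  rewrite -FzT; apply/seteqP; split=> // _ [q qF ->]; exact: subring_horner.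
have repr y : exists q : {poly X}, (forall i, F q`_i) /\ q.[z] = y.
  by have : adjoin F z y; [rewrite FzT|case=> q qF ->; exists q].
have [q qP] := choice repr.
pose D y := (q y)^`().[z].
have DE (P : {poly X}) y : (forall i, F P`_i) -> P.[z] = y -> D y = P^`().[z].
  move=> PF Py; have [qF qy] := qP y; apply/eqP; rewrite -subr_eq0 -hornerN -hornerD -derivN -derivD.
  apply/eqP; apply: (deriv_kill charp rF Fp zF) => [i|].
    by rewrite coefD coefN; apply: (subringB rF).
  by rewrite hornerD hornerN Py qy subrr.
have cF c : F (constants X c).
  by have [_ perf'] := perf; have [b ->] := perf' c; rewrite rmorphXn.
have Dconst y : F y -> D y = 0.
  move=> yF; rewrite (DE y%:P) ?hornerC // ?derivC ?horner0 // => i.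
  by rewrite coefC; case: ifP => // _; exact: subring0.
have derD : derivation (M := X^o) D.
  apply: And3 => [a b|a b|c]; last exact: Dconst.
    have [[aF aE] [bF bE]] := (qP a, qP b).
    rewrite (DE (q a + q b)) ?derivD ?hornerD ?aE ?bE // => i.
    by rewrite coefD; apply: (subringD rF).
  have [[aF aE] [bF bE]] := (qP a, qP b).
  rewrite (DE (q a * q b)) ?hornerM ?aE ?bE //; last first.
    by move=> i; rewrite coefM; apply: (subring_sum rF) => j _; exact: subringM.
  by rewrite derivM hornerD !hornerM aE bE addrC [D a * _]mulrC.
have [g [gE _]] := ud.2 _ _ derD.
have g0 v : g v = 0.
  pose U := \matrix_(i < n) d (t i).
  have Uu : U \in unitmx by rewrite unitmxE unitfE.
  rewrite -(mulmxKV Uu v) mulmx_sum_row linear_sum big1 // => i _.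
  by rewrite linearZ /= rowK -gE Dconst // scaler0.
have : D z = 1.
  rewrite (DE 'X) ?hornerX ?derivX ?hornerC // => i.
  by rewrite coefX; exact: subring_nat.
by rewrite gE g0 => /esym/eqP; rewrite oner_eq0.
Qed.
End Universal.

Section Tau.
Variables (K : fieldType) (p n : nat) (charp : p \in [pchar K]).
Variable d : K -> 'rV[K]_n.
Hypothesis dD : forall a b, d (a + b) = d a + d b.
Hypothesis dM : forall a b, d (a * b) = a *: d b + b *: d a.
Variables (t0 : 'I_n -> K) (w : K).
Hypotheses (W0 : wedge d t0 != 0) (sp0 : pspan p t0) (w0 : w != 0).
Implicit Types z : K.

Let p0 : (0 < p)%N. Proof. by case/andP: charp => /prime_gt0. Qed.

Let g0 : K := w / wedge d t0.
Let g0n : g0 != 0. Proof. by rewrite mulf_neq0 // invr_eq0. Qed.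

Let F := Phi p d t0.
Let FD : {morph F : a b / a + b}. Proof. exact: (PhiD charp dD dM W0 sp0). Qed.
Let FZ a z : F (a ^+ p * z) = a * F z. Proof. exact: (PhiZ charp dD dM W0 sp0). Qed.

Definition tau z : K := Phi p d t0 (g0 * z) / g0.

Lemma iter_tauE e z : iter e tau z = iter e F (g0 * z) / g0.
Proof.
elim: e => [|e IH]; first by rewrite /= mulrAC divff ?mul1r.
by rewrite !iterS IH /tau [g0 * _]mulrC divfK.
Qed.

Lemma iter_tauD e : {morph iter e tau : a b / a + b}.
Proof.
elim: e => // e IH a b; rewrite !iterS IH; set x := iter _ _ a; set y := iter _ _ b.
by rewrite /tau mulrDr -/F FD mulrDl.
Qed.

Lemma iter_tauZ e (a z : K) : iter e tau (a ^+ (p ^ e) * z) = a * iter e tau z.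
Proof.
rewrite !iter_tauE mulrCA; have -> : forall z, iter e F (a ^+ (p ^ e) * z) = a * iter e F z.
  exact: (iter_PhiZ charp dD dM W0 sp0).
by rewrite mulrA.
Qed.

(** Induction on e: the map y |-> sig (y^p u^a) is semilinear of the previous level, and the
    resulting multipliers are assembled with the dual monomials u^(p-1-a). *)
Lemma linear_iter_Phi e (sig : K -> K) : (forall a b : K, sig (a + b) = sig a + sig b) ->
  (forall a z : K, sig (a ^+ (p ^ e) * z) = a * sig z) ->
  exists h, forall z, sig z = iter e F (h * z).
Proof.
elim: e sig => [|e IH] sig sD sZ.
  by exists (sig 1) => z; rewrite /= -[z in LHS]mulr1 -[X in X * _]expr1 sZ mulrC.
pose M (a : {ffun 'I_n -> 'I_p}) := tmono t0 (fun i => a i).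
have /choice[l lE] : forall a, exists h, forall y, sig (y ^+ p * M a) = iter e F (h * y).
  move=> a; apply: (IH (fun y => sig (y ^+ p * M a))) => [x y|x y].
    by rewrite (frobD charp) mulrDl sD.
  by rewrite exprMn -exprM -expnSr -mulrA sZ.
have iD : {morph iter e F : a b / a + b}.
  by elim: (e) => // e' IH' a b; rewrite !iterS IH' FD.
have i0 : iter e F 0 = 0 by have := iD 0 0; rewrite addr0 -{1}[iter _ _ 0]addr0 => /addrI/esym.
have F0 : F 0 = 0 by have := FD 0 0; rewrite addr0 -{1}[F 0]addr0 => /addrI/esym.
exists (\sum_(a : {ffun 'I_n -> 'I_p}) l a ^+ p * tmono t0 (fun i => p.-1 - a i)%N) => z.
have s0 : sig 0 = 0 by have := sD 0 0; rewrite addr0 -{1}[sig 0]addr0 => /addrI/esym.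
rewrite {1}(Phi_expand charp dD dM W0 sp0 z) (big_morph sig sD s0) iterSr mulr_suml.
rewrite (big_morph F FD F0) (big_morph _ iD i0).
by apply: eq_bigr => a _; rewrite lE -mulrA FZ [_ * z]mulrC.
Qed.

Lemma linear_iter_tau e (sig : K -> K) : (forall a b : K, sig (a + b) = sig a + sig b) ->
  (forall a z : K, sig (a ^+ (p ^ e) * z) = a * sig z) ->
  exists h, forall z, sig z = iter e tau (h * z).
Proof.
move=> sD sZ; have [h hE] := linear_iter_Phi sD sZ.
exists (g0 ^+ (p ^ e) * (h / g0)) => z; rewrite -mulrA iter_tauZ iter_tauE hE.
have -> : g0 * (h / g0 * z) = h * z by field; exact: g0n.
by rewrite mulrCA divff ?mulr1.
Qed.

Section Local.
Variables (E : set K) (u : 'I_n -> K) (g : K).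
Hypotheses (dE : dvr E) (rE : subring E) (nE : int_closed E).
Hypotheses (Wu : wedge d u != 0) (spu : pspan p u) (wE : w = g * wedge d u).
Hypothesis uE : forall i, E (u i).
Hypothesis duE : forall a, E a -> exists2 c : 'I_n -> K,
  forall i, E (c i) & d a = \sum_(i < n) c i *: d (u i).

Let gn : g != 0. Proof. by apply: contraNneq w0 => g0'; rewrite wE g0' mul0r. Qed.

(** By [Phi_change], tau can be computed in the local coordinates at any divisor. *)
Lemma tau_local z : tau z = Phi p d u (g * z) / g.
Proof.
have := Phi_change charp dD dM (g * z) W0 sp0 spu.
set R := wedge d u / wedge d t0 => e.
have Rn : R != 0 by rewrite mulf_neq0 // invr_eq0.
have g0E : g0 = g * R by rewrite /g0 wE /R mulrA.
rewrite /tau g0E (_ : g * R * z = g * z * R); last by ring.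
by rewrite e; field; rewrite gn Rn.
Qed.

Lemma iter_tau_local e z : iter e tau z = iter e (Phi p d u) (g * z) / g.
Proof.
elim: e => [|e IH]; first by rewrite /= mulrAC divff ?mul1r.
by rewrite !iterS IH tau_local [g * _]mulrC divfK.
Qed.

(* Duality: the trace map tau^e makes O_E(K + qN) dual to O_E(-qN). *)
Lemma tau_dual e N z : vge E (- vord E g - N *+ (p ^ e)) z <->
  forall a, E a -> vge E (- vord E g - N) (iter e tau (a * z)).
Proof.
have [c c0 vc] := exists_vord dE N.
have cn m : c ^+ m != 0 by rewrite expf_neq0.
have conv m y b : b != 0 -> vord E b = m -> vge E (- vord E g - m) y <-> E (y * g * b).
  move=> b0 vb; rewrite (mem_vge dE).
  by rewrite -(vge_shift dE (- vord E g - m) y gn) -(vge_shift dE _ _ b0) vb; split; apply: etrans; congr (vge E _ _); lia.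
rewrite (conv _ _ (c ^+ (p ^ e))) ?vordX ?vc //.
rewrite (iter_Phi_dual charp dD dM rE nE Wu spu uE duE e).
have h a : iter e (Phi p d u) (a * (z * g * c ^+ (p ^ e))) = iter e tau (a * z) * g * c.
  rewrite (_ : a * _ = c ^+ (p ^ e) * (g * (a * z))); last by ring.
  by rewrite (iter_PhiZ charp dD dM Wu spu) iter_tau_local divfK // mulrC.
by split=> H a aE; [rewrite (conv _ _ c) // -h|rewrite h -(conv N)//]; exact: H.
Qed.
End Local.
End Tau.

(** * Traces and ramification *)

Section FrobeniusTrace.
Variables (K : fieldType) (p : nat) (charp : p \in [pchar K]).

Lemma coef_frob (q : {poly K}) i : (q ^+ p)`_(i * p) = q`_i ^+ p.
Proof.
have p0 : (0 < p)%N by case/andP: charp => /prime_gt0.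
have cp : p \in [pchar {poly K}] by rewrite pchar_poly.
elim/poly_ind: q i => [|q c IH] i.
  by rewrite !expr0n eqn0Ngt p0 /= !coef0 (frob0 charp).
rewrite -[_ ^+ p in LHS]/(pFrobenius_aut cp _) rmorphD rmorphM /= !pFrobenius_autE -rmorphXn /=.
rewrite coefD coefC coefMXn muln_eq0 orbC eqn0Ngt p0 /=.
case: i => [|i]; first by rewrite mul0n p0 add0r coefD coefMX coefC eqxx add0r.
rewrite addr0 coefD coefMX coefC /= addr0 -IH mulSn ifF ?addKn //.
by apply/negbTE; rewrite -leqNgt leq_addr.
Qed.

(* Compare the determinants of (X - A)^p and of X^p - A^p. *)
Lemma char_poly_frob m (A : 'M[K]_m.+1) i : (char_poly (A ^+ p))`_i = (char_poly A)`_i ^+ p.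
Proof.
have p0 : (0 < p)%N by case/andP: charp => /prime_gt0.
have cM : p \in [pchar 'M[{poly K}]_m.+1].
  rewrite inE; case/andP: charp => -> /= /eqP h.
  by rewrite -(rmorph_nat (@scalar_mx _ m.+1)) -(rmorph_nat polyC) h !raddf0.
have detX (L : comNzRingType) (B : 'M[L]_m.+1) l : \det (B ^+ l) = \det B ^+ l.
  by elim: l => [|l IH]; rewrite ?det1 // !exprS det_mulmx IH.
have mapX l : map_mx polyC (A ^+ l) = map_mx polyC A ^+ l.
  by elim: l => [|l IH]; rewrite ?map_mx1 // !exprS map_mxM IH.
have scX l : ('X : {poly K})%:M ^+ l = ('X^l)%:M :> 'M_m.+1.
  by rewrite -(rmorphXn (@scalar_mx _ m.+1)).
have e : char_poly A ^+ p = char_poly (A ^+ p) \Po 'X^p.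
  rewrite /char_poly -detX -[_ \Po _]/(comp_poly 'X^p _) -det_map_mx; congr (\det _).
  rewrite /char_poly_mx -[_ ^+ p in LHS]/(pFrobenius_aut cM _) pFrobenius_autB_comm; last first.
    exact: comm_scalar_mx.
  rewrite !pFrobenius_autE scX -mapX map_mxB map_scalar_mx /= comp_polyX; congr (_ - _).
  by apply/matrixP => r c; rewrite !mxE comp_polyC.
have h := congr1 (fun q : {poly K} => q`_(i * p)) e.
by move: h; rewrite coef_frob coef_comp_poly_Xn // dvdn_mull // mulnK // => <-.
Qed.

Lemma char_poly_frobX m (A : 'M[K]_m.+1) i s :
  (char_poly (A ^+ (p ^ s)))`_i = (char_poly A)`_i ^+ (p ^ s).
Proof. by elim: s => // s IH; rewrite expnSr !exprM char_poly_frob IH. Qed.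

Lemma mxtrace_frob m (A : 'M[K]_m.+1) : \tr (A ^+ p) = \tr A ^+ p.
Proof.
have ct (N : 'M[K]_m.+1) : (char_poly N)`_m = - \tr N by exact: (@char_poly_trace _ m.+1).
have := char_poly_frob A m; rewrite !ct.
by rewrite -[RHS]/(pFrobenius_aut charp _) pFrobenius_autN pFrobenius_autE => /oppr_inj.
Qed.

(** The i-th coefficient is homogeneous of degree m + 1 - i; the form without division also covers a
    = 0. *)
Lemma char_poly_scale m (a : K) (A : 'M[K]_m.+1) i :
  (char_poly (a *: A))`_i * a ^+ i = a ^+ m.+1 * (char_poly A)`_i.
Proof.
have e : char_poly (a *: A) \Po (a *: 'X) = a ^+ m.+1 *: char_poly A.
  have aX : (a ^+ m.+1)%:P = a%:P ^+ m.+1 by exact: rmorphXn.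
  rewrite -[RHS]mul_polyC aX -detZ /char_poly -[_ \Po _]/(comp_poly (a *: 'X) _) -det_map_mx.
  congr (\det _); apply/matrixP => r s.
  rewrite /char_poly_mx !mxE rmorphB rmorphMn /= comp_polyX comp_polyC mulrBr -mul_polyC mulrnAr.
  by rewrite polyCM.
have := congr1 (fun q : {poly K} => q`_i) e; rewrite coefZ => <-.
move: (char_poly (a *: A)) => P; rewrite comp_polyE coef_sum.
have aXX l : (a *: 'X : {poly K}) ^+ l = a ^+ l *: 'X^l.
  elim: l => [|l IH]; first by rewrite !expr0 scale1r.
  by rewrite !exprS IH -scalerAl -scalerAr scalerA.
under eq_bigr do rewrite aXX scalerA coefZ coefXn.
have [hi|hi] := ltnP i (size P).
  rewrite (bigD1 (Ordinal hi)) //= eqxx mulr1 big1 ?addr0 // => l li.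
  by rewrite (_ : (i == l) = false) ?mulr0 //; apply: contra_neqF li => /eqP il; apply/val_inj.
rewrite nth_default // mul0r big1 // => l _.
by rewrite (_ : (i == l) = false) ?mulr0 //; apply/negbTE; rewrite gtn_eqF // (leq_trans (ltn_ord l)).
Qed.
End FrobeniusTrace.

Section SemilinearTrace.
Variables (K : fieldType) (p : nat) (charp : p \in [pchar K]).
Variables (phi : {rmorphism K -> K}) (deg : nat) (b : 'I_deg -> K).
Hypothesis hb : forall y, exists c : 'I_deg -> K, y = \sum_(i < deg) phi (c i) * b i /\
  forall c' : 'I_deg -> K, y = \sum_(i < deg) phi (c' i) * b i -> forall i, c' i = c i.

Lemma coord_inj (c c' : 'I_deg -> K) :
  \sum_(i < deg) phi (c i) * b i = \sum_(i < deg) phi (c' i) * b i -> forall i, c i = c' i.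
Proof.
move=> e i; have [c0 [_ cu]] := hb (\sum_(i < deg) phi (c i) * b i).
by rewrite (cu c erefl i) (cu c' e i).
Qed.

(** The regular representation of K over phi(K), with entries read in K through phi. The size is a
    successor so that the matrices form a ring. *)
Lemma exists_rep : exists m (M : K -> 'M[K]_m.+1), deg = m.+1 /\
  [/\ forall x y, M (x + y) = M x + M y, forall a y, M (phi a * y) = a *: M y,
      M 1 = 1, forall x y, M (x * y) = M x * M y & forall y, M y = 0 -> y = 0].
Proof.
have /choice[co coE] : forall y, exists c : 'I_deg -> K, y = \sum_(i < deg) phi (c i) * b i.
  by move=> y; have [c [e _]] := hb y; exists c.
have [M ME] : exists M : K -> 'M_deg, forall y i j, M y i j = co (y * b i) j.
  by exists (fun y => \matrix_(i, j) co (y * b i) j) => y i j; rewrite mxE.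
have Mb y i : y * b i = \sum_j phi (M y i j) * b j.
  by rewrite {1}(coE (y * b i)); apply: eq_bigr => j _; rewrite ME.
have Muniq y (N : 'M_deg) : (forall i, y * b i = \sum_j phi (N i j) * b j) -> M y = N.
  move=> h; apply/matrixP => i; apply: coord_inj; by rewrite -Mb -h.
have MD x y : M (x + y) = M x + M y.
  apply: Muniq => i; rewrite mulrDl !Mb -big_split /=.
  by apply: eq_bigr => j _; rewrite mxE rmorphD mulrDl.
have Mphi a y : M (phi a * y) = a *: M y.
  apply: Muniq => i; rewrite -mulrA Mb mulr_sumr.
  by apply: eq_bigr => j _; rewrite mxE rmorphM mulrA.
have M1 : M 1 = 1%:M.
  apply: Muniq => i; rewrite mul1r (bigD1 i) //= big1 ?addr0 ?mxE ?eqxx ?rmorph1 ?mul1r // => j ji.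
  by rewrite mxE eq_sym (negbTE ji) rmorph0 mul0r.
have MM x y : M (x * y) = M y *m M x.
  apply: Muniq => i; rewrite -mulrA Mb mulr_sumr.
  transitivity (\sum_j \sum_l phi (M y i j * M x j l) * b l).
    by apply: eq_bigr => j _; rewrite mulrCA Mb mulr_sumr; apply: eq_bigr => l _; rewrite rmorphM mulrA.
  by rewrite exchange_big /=; apply: eq_bigr => l _; rewrite mxE rmorph_sum mulr_suml.
have M0 y : M y = 0 -> y = 0.
  move=> h; have yb i : y * b i = 0.
    by rewrite Mb big1 // => j _; rewrite h mxE rmorph0 mul0r.
  have [c cE] : exists c : 'I_deg -> K, 1 = \sum_i phi (c i) * b i by exists (co 1).
  by rewrite -[y]mulr1 cE mulr_sumr big1 // => i _; rewrite mulrCA yb mulr0.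
have [m dm] : exists m, deg = m.+1.
  have d0 : (0 < deg)%N.
    rewrite lt0n; apply/eqP => d0; have [c [e _]] := hb 1.
    have /eqP := e; rewrite big1 ?oner_eq0 // => i _.
    by have := ltn_ord i; rewrite [X in (_ < X)%N]d0.
  by exists deg.-1; rewrite prednK.
move: M MD Mphi M1 MM M0 {ME Mb Muniq}; rewrite dm => M MD Mphi M1 MM M0.
exists m, M; split=> //; split=> // x y; by rewrite mulrC MM.
Qed.

(** The trace of the regular representation divided by the degree. Its compatibility with Frobenius,
    from [mxtrace_frob], is what stands for separability below. *)
Lemma exists_trace : coprime deg p -> exists t : K -> K,
  [/\ forall x y, t (x + y) = t x + t y, forall a y, t (phi a * y) = a * t y,
      t 1 = 1 & forall y, t (y ^+ p) = t y ^+ p].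
Proof.
move=> cop; have pp : prime p by case/andP: charp.
have [m [M [dm [MD Mphi M1 MM _]]]] := exists_rep.
have dn : m.+1%:R != 0 :> K.
  by rewrite -(dvdn_pcharf charp) -dm -prime_coprime // coprime_sym.
exists (fun y => \tr (M y) / m.+1%:R); split=> [x y|a y||y].
- by rewrite MD mxtraceD mulrDl.
- by rewrite Mphi mxtraceZ mulrA.
- by rewrite M1 mxtrace1 divff.
have MX l : M (y ^+ l) = M y ^+ l.
  by elim: l => [|l IH]; rewrite ?M1 // !exprS MM IH.
by rewrite expr_div_n (frob_nat charp) MX (mxtrace_frob charp).
Qed.
End SemilinearTrace.

Section Ramification.
Variables (K : fieldType) (p n : nat) (charp : p \in [pchar K]).
Variable d : K -> 'rV[K]_n.
Hypothesis dD : forall a b, d (a + b) = d a + d b.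
Hypothesis dM : forall a b, d (a * b) = a *: d b + b *: d a.
Variables (t0 : 'I_n -> K) (w : K).
Hypotheses (W0 : wedge d t0 != 0) (sp0 : pspan p t0) (w0 : w != 0).
Variable phi : {rmorphism K -> K}.

(** Both sides are derivations in a along phi that vanish on p-th powers, and they agree on the
    p-basis u. *)
Lemma d_morph u a : wedge d u != 0 -> pspan p u ->
  d (phi a) = \sum_i phi (partial d u i a) *: d (phi (u i)).
Proof.
move=> Wu spu; pose Q a := d (phi a) = \sum_i phi (partial d u i a) *: d (phi (u i)).
have QD x y : Q x -> Q y -> Q (x + y).
  rewrite /Q rmorphD dD => -> ->; rewrite -big_split; apply: eq_bigr => i _.
  by rewrite (partialD dD) rmorphD scalerDl.
have QM x y : Q x -> Q y -> Q (x * y).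
  rewrite /Q rmorphM dM => -> ->; rewrite !scaler_sumr -big_split; apply: eq_bigr => i _.
  by rewrite (partialM dM) rmorphD !rmorphM scalerDl !scalerA.
have Q0 x : d x = 0 -> d (phi x) = 0 -> Q x.
  by move=> h e; rewrite /Q e big1 // => i _; rewrite (partial_const _ _ h) rmorph0 scale0r.
have Q1 : Q 1 by apply: Q0; rewrite ?rmorph1 (d1 dM).
have Qu i : Q (u i).
  rewrite /Q (bigD1 i) //= big1 ?addr0 => [|j ji].
    by rewrite (partial_u Wu) eqxx rmorph1 scale1r.
  by rewrite (partial_u Wu) (negbTE ji) rmorph0 scale0r.
have [c ->] := spu a; apply: (big_ind Q) => [||e _]; [|exact: QD|].
  by apply: Q0; rewrite ?rmorph0 (d0 dD).
apply: (QM); first by apply: Q0; rewrite ?rmorphXn (dp charp dM).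
apply: (big_ind Q) => [||i _]; [by []|exact: QM|]; elim: (val (e i)) => // m IH.
by rewrite exprS; apply: QM.
Qed.

Lemma wedge_partial u s : wedge d u != 0 ->
  wedge d s = \det (\matrix_(i, j) partial d u j (s i)) * wedge d u.
Proof.
move=> Wu; rewrite /wedge -det_mulmx; congr (\det _); apply/row_matrixP => i.
rewrite rowK (d_partial Wu) row_mul mulmx_sum_row; apply: eq_bigr => j _.
by rewrite !mxE rowK.
Qed.

Lemma wedge_morph u s : wedge d u != 0 -> pspan p u ->
  wedge d (phi \o s) = phi (wedge d s / wedge d u) * wedge d (phi \o u).
Proof.
move=> Wu spu; rewrite (wedge_partial s Wu) mulfK // -det_map_mx /wedge -det_mulmx.
congr (\det _); apply/row_matrixP => i.
rewrite rowK /= (d_morph _ Wu spu) row_mul mulmx_sum_row; apply: eq_bigr => j _.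
by rewrite !mxE rowK.
Qed.

Lemma wedge_in E u s : subring E -> wedge d u != 0 ->
  (forall a, E a -> exists2 c : 'I_n -> K,
    forall i, E (c i) & d a = \sum_(i < n) c i *: d (u i)) ->
  (forall i, E (s i)) -> E (wedge d s / wedge d u).
Proof.
move=> rE Wu duE sE; rewrite (wedge_partial s Wu) mulfK //; apply: det_subring => // i j.
by rewrite mxE; apply: (partial_in (E := E) Wu duE).
Qed.

Variable t : K -> K.
Hypotheses (tD : forall x y, t (x + y) = t x + t y) (tphi : forall a y, t (phi a * y) = a * t y)
  (t1 : t 1 = 1) (tp : forall y, t (y ^+ p) = t y ^+ p).

Let v := phi \o t0.
Let p0 : (0 < p)%N. Proof. by case/andP: charp => /prime_gt0. Qed.
Let B : finType := {ffun 'I_n -> 'I_p}.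
Let mono (u : 'I_n -> K) (a : B) := tmono u (fun i => a i).

Let t0E : t 0 = 0. Proof. by have := tD 0 0; rewrite addr0 -{1}[t 0]addr0 => /addrI/esym. Qed.

Let mono_v a : mono v a = phi (mono t0 a).
Proof. by rewrite /mono /tmono rmorph_prod; apply: eq_bigr => i _; rewrite rmorphXn. Qed.

Lemma pbasis_indep (c : B -> K) : \sum_a c a ^+ p * mono t0 a = 0 -> forall a, c a = 0.
Proof.
move=> h a; have := Phi0 charp dD dM W0 sp0; rewrite -(mul0r (tmono t0 (fun i => p.-1 - a i)%N)) -h.
rewrite mulr_suml (Phi_sum charp dD dM W0 sp0) (bigD1 a) //= big1 ?addr0 => [|e ea];
  rewrite -mulrA /mono tmonoD (PhiZ charp dD dM W0 sp0) (Phi_mono charp dD dM W0 sp0).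
  have lt i : (a i + (p.-1 - a i) = p.-1)%N by rewrite subnKC // -ltnS prednK.
  have pm : (p.-1 < p)%N by rewrite prednK.
  case: ifP => [_|/negbT/forallPn[i]]; last by rewrite lt modn_small ?eqxx.
  by rewrite [tmono _ _]big1 ?mulr1 // => i _; rewrite lt divn_small.
case: ifP => [/forallP hh|_]; last by rewrite mulr0.
case/eqP: ea; apply/ffunP => i; apply/val_inj => /=.
exact/esym/(pred_mod_inj (ltn_ord _) (ltn_ord _) (eqP (hh i))).
Qed.

(** Normalizing one coefficient to 1 and applying t turns a relation among the monomials in the phi
    (t0 i) into one among those in the t0 i, since t is linear along phi and commutes with
    Frobenius; t 1 = 1 keeps it nontrivial. *)
Lemma morph_indep (c : B -> K) : \sum_a c a ^+ p * mono v a = 0 -> forall a, c a = 0.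
Proof.
move=> h a; apply/eqP; apply: contraT => ca.
have e : \sum_e t (c e / c a) ^+ p * mono t0 e = 0.
  transitivity (t ((c a)^-1 ^+ p * \sum_e c e ^+ p * mono v e)); last by rewrite h mulr0.
  rewrite mulr_sumr (big_morph t tD t0E); apply: eq_bigr => e _.
  by rewrite mulrA -exprMn mono_v [_ * phi _]mulrC tphi tp mulrC [_^-1 * _]mulrC.
by have := pbasis_indep e a; rewrite divff // t1 => /eqP; rewrite oner_eq0.
Qed.

(** A count of dimensions over K^p: there are as many independent monomials in v as monomials in t0.
    M consists of the p-th roots of the transition coefficients, so that its invertibility can be
    tested over K. *)
Lemma morph_pspan : pspan p v.
Proof.
have /choice[m mE] : forall a, exists c : B -> K, mono v a = \sum_e c e ^+ p * mono t0 e.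
  by move=> a; exact: sp0.
pose M : 'M[K]_#|B| := \matrix_(i, j) m (enum_val i) (enum_val j).
have Mu : M \in unitmx.
  rewrite -row_free_unit; apply: inj_row_free => x xM.
  have h : \sum_a x 0 (enum_rank a) ^+ p * mono v a = 0.
    under eq_bigr do rewrite mE mulr_sumr.
    rewrite exchange_big big1 //= => e _.
    have := congr1 (fun N : 'rV_#|B| => N 0 (enum_rank e)) xM; rewrite !mxE => xe.
    under eq_bigr do rewrite mulrA -exprMn.
    rewrite -mulr_suml -(frob_sum charp) (_ : \sum_a _ = 0) ?(frob0 charp) ?mul0r //.
    rewrite -[RHS]xe [RHS](reindex _ (onW_bij _ (@enum_rank_bij B))) /=.
    by apply: eq_bigr => a _; rewrite mxE !enum_rankK.
  by apply/rowP => i; rewrite mxE -(enum_valK i) (morph_indep h).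
move=> z; have [c zE] := sp0 z.
have IM e e' : \sum_a invmx M (enum_rank e) (enum_rank a) * m a e' = (e == e')%:R.
  have := congr1 (fun N : 'M_#|B| => N (enum_rank e) (enum_rank e')) (mulVmx Mu).
  rewrite !mxE (inj_eq enum_rank_inj) => <-.
  rewrite [RHS](reindex _ (onW_bij _ (@enum_rank_bij B))) /=.
  by apply: eq_bigr => a _; rewrite [M _ _]mxE !enum_rankK.
have mono_t0 e : mono t0 e = \sum_a invmx M (enum_rank e) (enum_rank a) ^+ p * mono v a.
  have -> : mono t0 e = \sum_e' (e == e')%:R ^+ p * mono t0 e'.
    rewrite (bigD1 e) //= eqxx expr1n mul1r big1 ?addr0 // => e' /negbTE h.
    by rewrite eq_sym h (frob0 charp) mul0r.
  under eq_bigr do rewrite -IM (frob_sum charp) mulr_suml.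
  rewrite exchange_big; apply: eq_bigr => a _; rewrite mE mulr_sumr.
  by apply: eq_bigr => e' _; rewrite exprMn mulrA.
exists (fun a => \sum_e c e * invmx M (enum_rank e) (enum_rank a)).
rewrite {1}zE; under eq_bigr do rewrite -/(mono t0 _) mono_t0 mulr_sumr.
rewrite exchange_big; apply: eq_bigr => a _; rewrite (frob_sum charp) mulr_suml.
by apply: eq_bigr => e _; rewrite exprMn mulrA.
Qed.

Lemma morph_wedge : wedge d v != 0.
Proof.
have spv := morph_pspan; apply: contraNneq W0 => Wv0.
have h x : (d x <= \matrix_(i < n) d (v i))%MS.
  have [c ->] := spv x; rewrite (d_sum dD); apply: summx_sub => a _.
  rewrite (dpM charp dM); apply: scalemx_sub; rewrite /tmono.
  elim: (index_enum _) => [|i r IH]; first by rewrite big_nil (d1 dM) sub0mx.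
  rewrite big_cons dM; apply: addmx_sub; apply: scalemx_sub => //.
  rewrite (dX dM); apply: scalemx_sub.
  have -> : d (v i) = row i (\matrix_(i < n) d (v i)) by rewrite rowK.
  exact: row_sub.
have /submxP[C CE] : (\matrix_(i < n) d (t0 i) <= \matrix_(i < n) d (v i))%MS.
  by apply/row_subP => i; rewrite rowK.
by rewrite /wedge CE det_mulmx -/(wedge d v) Wv0 mulr0.
Qed.

(* phi^* of the form of divisor K is ramif times that form. *)
Definition ramif := phi (w / wedge d t0) * wedge d v / w.

Lemma ramif_neq0 : ramif != 0.
Proof.
by rewrite !mulf_neq0 ?invr_eq0 ?morph_wedge // fmorph_eq0 mulf_neq0 // invr_eq0.
Qed.

(** t exchanges the Cartier operators in the coordinates v and t0, as is seen on the products c^p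
    phi(u^a); by [Phi_change], passing from v to t0 costs the factor [ramif]. *)
Lemma tau_trace y : tau p d t0 w (t y) = t (ramif^-1 * tau p d t0 w (ramif * y)).
Proof.
have Wv := morph_wedge; have spv := morph_pspan.
have Pt z : Phi p d t0 (t z) = t (Phi p d v z).
  have [c ->] := spv z.
  rewrite (big_morph t tD t0E) !(Phi_sum charp dD dM) // (big_morph t tD t0E).
  apply: eq_bigr => a _; rewrite -/(mono v a) mono_v [_ * phi _]mulrC tphi tp.
  rewrite [mono t0 a * _]mulrC -mono_v [mono v a * _]mulrC /mono (Phi_mono0 charp dD dM W0 sp0) // (Phi_mono0 charp dD dM Wv spv) //.
  by case: ifP => // _; rewrite t0E.
pose g0 := w / wedge d t0; have g0n : g0 != 0 by rewrite mulf_neq0 // invr_eq0.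
have pg : phi g0 != 0 by rewrite fmorph_eq0.
have pW : phi (wedge d t0) != 0 by rewrite fmorph_eq0.
have pw : phi w != 0 by rewrite fmorph_eq0.
have L : tau p d t0 w (t y) = t (Phi p d v (phi g0 * y) / phi g0).
  rewrite /tau -/g0 -tphi Pt -[RHS]mul1r -(mulVf g0n) -mulrA -tphi.
  by rewrite [_ / phi g0]mulrC mulVKf // mulrC.
rewrite L; congr (t _).
have e := Phi_change charp dD dM (phi g0 * y) W0 sp0 spv.
rewrite /tau -/g0.
have -> : g0 * (ramif * y) = phi g0 * y * (wedge d v / wedge d t0).
  rewrite /ramif -/g0 /g0; by field; rewrite ?w0 ?W0 ?pW.
rewrite e /ramif -/g0; set P := Phi _ _ _ _.
by rewrite /g0; field; rewrite ?w0 ?W0 ?Wv ?pW ?pw.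
Qed.

Section LocalRamification.
Variables (E E1 : set K) (u u1 : 'I_n -> K) (g g1 : K).
Hypotheses (dE : dvr E) (rE : subring E) (phiE : forall a, E1 a -> E (phi a)).
Hypotheses (Wu : wedge d u != 0) (wE : w = g * wedge d u).
Hypotheses (Wu1 : wedge d u1 != 0) (spu1 : pspan p u1) (w1E : w = g1 * wedge d u1).
Hypothesis duE : forall a, E a -> exists2 c : 'I_n -> K,
  forall i, E (c i) & d a = \sum_(i < n) c i *: d (u i).
Hypothesis u1E : forall i, E1 (u1 i).

(** The pull-back of the regular form du1 is regular at E, so its coefficient on du lies in E. *)
Lemma ramif_ge : vge E (- vord E g + vord E (phi g1)) ramif.
Proof.
have gn : g != 0 by apply: contraNneq w0 => e; rewrite wE e mul0r.
have -> : ramif = wedge d (phi \o u1) / wedge d u * phi g1 / g.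
  rewrite /ramif /v (wedge_morph t0 Wu1 spu1) mulrA -rmorphM /=.
  have -> : w / wedge d t0 * (wedge d t0 / wedge d u1) = g1.
    by rewrite w1E; field; rewrite W0 Wu1.
  have -> : w^-1 = (wedge d u)^-1 / g by rewrite wE invfM mulrC.
  by ring.
have g1n : g1 != 0 by apply: contraNneq w0 => e; rewrite w1E e mul0r.
rewrite -mulrA mulrC [- _ + _]addrC -[_ + _]addr0; apply: (vgeM dE).
  by rewrite vge_eq ?mulf_neq0 ?invr_eq0 ?fmorph_eq0 // vordM ?vordV ?invr_eq0 ?fmorph_eq0.
apply/(mem_vge dE); apply: wedge_in => // i; exact: phiE.
Qed.
End LocalRamification.
End Ramification.

(** * Serre vanishing *)

Section Cohomology.
Variables (K : fieldType) (R0 : set K) (J : finType) (x : J -> K).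
Hypothesis cd : chart_data R0 x.
Let rR0 : subring R0. Proof. exact: cd_subring cd. Qed.
Let nR0 : noeth R0. Proof. exact: cd_noeth cd. Qed.
Let x_neq0 : forall j, x j != 0. Proof. exact: cd_neq0 cd. Qed.
Let A := chartR x R0.
Let rA i : subring (A i). Proof. exact: chartR_subring. Qed.
Let nA i : noeth (A i). Proof. exact: chartR_noeth. Qed.
Let pt := chart_points R0 x.
Hypothesis normal : forall O, pt O -> int_closed O.
Hypothesis hartogs : forall O z, pt O -> (forall E, pdiv R0 x E -> O `<=` E -> E z) -> O z.
Notation pdiv := (pdiv R0 x).
Notation fsupp := (fsupp R0 x).
Notation sec := (sec R0 x).
Notation B := (Bdiv x).
Let dvrE E : pdiv E -> dvr E. Proof. exact: (pdiv_dvr cd normal). Qed.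
Implicit Types (G N C D : set K -> int) (I : {set J}) (E O : set K) (u z : K).

Definition global G z := forall E, pdiv E -> vge E (- G E) z.

(** Extends a section from the point P to Spec S: the bad divisors are finite in number and none
    passes through P, so [avoid_finite] applies. *)
Lemma clear_at (S P : set K) G u : subring S -> prime_ideal S P -> fsupp G ->
  (forall E, pdiv E -> localization S P `<=` E -> vge E (- G E) u) ->
  exists c, [/\ S c, ~ P c & forall E, pdiv E -> S `<=` E -> vge E (- G E) (c * u)].
Proof.
move=> rS pP fG Hu; have [u0|u0] := eqVneq u 0.
  exists 1; split=> [||E _ _]; [exact: subring1|by case: pP|by rewrite u0 mulr0 vge0].
pose F := [set E | [/\ pdiv E, S `<=` E & ~ vge E (- G E) u]].
have Fbad : F `<=` [set E | pdiv E /\ (G E != 0 \/ vord E u != 0)].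
  move=> E [pE _ nu]; split=> //; have [G0|] := eqVneq (G E) 0; last by left.
  by right; apply/eqP => v0; apply: nu; rewrite vge_eq // G0 v0.
have fF := sub_finite_set Fbad (finite_bad cd normal fG u0).
have [n nP] := finite_bound (fun E => `|G E|%N + `|vord E u|%N)%N fF.
have [|c [Sc Pc cP]] := @avoid_finite K S P F n rS pP fF.
  by move=> E [pE SE nu]; split=> //; [exact: dvrE|move=> h; apply: nu; exact: Hu].
exists c; split=> // E pE SE; have dE := dvrE pE.
have [h|h] := boolP (vge E (- G E) u).
  by rewrite -[- _]add0r; apply: (vgeM dE) => //; apply/(mem_vge dE); exact: SE.
have FE : F E by split=> //; apply/negP.
apply: (@vge_le _ _ _ (n%:Z + vord E u)); first by have := nP E FE; lia.
by apply: (vgeM dE); [exact: cP|exact: vge_vord].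
Qed.

Lemma xB j E : pdiv E -> - B E <= vord E (x j).
Proof. by move=> pE; have [h _] := BdivP cd normal pE. Qed.

Lemma vge_x j E : pdiv E -> vge E (- B E) (x j).
Proof. by move=> pE; rewrite vge_eq // xB. Qed.

Definition gen_at N t s O :=
  [/\ s != 0, global (fun E => N E *+ t) s &
      forall E, pdiv E -> O `<=` E -> vord E s = - (N E *+ t)].

(* N is semiample. *)
Definition sa N := forall O, pt O -> exists t s, (0 < t)%N /\ gen_at N t s O.

Lemma fsuppMn N t : fsupp N -> fsupp (fun E => N E *+ t).
Proof.
move=> fN; apply: sub_finite_set fN => E [pE h]; split=> //.
by apply: contraNneq h => ->; rewrite mul0rn.
Qed.

Lemma gen_atX N t s O m : gen_at N t s O -> gen_at N (t * m) (s ^+ m) O.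
Proof.
move=> [s0 gs vs]; split=> [|E pE|E pE OE]; first exact: expf_neq0.
  by rewrite mulrnA -mulNrn; apply: (vgeX (dvrE pE)); exact: gs.
by rewrite (vordX (dvrE pE)) // vs // mulrnA mulNrn.
Qed.

Lemma gen_open N t s O : fsupp N -> pt O -> gen_at N t s O -> exists W,
  [/\ zopen R0 x W, W O & forall O', W O' -> gen_at N t s O'].
Proof.
move=> fN ptO [s0 gs vs].
pose F := [set E | pdiv E /\ vord E s != - (N E *+ t)].
have fF : finite_set F.
  apply: (sub_finite_set _ (finite_bad cd normal (fsuppMn t fN) s0)) => E [pE h]; split=> //.
  have [N0|] := eqVneq (N E *+ t) 0; last by left.
  by right; move: h; rewrite N0 oppr0.
exists [set O' | pt O' /\ forall E, F E -> ~ O' `<=` E]; split.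
- by apply: zopen_avoid => //; exact: zopen_pt.
- by split=> // E [pE /eqP h] OE; apply: h; exact: vs.
move=> O' [_ h]; split=> // E pE O'E; apply/eqP; apply: contraT => ne.
by case: (h E).
Qed.

(** Quasi-compactness makes the family of generating sections finite, and powers bring them to a
    common exponent t. *)
Lemma sa_common N : fsupp N -> sa N -> exists t (ys : seq K), [/\ (0 < t)%N,
  forall y, y \in ys -> y != 0 /\ global (fun E => N E *+ t) y &
  forall O, pt O -> exists2 y, y \in ys & gen_at N t y O].
Proof.
move=> fN saN.
have /choice[f fP] : forall O, exists ts : nat * K, pt O -> (0 < ts.1)%N /\ gen_at N ts.1 ts.2 O.
  move=> O; have [/saN[t [s h]]|h] := pselect (pt O); first by exists (t, s).
  by exists (0%N, 0).
have /choice[W WP] : forall O, exists W, pt O -> [/\ zopen R0 x W, W O &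
    forall O', W O' -> gen_at N (f O).1 (f O).2 O'].
  move=> O; have [ptO|h] := pselect (pt O); last by exists set0.
  by have [W h] := gen_open fN ptO (fP O ptO).2; exists W.
have [|F [fF Fpt Fcov]] := @quasi_compact _ _ _ _ cd W.
  by move=> O ptO; have [] := WP O ptO.
have [t t0 tP] := finite_common_multiple (g := fun O => (f O).1) fF (fun O FO => (fP O (Fpt O FO)).1).
have := finite_image (fun O => (f O).2 ^+ (t %/ (f O).1)%N) fF.
case/finite_seqP => ys ysE; exists t, ys.
have mem y : y \in ys <-> exists2 O, F O & (f O).2 ^+ (t %/ (f O).1)%N = y.
  by have -> : (y \in ys) = ([set` ys] y) :> Prop by []; rewrite -ysE.
have gen O O' : F O -> W O O' -> gen_at N t ((f O).2 ^+ (t %/ (f O).1)%N) O'.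
  move=> FO WO; have [_ _ h] := WP O (Fpt O FO).
  by have := gen_atX (t %/ (f O).1)%N (h O' WO); rewrite mulnC divnK // tP.
split=> // [y /mem[O FO <-]|O ptO].
  have [_ WOO _] := WP O (Fpt O FO).
  by have [] := gen O O FO WOO.
have [O' FO' WO] := Fcov O ptO; exists ((f O').2 ^+ (t %/ (f O').1)%N); last exact: gen.
by apply/mem; exists O'.
Qed.

Section Serre.
Variables (C N0 : set K -> int).
Hypotheses (fC : fsupp C) (fN : fsupp N0) (saN : sa N0).

Let Dv a b E : int := C E + N0 E *+ a + B E *+ b.
Let fB : fsupp B. Proof. exact: (fsupp_Bdiv cd normal). Qed.
Let fDv a b : fsupp (Dv a b).
Proof.
apply: (fsupp_ext _ (fsupp_comb 1 1 (fsupp_comb 1 1 fC (fsuppMn a fN)) (fsuppMn b fB))).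
by move=> E _; rewrite /Dv !mul1r.
Qed.
Definition charts_in I := [set E | forall i, i \in I -> A i `<=` E].

Let xB_eq i E : pdiv E -> A i `<=` E -> vord E (x i) = - B E.
Proof. by move=> pE; move/(Bdiv_chart cd normal i pE). Qed.

Section Module.
Variables (t : nat) (ys : seq K) (gens : seq (K * nat * nat)).
Hypothesis t0 : (0 < t)%N.
Hypothesis ysP : forall y, y \in ys -> y != 0 /\ global (fun E => N0 E *+ t) y.
Hypothesis ys_gen : forall O, pt O -> exists2 y, y \in ys & gen_at N0 t y O.
Hypothesis gensP : forall g a b, (g, a, b) \in gens -> global (Dv a b) g.
Hypothesis gens_span : forall i a z, (a < t)%N -> sec [set E | A i `<=` E] (fun E => C E + N0 E *+ a) z ->
  @Span K K^o (A i) [set g | exists b, (x i ^+ b * g, a, b) \in gens] z.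

Notation bimod := (bimod x R0 ys t gens).

Lemma bimod_global a b u : bimod a b u -> global (Dv a b) u.
Proof.
elim=> {a b u} [a b|a b u v _ IHu _ IHv|a b c u Rc _ IH|g a b /gensP //|a b i u _ IH|a b y u yP _ IH] E pE;
  have dE := dvrE pE; rewrite ?vge0 //.
- by apply: (vgeD dE); [exact: IHu|exact: IHv].
- rewrite -[- _]add0r; apply: (vgeM dE); last exact: IH.
  by apply/(mem_vge dE); exact: (pt_const cd pE.1).
- have -> : - Dv a b.+1 E = - B E + - Dv a b E by rewrite /Dv mulrSr; lia.
  by apply: (vgeM dE); [exact: vge_x|exact: IH].
have -> : - Dv (a + t) b E = - (N0 E *+ t) + - Dv a b E by rewrite /Dv mulrnDr; lia.
by apply: (vgeM dE); [have [_] := ysP yP; exact|exact: IH].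
Qed.

Lemma bimod_X a b i T u : bimod a b u -> bimod a (b + T) (x i ^+ T * u).
Proof.
move=> Mu; elim: T => [|T IH]; first by rewrite addn0 mul1r.
by rewrite addnS exprS -mulrA; apply: BMx.
Qed.

Lemma bimod_prod a b (r : seq J) (T : J -> nat) u : bimod a b u ->
  bimod a (b + \sum_(i <- r) T i) ((\prod_(i <- r) x i ^+ T i) * u).
Proof.
move=> Mu; elim: r => [|i r IH]; first by rewrite !big_nil addn0 mul1r.
by rewrite !big_cons addnCA addnC addnC -mulrA [(T i + _)%N]addnC; apply: bimod_X.
Qed.

Lemma bimod_form a b d F u : forms x R0 d F -> bimod a b u -> bimod a (b + d) (F * u).
Proof.
move=> SF Mu; elim: SF => [|c _ F' Rc [m <- ->] _ IH]; first by rewrite mul0r; apply: BM0.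
rewrite mulrDl; apply: BMD => //; rewrite -[c *: _]/(c * _) -mulrA; apply: BMZ => //.
exact: bimod_prod.
Qed.

Definition reach i a u := exists T, bimod a T (x i ^+ T * u).

Lemma reach_up i a u : reach i a u -> exists T0, forall T, (T0 <= T)%N -> bimod a T (x i ^+ T * u).
Proof.
move=> [T0 h]; exists T0 => T TT; rewrite -(subnK TT) exprD -mulrA addnC; exact: bimod_X.
Qed.

Lemma reachD i a u v : reach i a u -> reach i a v -> reach i a (u + v).
Proof.
move=> /reach_up[T hT] /reach_up[S hS]; exists (maxn T S); rewrite mulrDr.
by apply: BMD; [apply: hT|apply: hS]; rewrite leq_max leqnn ?orbT.
Qed.

Lemma reachA i a c u : A i c -> reach i a u -> reach i a (c * u).
Proof.
move=> [d Fc] [T h]; exists (T + d)%N.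
have -> : x i ^+ (T + d) * (c * u) = (c * x i ^+ d) * (x i ^+ T * u) by rewrite exprD; ring.
exact: bimod_form.
Qed.

(** Induction on a. For a < t, [gens] was chosen for this purpose. Otherwise, near a given point, u
    = y (u / y) for some y that generates O(t N0), and c (u / y) is a section for a - t with c
    nonzero at that point; such c generate the unit ideal. *)
Lemma sec_reach i a u : sec [set E | A i `<=` E] (fun E => C E + N0 E *+ a) u -> reach i a u.
Proof.
have [m] := ubnP a; elim: m a u => // m IH a u am Hu.
have [ta|ta] := ltnP a t.
  elim: (gens_span ta Hu) => [|c g z Ac [b gP] _ hz]; first by exists 0%N; rewrite mulr0; exact: BM0.
  apply: reachD => //; apply: reachA => //; exists b; exact: BMg.
pose Q : set K := [set c | A i c /\ reach i a (c * u)].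
have iQ : ideal (A i) Q.
  split; first by move=> c [].
  split; first by split; [exact: subring0|exists 0%N; rewrite mul0r mulr0; exact: BM0].
  move=> c v w Ac [Av rv] [Aw rw]; split; first by apply: (subringD (rA i)) => //; exact: subringM.
  by rewrite mulrDl; apply: reachD => //; rewrite -[c *: v]/(c * v) -mulrA; exact: reachA.
suff [_] : Q 1 by rewrite mul1r.
apply: (unit_ideal (rA i) (@nA i) iQ) => P pP.
have ptO : pt (localization (A i) P) by exists i, P.
have [y yP [y0 gy vy]] := ys_gen ptO.
have fG : fsupp (fun E => C E + N0 E *+ (a - t)).
  apply: (fsupp_ext _ (fsupp_comb 1 1 fC (fsuppMn (a - t) fN))).
  by move=> E _; rewrite !mul1r.
have [|c [Ac Pc cP]] := @clear_at (A i) P _ (u / y) (rA i) pP fG.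
  move=> E pE OE; have dE := dvrE pE.
  have AE : A i `<=` E by apply: subset_trans OE; exact: loc_sub.
  have := vge_shift dE (- (C E + N0 E *+ (a - t))) (u / y) y0; rewrite divfK // => <-.
  rewrite vy //; have := Hu E AE pE; congr (is_true (vge E _ u)).
  by rewrite -{1}(subnK ta) mulrnDr; lia.
exists c => //; split=> //.
have r : reach i (a - t) (c * (u / y)).
  by apply: IH => [|E AE pE]; [lia|exact: cP].
have [T h] := r; exists T; rewrite -(subnK ta).
have -> : x i ^+ T * (c * u) = y * (x i ^+ T * (c * (u / y))) by field.
exact: BMy.
Qed.

(** The product y of the x_l, l in I, generates exactly over the intersection of the charts in I, so
    y^T1 u is global by [clear_poles]. Then [sec_reach] on a single chart i puts x_i^T2 y^T1 u into
    the module, and [h3] writes larger powers of y as forms times x_i^T2 y^T1. *)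
Lemma sec_twisted I a b u : I != finset.set0 -> sec (charts_in I) (Dv a b) u ->
  exists T0, forall T, (T0 <= T)%N -> bimod a (b + \sum_(i in I) T)%N (xpow x (fun=> T) I * u).
Proof.
case/finset.set0Pn => i iI Hu.
pose y := xpow x (fun=> 1%N) I; have y0 : y != 0 by exact: xpow_neq0.
have vy E : pdiv E -> vord E y + B E *+ #|I| = \sum_(l in I) (vord E (x l) + B E).
  move=> pE; rewrite big_split /= sumr_const; congr (_ + _).
  have : y != 0 /\ vord E y = \sum_(l in I) vord E (x l); last by case.
  rewrite /y /xpow; elim: (index_enum _) => [|l r [IH0 IH]].
    by rewrite !big_nil oner_neq0 (vord1 (dvrE pE)).
  rewrite !big_cons; case: ifP => // lI; rewrite mulf_neq0 ?expf_neq0 //.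
  by rewrite (vordM (dvrE pE)) ?expf_neq0 // IH expr1.
have xB0 E l : pdiv E -> 0 <= vord E (x l) + B E.
  by move=> pE; have := xB l pE; lia.
have [||T1 T1P] := @clear_poles _ _ _ _ cd normal (Dv a b) (fun E => B E *+ #|I|) y u (fDv a b) y0.
- by move=> E pE; have : 0 <= \sum_(l in I) (vord E (x l) + B E);
    [apply: sumr_ge0 => l _; exact: xB0|rewrite -vy //; lia].
- move=> E pE vyE; apply: Hu => // l lI; apply/(Bdiv_chart cd normal l pE).
  have h : \sum_(l in I) (vord E (x l) + B E) = 0 by rewrite -vy // vyE addNr.
  by have := psumr_eq0P (fun l _ => xB0 E l pE) h lI; lia.
have yX T : y ^+ T = xpow x (fun=> T) I.
  by rewrite /y /xpow -prodrXl; apply: eq_bigr => l _; rewrite expr1.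
pose d := (b + #|I| * T1)%N.
have [|T2 h2] := @sec_reach i a (y ^+ T1 * u / x i ^+ d).
  move=> E AE pE; have dE := dvrE pE; have xd : x i ^+ d != 0 by rewrite expf_neq0.
  rewrite -(vge_shift dE _ _ xd) divfK // vordX // (xB_eq pE AE).
  have := T1P T1 (leqnn _) E pE; congr (is_true (vge E _ _)).
  by rewrite /Dv /d mulNrn mulrnDr -mulrnA; lia.
have {}h2 : bimod a (d + T2) (x i ^+ T2 * (y ^+ T1 * u)).
  rewrite (_ : _ * _ = x i ^+ d * (x i ^+ T2 * (y ^+ T1 * u / x i ^+ d))).
    by rewrite addnC; exact: bimod_X.
  by field; rewrite ?expf_neq0.
have h3 T : (T1 + T2 <= T)%N -> exists F, forms x R0 (#|I| * (T - T1) - T2) F /\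
    y ^+ T = F * (x i ^+ T2 * y ^+ T1).
  move=> TT; have TT1 : (T1 <= T)%N by exact: leq_trans (leq_addr _ _) TT.
  have TT2 : (T2 <= T - T1)%N by rewrite leq_subRL.
  pose S l := if l == i then (T - T1 - T2)%N else (T - T1)%N.
  exists (\prod_(l in I) x l ^+ S l); split.
    have -> : (#|I| * (T - T1) - T2 = \sum_(l in I) S l)%N.
      rewrite (bigD1 i) //= {1}/S eqxx (eq_bigr (fun=> (T - T1)%N)); last first.
        by move=> l /andP[_ /negbTE li]; rewrite /S li.
      rewrite (cardD1 i) iI sum_nat_const /= (eq_card (B := [predD1 I & i])); last first.
        by move=> l; rewrite !inE andbC.
      by rewrite mulSn [RHS]addnBAC.
    elim: (index_enum _) => [|l r IH]; first by rewrite !big_nil; apply: forms0 => //; exact: subring1.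
    by rewrite !big_cons; case: ifP => // _; apply: formsM => //; exact: formsX.
  rewrite -[T in LHS](subnK TT1) exprD mulrA; congr (_ * _).
  rewrite yX /xpow (bigD1 i) //= [in RHS](bigD1 i) //= /S eqxx.
  rewrite (eq_bigr (fun l => x l ^+ (T - T1))); last by [].
  have -> : x i ^+ (T - T1) = x i ^+ (T - T1 - T2) * x i ^+ T2.
    by rewrite -exprD subnK.
  rewrite mulrAC; congr (_ * _ * _); apply: eq_bigr => l /andP[_ /negbTE li].
  by rewrite li.
exists (T1 + T2)%N => T TT; have [F [FF yT]] := h3 T TT.
rewrite -yX yT.
have -> : F * (x i ^+ T2 * y ^+ T1) * u = F * (x i ^+ T2 * (y ^+ T1 * u)) by ring.
rewrite (_ : (b + \sum_(i in I) T)%N = (d + T2 + (#|I| * (T - T1) - T2))%N).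
  exact: bimod_form.
have I0 : (0 < #|I|)%N by apply/card_gt0P; exists i.
have TT1 : (T1 <= T)%N by exact: leq_trans (leq_addr _ _) TT.
have TT2 : (T2 <= #|I| * (T - T1))%N by apply: leq_trans (leq_pmull _ I0); rewrite leq_subRL.
rewrite sum_nat_const -{1}(subnKC TT1) mulnDr /d -!addnA; congr (_ + (_ + _))%N.
by rewrite subnKC.
Qed.
End Module.

Lemma exists_gens : exists t (ys : seq K) (gens : seq (K * nat * nat)), [/\ (0 < t)%N,
  forall y, y \in ys -> y != 0 /\ global (fun E => N0 E *+ t) y,
  forall O, pt O -> exists2 y, y \in ys & gen_at N0 t y O,
  forall g a b, (g, a, b) \in gens -> global (Dv a b) g &
  forall i a z, (a < t)%N -> sec [set E | A i `<=` E] (fun E => C E + N0 E *+ a) z ->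
  @Span K K^o (A i) [set g | exists b, (x i ^+ b * g, a, b) \in gens] z].
Proof.
have [t [ys [t0 ysP ys_gen]]] := sa_common fN saN; exists t, ys.
have fG a : fsupp (fun E => C E + N0 E *+ a).
  by apply: (fsupp_ext _ (fsupp_comb 1 1 fC (fsuppMn a fN))) => E _; rewrite !mul1r.
have /choice[s sP] : forall ir : J * 'I_t, exists s : seq K, forall z,
    sec [set E | A ir.1 `<=` E] (fun E => C E + N0 E *+ ir.2) z <->
    @Span K K^o (A ir.1) [set` s] z.
  by move=> [i r]; exact: sec_chart_fg.
have /choice[T TP] : forall irg : (J * 'I_t) * K, exists T, irg.2 \in s irg.1 ->
    global (Dv irg.1.2 T) (x irg.1.1 ^+ T * irg.2).
  move=> [[i r] g] /=; have [gs|gs] := boolP (g \in s (i, r)); last by exists 0%N.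
  have Hg : sec [set E | A i `<=` E] (fun E => C E + N0 E *+ r) g.
    by apply/(sP (i, r)); apply: Span_id => //; exact: rA.
  have [||T0 T0P] := @clear_poles _ _ _ _ cd normal _ B (x i) g (fG r) (x_neq0 i).
  - by move=> E pE; exact: xB.
  - by move=> E pE /(Bdiv_chart cd normal i pE) AE; exact: Hg.
  by exists T0 => _; exact: T0P.
exists (flatten [seq [seq (x ir.1 ^+ T (ir, g) * g, nat_of_ord ir.2, T (ir, g)) | g <- s ir]
  | ir <- enum {: J * 'I_t}]); split=> //.
  move=> g a b /flatten_mapP[ir _ /mapP[g' g's [-> -> ->]]]; exact: (TP (ir, g')).
move=> i a z ta Hz; have /(sP (i, Ordinal ta)) h := Hz.
apply: Span_sub h => //= g gs.
apply: Span_id; first exact: rA.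
exists (T (i, Ordinal ta, g)); apply/flatten_mapP; exists (i, Ordinal ta); rewrite ?mem_enum //.
by apply/mapP; exists g.
Qed.

(** Over nonempty sets of charts, [sec_twisted] and [bimod_global] identify sections with elements
    of the bigraded module divided by powers of the x_i. On the empty set z vanishes, s being
    positive. The primitive is cut down to degree s - 1 at the end. *)
Theorem serre_vanishing : exists b0, forall a b s (z : {set J} -> K), (b0 <= b)%N -> (1 < s)%N ->
  (forall I, sec (charts_in I) (Dv a b) (z I)) -> (forall I, z I != 0 -> #|I| = s) ->
  (forall I, koszul (fun=> 1) z I = 0) ->
  exists y : {set J} -> K, [/\ forall I, sec (charts_in I) (Dv a b) (y I),
    forall I, y I != 0 -> #|I| = s.-1 & forall I, koszul (fun=> 1) y I = z I].
Proof.
have [t [ys [gens [t0 ysP ys_gen gensP gens_span]]]] := exists_gens.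
have [b0 van] := graded_cech_vanishing x_neq0 rR0 nR0 ys t gens.
exists b0 => a b s z bb s1 Hz zs dz.
have /choice[Tz TzP] : forall I, exists T0, forall T, (T0 <= T)%N ->
    bimod x R0 ys t gens a (b + \sum_(i in I) T)%N (xpow x (fun=> T) I * z I).
  move=> I; have [I0|In] := eqVneq I finset.set0; last first.
    exact: (sec_twisted t0 ys_gen gens_span).
  exists 0%N => T _; have -> : z I = 0; last by rewrite mulr0; exact: BM0.
  apply/eqP; apply: contraT => /zs; rewrite I0 cards0 => e; by rewrite -e in s1.
have [|y0 [T Ty] dy] := van a b z bb _ dz.
  by exists (\max_I Tz I) => I; apply: TzP; apply: leq_bigmax.
pose y (I : {set J}) := if #|I| == s.-1 then y0 I else 0.
exists y; split=> [I E AE pE|I|I].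
- rewrite /y; case: ifP => _; last by rewrite vge0.
  have dE := dvrE pE; have := bimod_global t0 ysP gensP (Ty I) pE.
  have xn : xpow x (fun=> T) I != 0 by exact: xpow_neq0.
  rewrite mulrC => h; rewrite -(vge_shift dE _ _ xn); apply: vge_le h.
  have : xpow x (fun=> T) I != 0 /\ vord E (xpow x (fun=> T) I) = - (B E *+ \sum_(i in I) T).
    rewrite /xpow; have sub : forall i, i \in I -> vord E (x i) = - B E by move=> i iI; exact: xB_eq (AE i iI).
    elim: (index_enum _) => [|l r [IH0 IH]]; first by rewrite !big_nil oner_neq0 (vord1 dE).
    rewrite !big_cons; case: ifP => // lI; rewrite mulf_neq0 ?expf_neq0 //.
    by rewrite (vordM dE) ?expf_neq0 // IH vordX // sub // mulNrn mulrnDr opprD.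
  by move=> [_ ->]; rewrite /Dv mulrnDr; lia.
- by rewrite /y; case: ifP => [/eqP|]; rewrite ?eqxx.
have [Is|Is] := eqVneq #|I| s.
  rewrite -dy; apply: eq_bigr => i iI; congr (_ * _).
  by rewrite /y; have := cardsD1 i I; rewrite iI Is => ->; rewrite eqxx.
transitivity (0 : K); last by apply/esym/eqP; apply: contraNT Is => /zs ->.
apply: big1 => i iI; rewrite /y ifF ?mulr0 //; apply: contra_neqF Is => /eqP.
by have := cardsD1 i I; rewrite iI; lia.
Qed.
End Serre.
End Cohomology.

(** * Lifting sections along the trace of Frobenius *)

Section Duality.
Variables (K : fieldType) (R0 : set K) (J : finType) (x : J -> K).
Hypothesis cd : chart_data R0 x.
Let x_neq0 : forall j, x j != 0. Proof. exact: cd_neq0 cd. Qed.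
Let A := chartR x R0.
Let pt := chart_points R0 x.
Hypothesis normal : forall O, pt O -> int_closed O.
Hypothesis hartogs : forall O z, pt O -> (forall E, pdiv R0 x E -> O `<=` E -> E z) -> O z.
Notation pdiv := (pdiv R0 x).
Notation fsupp := (fsupp R0 x).
Notation sec := (sec R0 x).
Notation global := (global R0 x).
Notation sa := (sa R0 x).
Notation B := (Bdiv x).
Let dvrE E : pdiv E -> dvr E. Proof. exact: (pdiv_dvr cd normal). Qed.
Let fB : fsupp B. Proof. exact: (fsupp_Bdiv cd normal). Qed.
Implicit Types (G N C D L : set K -> int) (I : {set J}) (E O : set K) (u z : K).

Lemma sa_ext N N' : (forall E, pdiv E -> N E = N' E) -> sa N -> sa N'.
Proof.
move=> e saN O ptO; have [t [s [t0 [s0 gs vs]]]] := saN O ptO.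
exists t, s; split=> //; split=> // E pE; rewrite -e //; [exact: gs|exact: vs].
Qed.

Lemma saD N N' : sa N -> sa N' -> sa (fun E => N E + N' E).
Proof.
move=> saN saN' O ptO; have [t [s [t0 h]]] := saN O ptO.
have [t' [s' [t0' h']]] := saN' O ptO.
have [s0 gs vs] := gen_atX cd normal t' h; have [s0' gs' vs'] := gen_atX cd normal t h'.
exists (t * t')%N, (s ^+ t' * s' ^+ t); split; first by rewrite muln_gt0 t0.
split=> [|E pE|E pE OE]; first by rewrite mulf_neq0.
  rewrite mulrnDl opprD; apply: (vgeM (dvrE pE)); first exact: gs.
  by rewrite mulnC; exact: gs'.
by rewrite (vordM (dvrE pE)) // vs // vs' // mulrnDl opprD [(t' * t)%N]mulnC.
Qed.

Lemma saMn N k : sa N -> sa (fun E => N E *+ k).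
Proof.
move=> saN O ptO; have [t [s [t0 h]]] := saN O ptO.
have [s0 gs vs] := gen_atX cd normal k h.
by exists t, (s ^+ k); split=> //; split=> // E pE; rewrite -mulrnA mulnC; [exact: gs|exact: vs].
Qed.

Lemma sa_div N k : (0 < k)%N -> sa (fun E => N E *+ k) -> sa N.
Proof.
move=> k0 saN O ptO; have [t [s [t0 [s0 gs vs]]]] := saN O ptO.
exists (k * t)%N, s; split; first by rewrite muln_gt0 k0.
by split=> // E pE; rewrite mulrnA; [exact: gs|exact: vs].
Qed.

Lemma sa_B : sa B.
Proof.
move=> O ptO; have [i AO] := pt_chart cd ptO; exists 1%N, (x i); split=> //.
split=> // [E pE|E pE OE]; first exact: (vge_x cd normal).
by apply/(Bdiv_chart cd normal i pE); exact: subset_trans OE.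
Qed.

Lemma sa_BMn N k : sa N -> sa (fun E => N E + B E *+ k).
Proof. by move=> saN; apply: saD => //; apply: saMn; exact: sa_B. Qed.

Variables (p : nat) (charp : p \in [pchar K]) (tau : K -> K) (C : set K -> int).
Hypothesis tauD : forall e, {morph iter e tau : a b / a + b}.
Hypothesis tauZ : forall e a z, iter e tau (a ^+ (p ^ e) * z) = a * iter e tau z.
Hypothesis tau_dual : forall E e (m : int) z, pdiv E ->
  vge E (- C E - m *+ (p ^ e)) z <-> forall a, E a -> vge E (- C E - m) (iter e tau (a * z)).
Hypothesis fC : fsupp C.

Let pp : prime p. Proof. by case/andP: charp. Qed.
Let p0 : (0 < p)%N. Proof. exact: prime_gt0 pp. Qed.

Lemma tau_ge E e m z : pdiv E -> vge E (- (C E + m *+ (p ^ e))) z ->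
  vge E (- (C E + m)) (iter e tau z).
Proof.
move=> pE; rewrite !opprD => /(tau_dual e m z pE)/(_ 1).
by rewrite mul1r; apply; exact: subring1 (pt_subring cd pE.1).
Qed.

Lemma tau_iter_sum e (S : Type) (r : seq S) (P : pred S) (F : S -> K) :
  iter e tau (\sum_(i <- r | P i) F i) = \sum_(i <- r | P i) iter e tau (F i).
Proof.
apply: (big_morph _ (tauD e)).
by have := tauD e 0 0; rewrite addr0 -{1}[iter e tau 0]addr0 => /addrI/esym.
Qed.

Lemma frobXD e (a b : K) : (a + b) ^+ (p ^ e) = a ^+ (p ^ e) + b ^+ (p ^ e).
Proof. by elim: e => // e IH; rewrite expnSr !exprM IH (frobD charp). Qed.

Lemma sgnX e i I : sgn K i I ^+ (p ^ e) = sgn K i I.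
Proof.
have h : (-1) ^+ (p ^ e) = -1 :> K.
  apply/eqP; rewrite -addr_eq0 -{2}(expr1n K (p ^ e)) -frobXD addNr expr0n.
  by rewrite expn_eq0 eqn0Ngt p0.
by rewrite /sgn -exprM mulnC exprM h.
Qed.

Definition splits_at e D i g := sec [set E | A i `<=` E] (fun E => C E - C E *+ (p ^ e) - D E) g /\
  iter e tau g = 1.

Lemma splitting_poles e D (g : J -> K) : fsupp D -> (forall i, splits_at e D i (g i)) ->
  exists T0, forall T i, (T0 <= T)%N ->
    global (fun E => C E - C E *+ (p ^ e) - D E + B E *+ T) (x i ^+ T * g i).
Proof.
move=> fD Hg.
have fG : fsupp (fun E => C E - C E *+ (p ^ e) - D E).
  apply: (fsupp_ext _ (fsupp_comb 1 (-1) (fsupp_comb 1 (-1) fC (fsuppMn (p ^ e) fC)) fD)).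
  by move=> E _; rewrite !mul1r !mulN1r.
have /choice[T TP] : forall i, exists T0, forall T, (T0 <= T)%N -> forall E, pdiv E ->
    vge E (- (C E - C E *+ (p ^ e) - D E + B E *+ T)) (x i ^+ T * g i).
  move=> i; apply: (clear_poles cd normal fG (x_neq0 i)) => E pE; first exact: (xB cd normal).
  by move=> /(Bdiv_chart cd normal i pE) AE; exact: (Hg i).1.
exists (\max_i T i) => S i TS E pE; apply: TP => //.
by apply: leq_trans TS; apply: leq_bigmax.
Qed.

Section Killing.
Variables (e1 : nat) (g : J -> K).
Hypotheses (e10 : (0 < e1)%N) (gP : forall i, splits_at e1 (fun=> 0) i (g i)).

Lemma killers : exists M1, forall M l i, (M1 <= M)%N -> exists H,
  global (fun E => C E - C E *+ (p ^ (e1 * l)) + B E *+ (M * p ^ (e1 * l))) H /\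
  iter (e1 * l) tau H = x i ^+ M.
Proof.
have [T TP] := splitting_poles (fsupp0 _ _) gP; exists T => M l i TM.
have {}TP := TP T i (leqnn _).
(* Composing l copies of the splitting g_i gives poles of order at most a = T (1 + r + ... +
   r^(l-1)) along B, with r = p^e1. The invariant a + T <= T r^l bounds them by M r^l with M
   independent of l. *)
have [h [a [aT hg h1]]] : exists h a, [/\ (a + T <= T * p ^ (e1 * l))%N,
   global (fun E => C E - C E *+ (p ^ (e1 * l)) + B E *+ a) (x i ^+ a * h) &
   iter (e1 * l) tau h = 1].
  elim: l => [|l [h [a [aT hg h1]]]].
    exists 1, 0%N; rewrite muln0 muln1; split=> // E pE.
    by rewrite mulr1 mulr1n subrr mulr0n oppr0; apply/(mem_vge (dvrE pE)); exact: subring1 (pt_subring cd pE.1).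
  exists (h ^+ (p ^ e1) * g i), (a * p ^ e1 + T)%N; split=> [|E pE|].
  - rewrite mulnS expnD; move: (p ^ (e1 * l))%N aT => q aT.
    have : (1 < p ^ e1)%N by rewrite -(expn0 p) ltn_exp2l // prime_gt1.
    by move: (p ^ e1)%N => r r1; nia.
  - have -> : x i ^+ (a * p ^ e1 + T) * (h ^+ (p ^ e1) * g i) =
        (x i ^+ a * h) ^+ (p ^ e1) * (x i ^+ T * g i) by rewrite exprD exprM exprMn; ring.
    have := vgeM (dvrE pE) (vgeX (dvrE pE) (p ^ e1) (hg E pE)) (TP E pE).
    apply: vge_le; rewrite mulnS expnD [(p ^ e1 * _)%N]mulnC mulrnDr.
    rewrite !(mulrnDl, mulrnBl, mulNrn, opprD, opprK) -!mulrnA; lia.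
  by rewrite mulnS addnC iterD tauZ (gP i).2 mulr1.
exists (x i ^+ (M * p ^ (e1 * l)) * h); split; last by rewrite exprM tauZ h1 mulr1.
have aM : (a <= M * p ^ (e1 * l))%N.
  by apply: leq_trans (leq_trans (leq_addr _ _) aT) _; rewrite leq_mul2r TM orbT.
move=> E pE; rewrite -(subnK aM) exprD -mulrA mulrnDr.
have := vgeM (dvrE pE) (vgeX (dvrE pE) (M * p ^ (e1 * l) - a) (vge_x cd normal i pE)) (hg E pE).
apply: vge_le; rewrite mulNrn; lia.
Qed.

(* x_i^M v = tau^e(H v^q) for a global section H, and Serre vanishing makes the
   cocycle H v^q a coboundary. *)
Lemma killing : exists M1, forall M N s i (v : {set J} -> K), (M1 <= M)%N -> (1 < s)%N ->
  fsupp N -> sa (fun E => N E - B E) ->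
  (forall I, sec (charts_in R0 x I) (fun E => C E + N E - B E *+ M) (v I)) ->
  (forall I, v I != 0 -> #|I| = s) -> (forall I, koszul (fun=> 1) v I = 0) ->
  exists y : {set J} -> K, [/\ forall I, sec (charts_in R0 x I) (fun E => C E + N E) (y I),
    forall I, y I != 0 -> #|I| = s.-1 &
    forall I, koszul (fun=> 1) y I = x i ^+ M * v I].
Proof.
have [M1 hM] := killers; exists M1 => M N s i v MM s1 fN saN Hv vs dv.
have fN0 : fsupp (fun E => N E - B E).
  apply: (fsupp_ext _ (fsupp_comb 1 (-1) fN fB)).
  by move=> E _; rewrite mul1r mulN1r.
have [b0 van] := serre_vanishing cd normal hartogs fC fN0 saN.
pose e := (e1 * b0)%N; pose q := (p ^ e)%N.
(* The Serre bound b0 depends on N, but it only decides how often Frobenius is iterated; M1 is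
   unaffected. *)
have bq : (b0 <= q)%N.
  apply: (leq_trans (leq_pmull b0 e10)); apply: ltnW; rewrite /q; apply: ltn_expl; exact: prime_gt1.
have [H [HH Ht]] := hM M b0 i MM; rewrite -/e -/q in HH Ht.
have q0 : (0 < q)%N by rewrite expn_gt0 p0.
have CN E : C E + (N E - B E) *+ q + B E *+ q = C E + N E *+ q.
  by rewrite mulrnBl addrA subrK.
have [I E AE pE|I|I|w [wG ws dw]] := van q q s (fun I => H * v I ^+ q) bq s1.
- rewrite CN; have := vgeM (dvrE pE) (HH E pE) (vgeX (dvrE pE) q (Hv I E AE pE)).
  apply: vge_le; rewrite !(mulrnDl, mulrnBl, mulNrn, opprD, opprK) -!mulrnA; lia.
- by move=> h; apply: vs; apply: contraNneq h => ->; rewrite expr0n eqn0Ngt q0 mulr0.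
- transitivity (H * koszul (fun=> 1) v I ^+ q); last by rewrite dv expr0n eqn0Ngt q0 mulr0.
  rewrite /koszul (big_morph (fun a : K => a ^+ q) (frobXD e) (_ : _ = 0)); last first.
    by rewrite expr0n eqn0Ngt q0.
  rewrite mulr_sumr; apply: eq_bigr => l _.
  by rewrite !exprMn expr1n sgnX; ring.
exists (fun I => iter e tau (w I)); split=> [I E AE pE|I|I].
- by apply: tau_ge => //; rewrite -CN; exact: wG.
- move=> h; apply: ws; apply: contraNneq h => ->.
  by have := tauD e 0 0; rewrite addr0 -{1}[iter e tau 0]addr0 => /addrI/esym ->.
transitivity (iter e tau (koszul (fun=> 1) w I)).
  rewrite /koszul tau_iter_sum; apply: eq_bigr => l _.
  by rewrite -[sgn K l I in RHS](sgnX e) !mulr1 tauZ.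
by rewrite dw mulrC tauZ Ht mulrC.
Qed.

Let n := #|J|.

(** This is [generation] for the elements x_i^M and the twists by -jMB. Here j runs up to 2n and
    [killing] takes one more B, which is covered by (2n + 1) M copies of B. *)
Lemma P_step : exists M1, forall M N z0, (M1 <= M)%N -> fsupp N ->
  sa (fun E => N E - B E *+ ((n.*2.+1) * M)) -> global (fun E => C E + N E) z0 ->
  exists y : J -> K, (forall i, global (fun E => C E + N E - B E *+ M) (y i)) /\
    z0 = \sum_i x i ^+ M * y i.
Proof.
have [M1 kill] := killing; exists (maxn M1 1) => M N z0; rewrite geq_max => /andP[MM M0] fN saN Hz0.
pose Gam j I := sec (charts_in R0 x I) (fun E => C E + N E - B E *+ (j * M)).
have fNj j : fsupp (fun E => N E - B E *+ (j * M)).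
  apply: (fsupp_ext _ (fsupp_comb 1 (-1) fN (fsuppMn (j * M) fB))).
  by move=> E _; rewrite mul1r mulN1r.
have [i0 _] := card_gt0P (card_charts cd).
have x'0 i : x i ^+ M != 0 by rewrite expf_neq0.
have Gam0 j I : Gam j I 0 by move=> E _ _; rewrite vge0.
have GamB j I a b : Gam j I a -> Gam j I b -> Gam j I (a - b).
  move=> Ha Hb E AE pE; apply: (vgeD (dvrE pE)); first exact: Ha.
  by rewrite (vgeN (dvrE pE)); exact: Hb.
have GamS j I I' a : I \subset I' -> Gam j I a -> Gam j I' a.
  by move=> /fintype.subsetP II Ha E AE pE; apply: Ha => // i iI; apply: AE; exact: II.
have GamX j I i a : Gam j.+1 I a -> Gam j I (x i ^+ M * a).
  move=> Ha E AE pE.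
  have := vgeM (dvrE pE) (vgeX (dvrE pE) M (vge_x cd normal i pE)) (Ha E AE pE).
  by apply: vge_le; rewrite mulSn mulrnDr mulNrn; lia.
have GamV j I i a : i \in I -> Gam j I a -> Gam j.+1 I (a / x i ^+ M).
  move=> iI Ha E AE pE; have dE := dvrE pE.
  rewrite -(vge_shift dE _ _ (x'0 i)) divfK // vordX //.
  have -> : vord E (x i) = - B E by apply/(Bdiv_chart cd normal i pE); exact: AE.
  by have := Ha E AE pE; apply: vge_le; rewrite mulSn mulrnDr mulNrn; lia.
have kil j s i v : (j <= n.*2)%N -> (1 < s)%N -> cochain Gam j.+1 s v ->
    (forall I, koszul (fun=> 1) v I = 0) ->
    exists2 y, cochain Gam j s.-1 y & forall I, koszul (fun=> 1) y I = x i ^+ M * v I.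
  move=> jn s1 [Gv vs] dv.
  have saj : sa (fun E => N E - B E *+ (j * M) - B E).
    apply: (sa_ext _ (sa_BMn ((n.*2.+1) * M - (j * M).+1) saN)) => E _.
    have jM : ((j * M).+1 <= n.*2.+1 * M)%N.
      by apply: leq_trans (_ : j.+1 * M <= _)%N; [rewrite mulSn -add1n leq_add2r|rewrite leq_mul2r ltnS jn orbT].
    by rewrite -{1}(subnKC jM) mulrnDr mulrSr; lia.
  have vG I : sec (charts_in R0 x I) (fun E => C E + (N E - B E *+ (j * M)) - B E *+ M) (v I).
    by move=> E AE pE; have := Gv I E AE pE; apply: vge_le; rewrite mulSn mulrnDr; lia.
  have [y [Gy ys dy]] := kill M _ s i v MM s1 (fNj j) saj vG vs dv.
  by exists y => //; split=> // I E AE pE; have := Gy I E AE pE; apply: vge_le; lia.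
have Gz0 (i : J) : Gam 0%N [set i]%SET z0.
  by move=> E AE pE; have := Hz0 E pE; rewrite mul0n mulr0n subr0.
have [y [Gy zE]] := generation x'0 Gam0 GamB GamS GamX GamV kil i0 (leqnn _) Gz0.
exists y; split=> // i E pE; have [l Al] := pt_chart cd pE.1.
have := Gy i l E _ pE; rewrite mul1n; apply.
by move=> l'; rewrite finset.in_set1 => /eqP ->.
Qed.

(** Writing j as a sum of x_i^M y_i and replacing x_i^M by the section above it from [killers] lifts
    j to every level e1 l. The poles of the splittings for D, on which M1 may not depend, are
    absorbed at a high level, where L q is positive enough to apply [P_step] again with factors
    x_i^M' as high as needed. *)
Lemma lift_form : exists M1, forall L D (j : K) (e2 : nat) (g' : J -> K), fsupp L -> fsupp D ->
  sa (fun E => L E - B E *+ M1) -> global (fun E => C E + L E) j ->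
  (0 < e2)%N -> (forall i, splits_at e2 D i (g' i)) ->
  exists e kap, [/\ (0 < e)%N, global (fun E => C E + L E *+ (p ^ e) - D E) kap &
    iter e tau kap = j].
Proof.
have [M0 step] := P_step; have [M1 kil] := killers; pose M := maxn (maxn M0 M1) 1.
have [MM0 MM1 M01] : [/\ M0 <= M, M1 <= M & 0 < M]%N by rewrite !leq_max !leqnn !orbT.
exists (n.*2.+1 * M)%N => L D j e2 g' fL fD saL jL e20 Hg'.
have [y [yG jE]] := step M L j MM0 fL saL jL.
have level l : exists kap, global (fun E => C E + L E *+ (p ^ (e1 * l))) kap /\
    iter (e1 * l) tau kap = j.
  have /choice[H HP] := fun i => kil M l i MM1; set q := (p ^ (e1 * l))%N in HP *.
  exists (\sum_i y i ^+ q * H i); split=> [E pE|]; last first.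
    by rewrite tau_iter_sum jE; apply: eq_bigr => i _; rewrite tauZ (HP i).2 mulrC.
  apply: (vge_sum (dvrE pE)) => i _.
  have := vgeM (dvrE pE) (vgeX (dvrE pE) q (yG i E pE)) ((HP i).1 E pE).
  apply: vge_le; rewrite !(mulrnDl, mulrnBl, mulNrn, opprD, opprK) mulrnA; lia.
have [M2 pol] := splitting_poles fD Hg'; pose M' := maxn M0 M2.
have [MM0' MM2] : (M0 <= M')%N /\ (M2 <= M')%N by rewrite !leq_max !leqnn orbT.
(* As q >= l, the copies of B contained in L, multiplied by q, cover the (2n + 1) M' copies asked
   for by [P_step]. *)
pose l := (n.*2.+1 * M')%N; pose q := (p ^ (e1 * l))%N.
have lq : (l <= q)%N.
  apply: (leq_trans (leq_pmull l e10)); apply: ltnW; apply: ltn_expl; exact: prime_gt1.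
have [kap [kG kj]] := level l; rewrite -/q in kG.
have [|z [zG kE]] := step M' (fun E => L E *+ q) kap MM0' (fsuppMn q fL) _ kG.
  apply: (sa_ext _ (sa_BMn ((n.*2.+1 * M) * q - l) (saMn q saL))) => E _.
  have lM : (l <= n.*2.+1 * M * q)%N by apply: leq_trans lq _; rewrite leq_pmull // muln_gt0.
  rewrite mulrnBl -mulrnA -{1}(subnKC lM) mulrnDr; lia.
have q20 : (0 < p ^ e2)%N by rewrite expn_gt0 p0.
have le2 : (M2 <= M' * p ^ e2)%N by apply: leq_trans MM2 _; rewrite leq_pmulr.
exists (e1 * l + e2)%N, (\sum_i z i ^+ (p ^ e2) * (x i ^+ (M' * p ^ e2) * g' i)); split.
- by rewrite addn_gt0 e20 orbT.
- move=> E pE; apply: (vge_sum (dvrE pE)) => i _.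
  have := vgeM (dvrE pE) (vgeX (dvrE pE) (p ^ e2) (zG i E pE)) (pol _ i le2 E pE).
  apply: vge_le; rewrite expnD -/q !(mulrnDl, mulrnBl, mulNrn, opprD, opprK) -!mulrnA; lia.
rewrite iterD tau_iter_sum -kj kE; congr (iter _ _ _); apply: eq_bigr => i _.
by rewrite tauZ exprM tauZ (Hg' i).2 mulr1 mulrC.
Qed.
End Killing.
End Duality.

(** * Projective varieties and splittings *)

Lemma noeth_field (k : fieldType) : @noeth k setT.
Proof.
move=> I _ [I0 mI]; have [[a [Ia a0]]|h] := pselect (exists a, I a /\ a != 0); last first.
  exists [::] => // z Iz; have [->|z0] := eqVneq z 0; first exact: Span0.
  by case: h; exists z.
exists [:: a] => [z|z Iz]; first by rewrite /= inE => /eqP ->.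
have -> : z = (z / a) *: (a : k^o) + 0 by rewrite addr0 /GRing.scale /= divfK.
by apply: SpanZ => //=; [rewrite inE|exact: Span0].
Qed.

Section Model.
Variables (k : fieldType) (X : projVariety k).

Definition cidx := {i : 'I_(ambientDim X).+1 | hcoord X i != 0}.
Definition coordX (j : cidx) : X := hcoord X (val j).
Definition consts : set X := range (constants X).

Lemma coordX_neq0 j : coordX j != 0. Proof. exact: (valP j). Qed.

Lemma consts_subring : subring consts.
Proof.
have -> : consts = constants X @` setT by [].
by apply: image_subring; split.
Qed.

Lemma chart_subring i : subring (chart (constants X) (hcoord X) i).
Proof.
have h S : (subring_closed (mem S) /\ range (constants X) `|` range (fun j => hcoord X j / hcoord X i) `<=` S) ->
    subring S by case=> /subring_closedP.
split=> [S hS|a b Ha Hb S hS|a b Ha Hb S hS].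
- exact: (subring1 (h S hS)).
- by apply: (subringB (h S hS)); [exact: Ha|exact: Hb].
- by apply: (subringM (h S hS)); [exact: Ha|exact: Hb].
Qed.

Lemma chartE (j : cidx) :
  chart (constants X) (hcoord X) (val j) = chartR coordX consts j.
Proof.
apply/seteqP; split.
  apply: smallest_sub; first by apply/subring_closedP; apply: chartR_subring consts_subring; exact: coordX_neq0.
  move=> _ [[c _ <-]|[l _ <-]]; first by apply: chartR_sub; [exact: consts_subring|exists c].
  have [->|l0] := eqVneq (hcoord X l) 0.
    by rewrite mul0r; apply: subring0; apply: chartR_subring consts_subring; exact: coordX_neq0.
  by apply: (@chartR_ratio _ _ coordX coordX_neq0 consts j (exist _ l l0) consts_subring).
apply: chartR_min; [exact: coordX_neq0|exact: consts_subring|exact: chart_subring| |].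
  by move=> z Rz S [_ h]; apply: h; left.
by move=> l S [_ h]; apply: h; right; exists (val l).
Qed.

Lemma chart_dataX : chart_data consts coordX.
Proof.
split; [exact: consts_subring| |exact: coordX_neq0|].
  apply: (noeth_image (f := constants X)) (@noeth_field k); exact: fmorph_inj.
have [i i0 h] := hcoord_frac X; exists (exist _ i i0) => z.
by have := h z; rewrite (chartE (exist _ i i0)).
Qed.

Lemma pointsE : points X = chart_points consts coordX.
Proof.
apply/seteqP; split=> O.
  by move=> [i [P [i0]]]; rewrite (chartE (exist _ i i0)) => pP ->; exists (exist _ i i0), P.
move=> [i [P [pP ->]]]; exists (val i), P; split; first exact: (valP i).
  by rewrite chartE.
by rewrite chartE.
Qed.

Lemma prime_divisorE E : prime_divisor E <-> pdiv consts coordX E.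
Proof. by rewrite /prime_divisor pointsE. Qed.

Lemma open_inE U : open_in U <-> zopen consts coordX U.
Proof. by rewrite /open_in pointsE. Qed.

Lemma normalE : normal_variety X -> forall O, chart_points consts coordX O -> int_closed O.
Proof. by move=> nX O; rewrite -pointsE; exact: nX. Qed.

Lemma sectionsE D U s : sections D U s <-> sec consts coordX U D s.
Proof.
split=> [[->|h] E UE /prime_divisorE pE|h].
- by rewrite vge0.
- by rewrite /vge; apply/orP; right; have := h E UE pE; lia.
have [->|s0] := eqVneq s 0; first by left.
by right=> E UE /prime_divisorE pE; have := h E UE pE; rewrite vge_eq //; lia.
Qed.
End Model.

(** * Frobenius splittings as sections of divisors *)

Section FRegular.
Variables (k : fieldType) (p : nat) (X : projVariety k).
Hypothesis (nX : normal_variety X).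
Notation R0 := (@consts k X).
Notation x := (@coordX k X).
Notation pdiv := (pdiv R0 x).
Notation pt := (chart_points R0 x).
Let cd : chart_data R0 x := chart_dataX X.
Let normal := normalE nX.
Let dvrE E : pdiv E -> dvr E. Proof. exact: (pdiv_dvr cd normal). Qed.
Implicit Types (O E : set X) (D C : set X -> int).

Lemma regular_sections D U z : effective U D -> (forall O, U O -> O z) -> sections D U z.
Proof.
move=> eD Uz; have [->|z0] := eqVneq z 0; first by left.
right=> E UE pE; have pE' := (prime_divisorE E).1 pE.
apply: addr_ge0; last exact: eD.
by rewrite -(vge_eq E _ z0); apply/(mem_vge (dvrE pE')); exact: Uz.
Qed.

Lemma effective_sub D (U W : set (set X)) : U `<=` W -> effective W D -> effective U D.
Proof. by move=> UW eD E /UW; exact: eD. Qed.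

(** Sections being defined by divisors, z^(p^e) is a section of O_X(0) near O, and a splitting for D
    = 0 maps it into O. On the smaller open set V where z is regular the splitting returns z, and it
    commutes with restriction. *)
Lemma strong_hartogs O z : strongly_F_regular X p -> pt O ->
  (forall E, pdiv E -> O `<=` E -> E z) -> O z.
Proof.
move=> SF ptO Hz; have [z0|z0] := eqVneq z 0.
  by rewrite z0; exact: subring0 (pt_subring cd ptO).
have [W [oW WO gF]] := SF O (eq_ind_r (fun S => S O) ptO (pointsE X)).
have oW' := (open_inE W).1 oW.
have e0 : effective W (fun=> 0) by [].
have w0 : weil_divisor W (fun=> 0).
  by rewrite /weil_divisor (_ : [set _ | _] = set0) //; apply/seteqP; split=> // E []; rewrite eqxx.
have [e e_gt0 [sig sP]] := gF _ w0 e0.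
pose F := [set E | pdiv E /\ ~ E z].
have fF : finite_set F.
  apply: (sub_finite_set _ (finite_div cd normal z0)) => E [pE nz]; split=> //.
  apply/eqP => v0; apply: nz; apply/(mem_vge (dvrE pE)).
  by rewrite vge_eq // v0.
pose U := [set O' | W O' /\ forall E, F E -> ~ O' `<=` E].
have oU : zopen R0 x U by exact: zopen_avoid.
have UO : U O by split=> // E [pE nz] OE; apply: nz; exact: Hz.
pose V := U `&` [set O' | pt O' /\ O' z].
have oV : zopen R0 x V by apply: zopenI => //; exact: zopen_mem.
have VT : V setT by split; [apply: (zopen_generic cd) oU _; exists O|split=> //; exact: (pt_generic cd)].
have UW : U `<=` W by move=> O' [].
have VW : V `<=` W by move=> O' [/UW].
have sU : sections (fun=> 0) U (z ^+ (p ^ e)).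
  have [->|z1] := eqVneq (z ^+ (p ^ e)) 0; first by left.
  right=> E [WE UE] pE; have pE' := (prime_divisorE E).1 pE; rewrite addr0.
  rewrite -(vge_eq E _ z1); apply/(mem_vge (dvrE pE')); apply: (subringX (pt_subring cd pE'.1)).
  by apply: contrapT => nz; apply: (UE E).
have [r1 _ _ r4 _] := sP U ((open_inE U).2 oU) UW (ex_intro _ O UO).
have [_ _ _ _ v5] := sP V ((open_inE V).2 oV) VW (ex_intro _ _ VT).
have := r1 _ sU O UO; rewrite -(r4 V _ ((open_inE V).2 oV) _ (ex_intro _ _ VT) sU); last by move=> O' [].
by rewrite v5 // => O' [_ []].
Qed.

Hypothesis SF : strongly_F_regular X p.
Let hartogs O z : pt O -> (forall E, pdiv E -> O `<=` E -> E z) -> O z.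
Proof. exact: strong_hartogs. Qed.

Variables (charp : p \in [pchar X]) (tau : X -> X) (C : set X -> int).
Hypothesis tauD : forall e, {morph iter e tau : a b / a + b}.
Hypothesis tauZ : forall e a z, iter e tau (a ^+ (p ^ e) * z) = a * iter e tau z.
Hypothesis tau_dual : forall E e (m : int) z, pdiv E ->
  vge E (- C E - m *+ (p ^ e)) z <-> forall a, E a -> vge E (- C E - m) (iter e tau (a * z)).
Hypothesis tau_lin : forall e (sig : X -> X), (forall a b : X, sig (a + b) = sig a + sig b) ->
  (forall a z : X, sig (a ^+ (p ^ e) * z) = a * sig z) ->
  exists h, forall z, sig z = iter e tau (h * z).
Hypothesis fC : fsupp R0 x C.

Let p0 : (0 < p)%N. Proof. by case/andP: charp => /prime_gt0. Qed.

Definition Ksec e D E : int := C E - C E *+ (p ^ e) - D E.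

Lemma fsupp_Ksec e D : fsupp R0 x D -> fsupp R0 x (Ksec e D).
Proof.
move=> fD; apply: (fsupp_ext _ (fsupp_comb 1 (-1) (fsupp_comb 1 (-1) fC (fsuppMn (p ^ e) fC)) fD)).
by move=> E _; rewrite !mul1r !mulN1r.
Qed.

(** Regularity of tau^e(h s) is checked at the prime divisors by [tau_dual] and extended to all
    points by [hartogs]. *)
Lemma splits_of_section e D h : effective (points X) D -> sec R0 x pt (Ksec e D) h ->
  iter e tau h = 1 -> frobenius_splits p e (points X) D.
Proof.
move=> eD hG h1; exists (fun _ s => iter e tau (h * s)) => U oU UX Un.
have oU' := (open_inE U).1 oU.
split=> //.
- move=> s /sectionsE Us O UO; have ptO : pt O by apply: oU'.1.
  apply: hartogs => // E pE OE; have dE := dvrE pE.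
  have UE : U E by apply: (zopen_sup oU' UO) => //; exact: pE.1.
  apply/(mem_vge dE); have := (tau_dual e (- C E) (h * s) pE).1 _ 1.
  rewrite mul1r opprK addNr; apply; last exact: subring1 (pt_subring cd pE.1).
  have := vgeM dE (hG E pE.1 pE) (Us E UE pE); apply: vge_le; rewrite /Ksec mulNrn; lia.
- by move=> s s' _ _; rewrite mulrDr tauD.
- by move=> a s _ _; rewrite mulrCA tauZ.
- by move=> a _; rewrite mulrC tauZ h1 mulr1.
Qed.

(** The splitting is extended to the generic point: s z is its value on z over the open set [V z]
    where z is regular. Restriction makes s additive and p^-e-linear on K, so [tau_lin] produces h,
    and [tau_dual] turns regularity of the splitting at E into a bound on the poles of h. *)
Lemma local_splitting O D : pt O -> fsupp R0 x D -> (forall E, pdiv E -> 0 <= D E) ->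
  exists e W h, [/\ (0 < e)%N, zopen R0 x W, W O, sec R0 x W (Ksec e D) h & iter e tau h = 1].
Proof.
move=> ptO fD D0; have [W [oW WO gF]] := SF (eq_ind_r (fun S => S O) ptO (pointsE X)).
have oW' := (open_inE W).1 oW.
have eW : effective W D by move=> E _ /prime_divisorE; exact: D0.
have wW : weil_divisor W D.
  by apply: sub_finite_set fD => E [_ /prime_divisorE pE DE].
have [e e_gt0 [sig sP]] := gF _ wW eW.
pose V z := W `&` [set O' | pt O' /\ O' z].
have oV z : zopen R0 x (V z) by apply: zopenI => //; exact: zopen_mem.
have WT : W setT by apply: (zopen_generic cd) oW' _; exists O.
have VT z : V z setT by split=> //; split=> //; exact: (pt_generic cd).
have VW z : V z `<=` W by move=> O' [].
have secV z U : U `<=` V z -> sections D U z.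
  move=> UV; apply: regular_sections; first by apply: effective_sub eW => O' /UV/VW.
  by move=> O' /UV[_ []].
pose s z := sig (V z) z.
have sE z U : zopen R0 x U -> U `<=` W -> U setT -> sections D U z -> sig U z = s z.
  move=> oU UW UT Uz; have oI := zopenI oU (oV z).
  have IT : (U `&` V z) setT by [].
  have [_ _ _ r _] := sP U ((open_inE U).2 oU) UW (ex_intro _ _ UT).
  have [_ _ _ r' _] := sP (V z) ((open_inE _).2 (oV z)) (@VW z) (ex_intro _ _ (VT z)).
  rewrite -(r (U `&` V z) z ((open_inE _).2 oI) _ (ex_intro _ _ IT) Uz); last by move=> O' [].
  have subI : U `&` V z `<=` V z by move=> O' [].
  have Vz : sections D (V z) z by exact: secV.
  by rewrite (r' (U `&` V z) z ((open_inE _).2 oI) subI (ex_intro _ _ IT) Vz).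
have sD a b : s (a + b) = s a + s b.
  pose U := V a `&` V b; have oU := zopenI (oV a) (oV b).
  have UT : U setT by [].
  have UW : U `<=` W by move=> O' [/VW].
  have [_ r _ _ _] := sP U ((open_inE U).2 oU) UW (ex_intro _ _ UT).
  have Ua : sections D U a by apply: secV => O' [].
  have Ub : sections D U b by apply: secV => O' [].
  have Uab : sections D U (a + b).
    apply: secV => O' [[WO' [ptO' O'a]] [_ [_ O'b]]]; split=> //; split=> //.
    by apply: (subringD (pt_subring cd ptO')).
  by rewrite -(sE _ U oU UW UT Uab) r // (sE _ U oU UW UT Ua) (sE _ U oU UW UT Ub).
have sZ a z : s (a ^+ (p ^ e) * z) = a * s z.
  pose U := V a `&` V z; have oU := zopenI (oV a) (oV z).
  have UT : U setT by [].
  have UW : U `<=` W by move=> O' [/VW].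
  have [_ _ r _ _] := sP U ((open_inE U).2 oU) UW (ex_intro _ _ UT).
  have Uz : sections D U z by apply: secV => O' [].
  have Ua : regular_on U a by move=> O' [[_ []]].
  have Uaz : sections D U (a ^+ (p ^ e) * z).
    apply: secV => O' [[WO' [ptO' O'a]] [_ [_ O'z]]]; split=> //; split=> //.
    by apply: (subringM (pt_subring cd ptO')) => //; apply: (subringX (pt_subring cd ptO')).
  by rewrite -(sE _ U oU UW UT Uaz) r // (sE _ U oU UW UT Uz).
have [h hE] := tau_lin sD sZ; exists e, W, h; split=> //; last first.
  rewrite -[h]mulr1 -hE; have [_ _ _ _ r] := sP (V 1) ((open_inE _).2 (oV 1)) (@VW 1) (ex_intro _ _ (VT 1)).
  by rewrite /s -{2}(expr1n X (p ^ e)) r // => O' [_ []].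
move=> E WE pE; have dE := dvrE pE; have [c c0 vc] := exists_vord dE (D E).
have rE := pt_subring cd pE.1.
(* As v_E(c) = D E, the local sections of O(D) at E are the a / c with a in E; U leaves out the
   finitely many divisors where a / c is not a section. *)
have key a : E a -> E (s (a / c)).
  move=> Ea; have [->|a0] := eqVneq a 0.
    have s0 : s 0 = 0 by have := sD 0 0; rewrite addr0 -{1}[s 0]addr0 => /addrI/esym.
    by rewrite mul0r s0; exact: subring0.
  have ac0 : a / c != 0 by rewrite mulf_neq0 // invr_eq0.
  pose F := [set E' | pdiv E' /\ ~ vge E' (- D E') (a / c)].
  have fF : finite_set F.
    apply: (sub_finite_set _ (finite_bad cd normal fD ac0)) => E' [pE' nv]; split=> //.
    have [D0'|] := eqVneq (D E') 0; last by left.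
    by right; apply/eqP => v0; apply: nv; rewrite vge_eq // v0 D0'.
  pose U := [set O' | W O' /\ forall E', F E' -> ~ O' `<=` E'].
  have oU : zopen R0 x U by exact: zopen_avoid.
  have UE : U E.
    split=> // E' [pE' nv] EE'; apply: nv; have <- : E = E' by exact: (pdiv_eq cd normal).
    rewrite -[- D E]add0r; apply: (vgeM dE); first exact/(mem_vge dE).
    by rewrite vge_eq ?invr_eq0 // (vordV dE) // vc.
  have UT : U setT by apply: (zopen_generic cd) oU _; exists E.
  have UW : U `<=` W by move=> O' [].
  have Uz : sections D U (a / c).
    apply/sectionsE => E' [WE' UE'] pE'; apply: contrapT => nv.
    by apply: (UE' E').
  have [r _ _ _ _] := sP U ((open_inE U).2 oU) UW (ex_intro _ _ UT).
  by rewrite -(sE _ U oU UW UT Uz); apply: r.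
have := (tau_dual e (- C E) (h / c) pE).2; rewrite opprK addNr => H.
have {}H : vge E (- C E - (- C E) *+ p ^ e) (h / c).
  apply: H => a Ea; apply/(mem_vge dE).
  by rewrite (_ : a * (h / c) = h * (a / c)) -?hE; [exact: key|ring].
rewrite -(divfK c0 h); move: H; rewrite -(vge_shift dE _ _ c0) vc; apply: vge_le.
rewrite /Ksec mulNrn; lia.
Qed.

(** Quasi-compactness and composition give local splittings of one common level e. On an affine
    chart the values tau^e(u) of the sections u form an ideal, and a local splitting multiplied by
    some c^(p^e) puts c, taken outside a given prime ideal, into it. *)
Lemma chart_splitting D : fsupp R0 x D -> (forall E, pdiv E -> 0 <= D E) ->
  exists e (g : cidx X -> X), (0 < e)%N /\ forall i, splits_at R0 x p tau C e D i (g i).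
Proof.
move=> fD D0.
have /choice[f fP] : forall O, exists eWh : nat * set (set X) * X, pt O ->
    [/\ (0 < eWh.1.1)%N, zopen R0 x eWh.1.2, eWh.1.2 O, sec R0 x eWh.1.2 (Ksec eWh.1.1 D) eWh.2 &
     iter eWh.1.1 tau eWh.2 = 1].
  move=> O; have [ptO|h] := pselect (pt O); last by exists (0%N, set0, 0).
  by have [e [W [h hP]]] := local_splitting ptO fD D0; exists (e, W, h).
have [|F [fF Fpt Fcov]] := @quasi_compact _ _ _ _ cd (fun O => (f O).1.2).
  by move=> O ptO; have [] := fP O ptO.
have Fe O : F O -> (0 < (f O).1.1)%N by move=> FO; have [] := fP O (Fpt O FO).
have [e e0 eP] := finite_common_multiple (g := fun O => (f O).1.1) fF Fe.
(* Composition multiplies the zeros along D of the previous splitting by p^e1 and adds those of the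
   next; as D >= 0, the surplus is harmless. *)
have level O m : F O -> exists h, sec R0 x (f O).1.2 (Ksec ((f O).1.1 * m.+1) D) h /\
    iter ((f O).1.1 * m.+1) tau h = 1.
  move=> FO; have [_ _ _ hG h1] := fP O (Fpt O FO); set W := (f O).1.2 in hG *.
  set e1 := (f O).1.1 in hG h1 *; elim: m => [|m [h [hmG hm1]]].
    by exists (f O).2; rewrite muln1.
  exists (h ^+ (p ^ e1) * (f O).2); rewrite mulnS addnC iterD tauZ h1 mulr1; split=> // E WE pE.
  have dE := dvrE pE.
  have := vgeM dE (vgeX dE (p ^ e1) (hmG E WE pE)) (hG E WE pE); apply: vge_le.
  rewrite /Ksec expnD !(mulrnDl, mulrnBl, mulNrn, opprD, opprK) -!mulrnA.
  have := mulrn_wge0 (p ^ e1) (D0 E pE); lia.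
have hP O : pt O -> exists W h, [/\ zopen R0 x W, W O, sec R0 x W (Ksec e D) h & iter e tau h = 1].
  move=> ptO; have [O' FO' WO] := Fcov O ptO; have [_ oW _ _ _] := fP O' (Fpt O' FO').
  have e1 := divnK (eP O' FO').
  have q0 : (0 < e %/ (f O').1.1)%N by rewrite divn_gt0 ?Fe // dvdn_leq // eP.
  have [h [hG h1]] := level O' (e %/ (f O').1.1).-1 FO'.
  by rewrite prednK // mulnC e1 in hG h1; exists (f O').1.2, h.
have /choice[g gP] : forall i : cidx X, exists g, splits_at R0 x p tau C e D i g; last by exists e, g.
move=> i; have rA : subring (chartR x R0 i) by apply: chartR_subring (cd_subring cd); exact: cd_neq0 cd.
have nA : noeth (chartR x R0 i) by apply: chartR_noeth (cd_noeth cd) => //; [exact: cd_neq0 cd|exact: cd_subring cd].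
pose A := chartR x R0 i; pose G := sec R0 x [set E | A `<=` E] (Ksec e D).
have GA c u : A c -> G u -> G (c * u).
  move=> Ac Gu E AE pE; rewrite -[- _]add0r; apply: (vgeM (dvrE pE)); last exact: Gu.
  by apply/(mem_vge (dvrE pE)); exact: AE.
pose Q : set X := [set c | A c /\ exists2 u, G u & iter e tau u = c].
have iQ : ideal A Q.
  split; first by move=> c [].
  split.
    split; first exact: subring0.
    exists 0; first by move=> E _ _; rewrite vge0.
    by have := tauD e 0 0; rewrite addr0 -{1}[iter e tau 0]addr0 => /addrI/esym.
  move=> c v w Ac [Av [u Gu uE]] [Aw [u' Gu' u'E]]; split.
    by apply: (subringD rA) => //; exact: (subringM rA).
  exists (c ^+ (p ^ e) * u + u'); last by rewrite tauD tauZ uE u'E.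
  move=> E AE pE; apply: (vgeD (dvrE pE)); last exact: Gu'.
  by apply: GA => //; exact: (subringX rA).
suff [_ [u Gu u1]] : Q 1 by exists u; split.
apply: (unit_ideal rA nA iQ) => P pP.
have ptO : pt (localization A P) by exists i, P.
have [W [h [oW WO hG h1]]] := hP _ ptO.
have [|c [Ac Pc cP]] := clear_at cd normal (G := Ksec e D) (u := h) rA pP (fsupp_Ksec e fD).
  by move=> E pE OE; apply: hG => //; apply: (zopen_sup oW WO) => //; exact: pE.1.
exists c => //; split=> //; exists (c ^+ (p ^ e) * h); last by rewrite tauZ h1 mulr1.
have -> : c ^+ (p ^ e) * h = c ^+ (p ^ e).-1 * (c * h).
  by rewrite mulrA -exprSr prednK // expn_gt0 p0.
by apply: GA; [exact: (subringX rA)|move=> E AE pE; exact: cP].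
Qed.
End FRegular.

(** * Ample divisors *)

Lemma mulrn_fctE (T : Type) (D : T -> int) n E : (D *+ n) E = D E *+ n.
Proof. by elim: n => // n IH; rewrite !mulrS -IH. Qed.

Section Ample.
Variables (k : fieldType) (X : projVariety k).
Hypothesis (nX : normal_variety X).
Notation R0 := (@consts k X).
Notation x := (@coordX k X).
Notation pdiv := (pdiv R0 x).
Notation pt := (chart_points R0 x).
Notation sa := (sa R0 x).
Notation global := (global R0 x).
Notation fsupp := (fsupp R0 x).
Let cd : chart_data R0 x := chart_dataX X.
Let normal := normalE nX.
Let dvrE E : pdiv E -> dvr E. Proof. exact: (pdiv_dvr cd normal). Qed.
Hypothesis hartogs : forall O z, pt O -> (forall E, pdiv E -> O `<=` E -> E z) -> O z.
Implicit Types (O E : set X) (D C G H N : set X -> int).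

Lemma weil_fsupp D : weil_divisor (points X) D -> fsupp D.
Proof.
by apply: sub_finite_set => E [pE DE]; split; [rewrite pointsE; exact: pE.1|exact/prime_divisorE|].
Qed.

Definition locally_principal N := forall O, pt O -> exists h U,
  [/\ h != 0, zopen R0 x U, U O & forall E, U E -> pdiv E -> N E = vord E h].

Lemma cartier_principal H : cartier H -> locally_principal H.
Proof.
move=> [_ cH] O; rewrite -pointsE => ptO; have [h [h0 [U [oU UO hU]]]] := cH O ptO.
exists h, U; split=> //; first exact/open_inE.
by move=> E UE /prime_divisorE; exact: hU.
Qed.

Lemma zopen_chart i : zopen R0 x [set O | pt O /\ chartR x R0 i `<=` O].
Proof.
split=> [O []//|O [ptO AO]]; exists [seq x j / x i | j <- enum {: cidx X}]; split.
  move=> z /mapP[j _ ->]; apply: AO; apply: chartR_ratio; [exact: cd_neq0 cd|exact: cd_subring cd].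
move=> O' ptO' h; split=> //; apply: (ratio_chart cd ptO') => j; apply: h.
by apply/mapP; exists j; rewrite ?mem_enum.
Qed.

Lemma principal_B : locally_principal (Bdiv x).
Proof.
move=> O ptO; have [i AO] := pt_chart cd ptO.
exists (x i)^-1, [set O | pt O /\ chartR x R0 i `<=` O]; split=> //; last 1 first.
- move=> E [_ AE] pE; have x0 := cd_neq0 cd i; rewrite (vordV (dvrE pE)) //.
  by have -> := (Bdiv_chart cd normal i pE).1 AE; rewrite opprK.
- by rewrite invr_eq0; exact: cd_neq0 cd i.
exact: zopen_chart.
Qed.

(** Let h be an equation of N at O and X_s affine around O. On Spec of the ring of X_s, [clear_at]
    gives c, a unit at O, such that c h is a section of O(-N) over X_s; [clear_poles] extends s^T c
    h to a global section of O(nT G - N), which generates near O. *)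
Lemma ample_local G N O : ample_cartier G -> fsupp N -> locally_principal N -> pt O ->
  exists n T0 W, [/\ (0 < n)%N, zopen R0 x W, W O & forall T O', (T0 <= T)%N -> W O' ->
    exists w, gen_at R0 x (fun E => G E *+ (n * T) - N E) 1 w O'].
Proof.
move=> [cG aG] fN lN ptO; have ptO' : points X O by rewrite pointsE.
have [n [s [n0 s0 sG nvO aff]]] := aG O ptO'; have [h [U [h0 oU UO hU]]] := lN O ptO.
set Y := nonvanishing _ s in nvO aff; have [oY YE] := aff; pose S := regular_on Y.
have rS : subring S.
  have rpt O' : Y O' -> subring O' by move=> YO'; apply: (pt_subring cd); rewrite -pointsE; exact: oY.1.
  split=> [O' YO'|a b Sa Sb O' YO'|a b Sa Sb O' YO']; first exact: subring1 (rpt _ YO').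
    by apply: (subringB (rpt _ YO')); [exact: Sa|exact: Sb].
  by apply: (subringM (rpt _ YO')); [exact: Sa|exact: Sb].
have [P pP OE] : [set localization S P | P in prime_ideal S] O by rewrite /S -YE.
have fN' : fsupp (fun E => - N E) by apply: sub_finite_set fN => E []; rewrite oppr_eq0.
have [|c [Sc Pc cP]] := clear_at cd normal (G := fun E => - N E) (u := h) rS pP fN'.
  move=> E pE; rewrite OE => OE'; rewrite opprK vge_eq // hU //.
  by apply: (zopen_sup oU UO) => //; exact: pE.1.
have Oc : O c by apply: Sc.
have c0 : c != 0 by apply: contra_not_neq Pc => ->; case: pP => [[]].
have Oc' : O c^-1.
  rewrite -OE; exists 1, c; rewrite mul1r; split=> //; exact: subring1.
have nvE E : pdiv E -> vord E s = - (G E *+ n) -> Y E.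
  move=> pE vs; split=> [|E' /prime_divisorE pE' EE']; first by rewrite pointsE; exact: pE.1.
  by rewrite -(pdiv_eq cd normal pE pE' EE') vs mulrn_fctE addNr.
have [||T0 T0P] := @clear_poles _ _ _ _ cd normal (fun E => - N E) (fun E => G E *+ n) s (c * h) fN' s0.
- move=> E pE; have := (sectionsE _ _ _).1 sG E _ pE; rewrite pointsE => /(_ pE.1).
  by rewrite vge_eq // mulrn_fctE.
- by move=> E pE /(nvE E pE) YE'; apply: cP => // z Sz; exact: Sz.
pose W := (Y `&` U) `&` ([set O | pt O /\ O c] `&` [set O | pt O /\ O c^-1]).
exists n, T0, W; split=> //.
- apply: zopenI; [apply: zopenI => //; exact/open_inE|by apply: zopenI; exact: zopen_mem].
move=> T O' T0T [[YO' UO'] [[ptO'' O'c] [_ O'c']]]; exists (s ^+ T * (c * h)).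
have w0 : s ^+ T * (c * h) != 0 by rewrite !mulf_neq0 ?expf_neq0.
split=> // E pE.
  have := T0P T T0T E pE; apply: vge_le; rewrite mulr1n mulrnA; lia.
move=> O'E; have dE := dvrE pE.
rewrite (vordM dE) ?expf_neq0 ?mulf_neq0 // (vordX dE) // (vordM dE) //.
have -> : vord E s = - (G E *+ n).
  by have := YO'.2 E ((prime_divisorE E).2 pE) O'E; rewrite mulrn_fctE; lia.
have -> : vord E c = 0 by apply: (vord_unit dE); split=> //; exact: O'E.
rewrite -hU //; last by apply: (zopen_sup oU UO') => //; exact: pE.1.
by rewrite mulr1n mulrnA mulNrn; lia.
Qed.

Lemma ample_sub G N : ample_cartier G -> fsupp N -> locally_principal N ->
  exists2 c, (0 < c)%N & sa (fun E => G E *+ c - N E).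
Proof.
move=> aG fN lN.
have /choice[f fP] : forall O, exists v : nat * nat * set (set X), pt O ->
    [/\ (0 < v.1.1)%N, zopen R0 x v.2, v.2 O & forall T O', (v.1.2 <= T)%N -> v.2 O' ->
    exists w, gen_at R0 x (fun E => G E *+ (v.1.1 * T) - N E) 1 w O'].
  move=> O; have [ptO|h] := pselect (pt O); last by exists (0%N, 0%N, set0).
  by have [n [T0 [W h]]] := ample_local aG fN lN ptO; exists (n, T0, W).
have [|F [fF Fpt Fcov]] := @quasi_compact _ _ _ _ cd (fun O => (f O).2).
  by move=> O ptO; have [] := fP O ptO.
have Fe O : F O -> (0 < (f O).1.1)%N by move=> FO; have [] := fP O (Fpt O FO).
have [m m0 mP] := finite_common_multiple (g := fun O => (f O).1.1) fF Fe.
have [T TP] := finite_bound (fun O => (f O).1.2) fF.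
exists (m * T.+1)%N; first by rewrite muln_gt0 m0.
move=> O ptO; have [O' FO' WO] := Fcov O ptO; have [_ _ _ h] := fP O' (Fpt O' FO').
have mE := divnK (mP O' FO').
have q0 : (0 < m %/ (f O').1.1)%N by rewrite divn_gt0 ?Fe // dvdn_leq // mP.
have [|w] := h (m %/ (f O').1.1 * T.+1)%N O _ WO.
  by apply: leq_trans (TP O' FO') _; apply: leq_trans (leqnSn _) (leq_pmull _ q0).
by rewrite mulnA [((f O').1.1 * _)%N]mulnC mE => hw; exists 1%N, w.
Qed.

Lemma sa_ample G : ample_cartier G -> sa G.
Proof.
move=> [_ aG] O ptO; have [n [s [n0 s0 sG nvO _]]] := aG O (eq_ind_r (fun S => S O) ptO (pointsE X)).
exists n, s; split=> //; split=> // E pE.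
  by have := (sectionsE _ _ _).1 sG E (eq_ind_r (fun S => S E) pE.1 (pointsE X)) pE; rewrite mulrn_fctE.
by move=> OE; have := nvO.2 E ((prime_divisorE E).2 pE) OE; rewrite mulrn_fctE; lia.
Qed.

End Ample.

(** * Endomorphisms *)

Section Endomorphism.
Variables (k : fieldType) (p : nat) (X : projVariety k).
Hypothesis (nX : normal_variety X).
Notation R0 := (@consts k X).
Notation x := (@coordX k X).
Notation pdiv := (pdiv R0 x).
Notation pt := (chart_points R0 x).
Notation sa := (sa R0 x).
Notation global := (global R0 x).
Notation fsupp := (fsupp R0 x).
Notation B := (Bdiv x).
Let cd : chart_data R0 x := chart_dataX X.
Let normal := normalE nX.
Let dvrE E : pdiv E -> dvr E. Proof. exact: (pdiv_dvr cd normal). Qed.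
Hypothesis hartogs : forall O z, pt O -> (forall E, pdiv E -> O `<=` E -> E z) -> O z.
Hypothesis charp : p \in [pchar X].
Implicit Types (O E : set X) (D C G H N : set X -> int) (y u z : X).

Section OneMorphism.
Variable phi : {rmorphism X -> X}.
Hypothesis phi_const : forall c, R0 c -> phi c = c.
Hypothesis dom : forall O, pt O -> exists2 O', pt O' & local_hom phi O O'.

(** The functions regular on the inverse image of Spec O1, the points of which are the generizations
    of O1. *)
Definition over O1 : set X := [set y | forall O' O'', pt O' -> pt O'' ->
  local_hom phi O' O'' -> O1 `<=` O'' -> O' y].

Lemma over_pdiv O1 y : pt O1 ->
  (forall E E', pdiv E -> pt E' -> local_hom phi E E' -> O1 `<=` E' -> E y) -> over O1 y.
Proof.
move=> pt1 h O' O'' ptO' ptO'' l OO; apply: hartogs => // E pE OE.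
have [E' ptE' lE] := dom pE.1; apply: (h E E') => //; apply: subset_trans OO _.
exact: (local_hom_mono cd ptO' pE.1 ptO'' ptE' OE l lE).
Qed.

Variables (m : nat) (M : X -> 'M[X]_m.+1).
Hypotheses (MD : forall x y, M (x + y) = M x + M y) (Mphi : forall a y, M (phi a * y) = a *: M y)
  (M1 : M 1 = 1) (MM : forall x y, M (x * y) = M x * M y) (Minj : forall y, M y = 0 -> y = 0).

Let M0 : M 0 = 0. Proof. by have := Mphi 0 0; rewrite mulr0 scale0r. Qed.
Let MX y l : M (y ^+ l) = M y ^+ l.
Proof. by elim: l => [|l IH]; rewrite ?M1 // !exprS MM IH. Qed.

Lemma root_rep u : root (map_poly phi (char_poly (M u))) u.
Proof.
apply/eqP; apply: Minj; rewrite horner_coef (big_morph M MD M0) size_map_poly.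
rewrite -[RHS](Cayley_Hamilton (M u)).
move: (char_poly (M u)) => P; rewrite -[in RHS](coefK P) poly_def linear_sum.
apply: eq_bigr => i _; rewrite coef_map /= Mphi MX linearZ rmorphXn /= horner_mx_X.
by [].
Qed.

(** The powers of y lie in a finite module over phi(O1), so the entries of all M (y ^+ l) have
    bounded poles along E. But the coefficients for y^(p^s) are the p^s-th powers of those for y, so
    that a pole would be multiplied by p^s. *)
Lemma coef_over O1 y i : pt O1 -> over O1 y -> O1 (char_poly (M y))`_i.
Proof.
move=> pt1 oy; have [ns nsP] := integral_over_pt cd phi_const dom pt1 oy.
apply: hartogs => // E pE OE; have dE := dvrE pE; apply/(mem_vge dE).
have [N NP] := exists_vbound E [seq M n rc.1 rc.2 | n <- ns, rc <- enum {: 'I_m.+1 * 'I_m.+1}].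
have bnd l r c : vge E (- N%:Z) (M (y ^+ l) r c).
  elim: (nsP l) => [|a n z [b Ob <-] nns _ IH]; first by rewrite M0 mxE vge0.
  rewrite MD mxE; apply: (vgeD dE) => //; rewrite -[phi b *: n]/(phi b * n) Mphi mxE -[- _]add0r.
  apply: (vgeM dE); first by apply/(mem_vge dE); apply: OE.
  by apply: NP; apply/allpairsP; exists (n, (r, c)); rewrite mem_enum.
pose c := (char_poly (M y))`_i; rewrite -/c; have [->|c0] := eqVneq c 0; first by rewrite vge0.
rewrite vge_eq // leNgt; apply/negP => vc.
have [b b0 vb] := exists_vord dE N%:Z.
(* Multiplication by b, of order N, makes the matrix integral at E and costs at most (m + 1) N = s
   in the valuation of c^(p^s); and s < p^s. *)
pose s := (m.+1 * N)%N.
have Ee : E (char_poly (b *: M y ^+ (p ^ s)))`_i.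
  apply: char_poly_subring; first exact: (pt_subring cd pE.1).
  move=> r c'; rewrite mxE -MX; apply/(mem_vge dE).
  by have := vgeM dE (vge_vord E b) (bnd (p ^ s)%N r c'); rewrite vb addrN.
have := char_poly_scale b (M y ^+ (p ^ s)) i; rewrite (char_poly_frobX charp) -/c.
pose e := (char_poly (b *: M y ^+ (p ^ s)))`_i; rewrite -/e in Ee *; move=> ee.
have e0 : e != 0.
  apply: contra_neq (_ : b ^+ m.+1 * c ^+ (p ^ s) != 0) => [e0|].
    by rewrite -ee e0 mul0r.
  by rewrite mulf_neq0 ?expf_neq0.
have := congr1 (vord E) ee; rewrite !(vordM dE) ?expf_neq0 // !(vordX dE) // vb.
have : 0 <= vord E e by rewrite -vge_eq //; apply/(mem_vge dE).
have sp : (s < p ^ s)%N by apply: ltn_expl; apply: prime_gt1; case/andP: charp.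
have mn (a : int) l : a *+ l = a * l%:Z by rewrite -mulr_natr natz.
rewrite !mn => ve eq.
have h1 : 0 <= N%:Z * i%:Z by apply: mulr_ge0.
have h2 : 0 <= (- 1 - vord E c) * (p ^ s)%N%:Z by apply: mulr_ge0 => //; lia.
have h3 : N%:Z * m.+1%:Z = s%:Z by rewrite /s PoszM mulrC.
by move: sp eq h1 h2 ve; rewrite h3 mulrBl mulN1r; lia.
Qed.

(* If b is in the maximal ideal of O1 but not in the nonzero prime P1, then some
   b^N / a, a in P1, is mapped into E, hence is a quotient zt / u; comparing the
   characteristic polynomials of zt and u, the lower coefficients of the latter are
   in P1, so the unit u of E is not one. *)
Lemma dim1_image E O1 : pdiv E -> pt O1 -> local_hom phi E O1 ->
  (forall z, E z -> exists zt u, [/\ over O1 zt, over O1 u, unit_in E u & z * u = zt]) ->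
  pdiv O1.
Proof.
move=> pE pt1 l fracE; split=> //; have dE := dvrE pE.
have rE := pt_subring cd pE.1; have r1 := pt_subring cd pt1.
have phiE a : O1 a -> E (phi a) by move=> /l[].
have phiN a : nonunits O1 a -> vge E 1 (phi a).
  move=> [Oa nu]; apply/(nonunits_vge dE); split; first exact: phiE.
  by move=> h; apply: nu; apply: (l a Oa).2.
have cpE u : (map_poly phi (char_poly (M u))) \is monic.
  by rewrite map_monic char_poly_monic.
split=> [OT|P1 pP1].
  apply: (pdiv_neqT pE); apply/seteqP; split=> // z _.
  apply: (normal pE.1) (cpE z) _ (root_rep z); apply: polyOver_set => i.
  by rewrite coef_map; apply: phiE; rewrite OT.
have [P10|P1n] := pselect (P1 = [set 0]); first by left.
right; have [[PO Pz] PD PM P11 Pp] := pP1.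
have Pnu : P1 `<=` nonunits O1.
  move=> a Pa; split; first exact: PO.
  by move=> [a0 _ Oa']; apply: P11; rewrite -(mulVf a0); apply: PM.
apply/seteqP; split=> // b nb; apply: contrapT => Pb.
have [a Pa a0] : exists2 a, P1 a & a != 0.
  apply: contrapT => h; apply: P1n; apply/seteqP; split=> [z Pz'|z ->] //=.
  by apply: contrapT => /eqP z0; apply: h; exists z.
have b0 : b != 0 by apply: contra_not_neq Pb => ->.
have pa0 : phi a != 0 by rewrite fmorph_eq0.
have pb0 : phi b != 0 by rewrite fmorph_eq0.
pose N := `|vord E (phi a)|%N; pose r := b ^+ N / a.
have r0 : r != 0 by rewrite mulf_neq0 ?expf_neq0 ?invr_eq0.
have Er : E (phi r).
  apply/(mem_vge dE); rewrite rmorphM fmorphV rmorphXn vge_eq ?mulf_neq0 ?invr_eq0 ?expf_neq0 //.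
  rewrite (vordM dE) ?invr_eq0 ?expf_neq0 // (vordV dE) // (vordX dE) //.
  have := phiN b nb; rewrite vge_eq // -[_ *+ _]mulr_natr natz => vb1.
  have : 0 <= (vord E (phi b) - 1) * N%:Z by apply: mulr_ge0 => //; lia.
  have hN : vord E (phi a) <= N%:Z by rewrite /N; lia.
  by rewrite mulrBl mul1r !subr_ge0; exact: le_trans.
have [zt [u [ozt ou [u0 Eu Eu'] ztE]]] := fracE _ Er.
have Ob : O1 b by case: nb.
have cP i : (i < m.+1)%N -> P1 (char_poly (M u))`_i.
  move=> im; have e := char_poly_scale r (M u) i; rewrite -Mphi ztE in e.
  set ci := (char_poly (M u))`_i in e *; pose ei := (char_poly (M zt))`_i; rewrite -/ei in e.
  have Oci : O1 ci by exact: coef_over.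
  have Oei : O1 ei by exact: coef_over.
  have e' : a ^+ (m.+1 - i) * ei = b ^+ (N * (m.+1 - i)) * ci.
    have rX : r ^+ m.+1 = r ^+ (m.+1 - i) * r ^+ i by rewrite -exprD subnK // ltnW.
    apply: (mulfI (expf_neq0 i r0)); rewrite mulrCA [r ^+ i * ei]mulrC e rX.
    by rewrite /r expr_div_n -exprM; field; rewrite ?expf_neq0.
  have Pbe : P1 (b ^+ (N * (m.+1 - i)) * ci).
    rewrite -e' mulrC; apply: (PM) => //.
    have [q ->] : exists q, (m.+1 - i = q.+1)%N by exists (m - i)%N; rewrite subSn.
    by rewrite exprSr; apply: (PM) => //; apply: (subringX r1); exact: PO.
  case: (Pp _ _ (subringX r1 _ Ob) Oci Pbe) => // Pbn; exfalso; apply: Pb.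
  elim: (N * _)%N Pbn => [|q IH]; first by rewrite expr0.
  by rewrite exprS => /(Pp _ _ Ob (subringX r1 _ Ob))[].
have := root_rep u; rewrite /root horner_coef size_map_poly size_char_poly big_ord_recr /=.
have -> : (map_poly phi (char_poly (M u)))`_m.+1 = 1.
  rewrite coef_map /=; have /monicP := char_poly_monic (M u).
  by rewrite lead_coefE size_char_poly /= => ->; exact: rmorph1.
rewrite mul1r addrC addr_eq0 => /eqP h.
have : vge E 1 (u ^+ m.+1).
  rewrite h (vgeN dE); apply: (vge_sum dE) => i _; rewrite coef_map -[1]addr0.
  apply: (vgeM dE); first by apply/phiN/Pnu/cP.
  by apply/(mem_vge dE); exact: subringX.
rewrite vge_eq ?expf_neq0 // (vordX dE) // (vord_unit dE); last by split.
by rewrite mul0rn.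
Qed.
End OneMorphism.
End Endomorphism.

Section Pullback.
Variables (k : fieldType) (p : nat) (X : projVariety k).
Hypothesis (nX : normal_variety X).
Notation R0 := (@consts k X).
Notation x := (@coordX k X).
Notation pdiv := (pdiv R0 x).
Notation pt := (chart_points R0 x).
Notation sa := (sa R0 x).
Notation global := (global R0 x).
Notation fsupp := (fsupp R0 x).
Notation B := (Bdiv x).
Let cd : chart_data R0 x := chart_dataX X.
Let normal := normalE nX.
Let dvrE E : pdiv E -> dvr E. Proof. exact: (pdiv_dvr cd normal). Qed.
Hypothesis hartogs : forall O z, pt O -> (forall E, pdiv E -> O `<=` E -> E z) -> O z.
Hypothesis charp : p \in [pchar X].
Implicit Types (O E : set X) (D C G H N : set X -> int) (y u z : X) (phi : {rmorphism X -> X}).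

Let mnE (a : int) l : a *+ l = a * l%:Z. Proof. by rewrite -mulr_natr natz. Qed.

(* phi is the comorphism of an endomorphism, t a normalized trace of X over
   phi X, ff E the image of E and rho E the ramification index at E. *)
Record edata phi (t : X -> X) (ff : set X -> set X) (rho : set X -> int) : Prop := EData {
  ed_add : forall y z, t (y + z) = t y + t z;
  ed_semi : forall a y, t (phi a * y) = a * t y;
  ed_one : t 1 = 1;
  ed_frob : forall y, t (y ^+ p) = t y ^+ p;
  ed_const : forall c, R0 c -> phi c = c;
  ed_pt : forall O, pt O -> pt (ff O) /\ local_hom phi O (ff O);
  ed_pdiv : forall E, pdiv E -> pdiv (ff E);
  ed_rho0 : forall E, pdiv E -> 0 <= rho E;
  ed_rho : forall E z, pdiv E -> z != 0 -> vord E (phi z) = rho E * vord (ff E) z }.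

Definition fstar (ff : set X -> set X) (rho : set X -> int) N E := rho E * N (ff E).

Lemma forms_global d F : forms x R0 d F -> global (fun E => B E *+ d) F.
Proof.
move=> SF E pE; have dE := dvrE pE; elim: SF => [|a _ z Ra [m md ->] _ IH]; first by rewrite vge0.
apply: (vgeD dE) => //; rewrite -[a *: _]/(a * _) -[- _]add0r; apply: (vgeM dE).
  by apply/(mem_vge dE); exact: (pt_const cd pE.1).
rewrite -md /mdegree /monomial; elim: (index_enum _) => [|j r IHr].
  by rewrite !big_nil mulr0n oppr0; apply/(mem_vge dE); exact: subring1 (pt_subring cd pE.1).
rewrite !big_cons mulrnDr opprD; apply: (vgeM dE) => //.
by rewrite -mulNrn; apply: (vgeX dE); exact: (vge_x cd normal).
Qed.

Section Construction.
Variables (f : dominantEndo X) (deg : nat) (H H' : set X -> int) (c : nat).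
Hypotheses (hdeg : has_degree f deg) (cop : coprime deg p).
Hypotheses (lH : locally_principal H) (pH : pullback f H H').
Hypothesis saH' : sa (fun E => H' E *+ c - B E).

Let phi : {rmorphism X -> X} := comorph f.
Let phi_const a : R0 a -> phi a = a.
Proof. by move=> [b _ <-]; exact: comorph_const. Qed.
Let dom O : pt O -> exists2 O', pt O' & local_hom phi O O'.
Proof.
by rewrite -pointsE => ptO; have [O' ptO' h] := comorph_point f ptO; exists O'.
Qed.

(** [pullback] chooses an equation of H separately for each E. Two equations at E' differ by a unit
    of E', and its image is a unit of E. *)
Lemma pullback_local O1 h U E E' : h != 0 -> zopen R0 x U -> U O1 ->
  (forall E, U E -> pdiv E -> H E = vord E h) -> pdiv E -> pt E' -> local_hom phi E E' ->
  O1 `<=` E' -> H' E = vord E (phi h).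
Proof.
move=> h0 oU UO1 hU pE ptE' l OE'.
have [O [h1 [ptO l1 [h10 [U1 [oU1 U1O h1U]]] ->]]] := pH ((prime_divisorE E).2 pE).
rewrite pointsE in ptO; have oU1' := (open_inE U1).1 oU1.
have e : O = E' by apply: (local_hom_uniq cd ptO ptE' l1 l).
have ud (a b : X) (V W : set (set X)) : a != 0 -> b != 0 -> zopen R0 x V -> zopen R0 x W -> V E' -> W E' ->
    (forall E0, V E0 -> pdiv E0 -> H E0 = vord E0 a) -> (forall E0, W E0 -> pdiv E0 -> H E0 = vord E0 b) -> E' (a / b).
  move=> a0 b0 oV oW VE WE aV bW; apply: hartogs => // E0 pD ED.
  apply/(mem_vge (dvrE pD)); rewrite vge_eq ?mulf_neq0 ?invr_eq0 //.
  rewrite (vordM (dvrE pD)) ?invr_eq0 // (vordV (dvrE pD)) // -aV ?bW ?subrr //.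
    by apply: (zopen_sup oW WE) => //; exact: pD.1.
  by apply: (zopen_sup oV VE) => //; exact: pD.1.
have UE' : U E' by apply: (zopen_sup oU UO1).
have U1E' : U1 E' by rewrite -e.
have h1U' E0 : U1 E0 -> pdiv E0 -> H E0 = vord E0 h1 by move=> UD /prime_divisorE; exact: h1U.
have q1 := ud _ _ _ _ h10 h0 oU1' oU U1E' UE' h1U' hU.
have q2 := ud _ _ _ _ h0 h10 oU oU1' UE' U1E' hU h1U'.
have dE := dvrE pE; have un : unit_in E (phi (h1 / h)).
  split; first by rewrite fmorph_eq0 mulf_neq0 // invr_eq0.
    by case: (l _ q1).
  by rewrite -fmorphV invf_div; case: (l _ q2).
have -> : phi h1 = phi (h1 / h) * phi h by rewrite -rmorphM divfK.
rewrite (vordM dE); [by rewrite (vord_unit dE un) add0r|by case: un|by rewrite fmorph_eq0].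
Qed.

(** Write z = a / b in a chart. If y generates O(t (c H' - B)) at E and h is an equation of H at O1,
    then w = y^d phi(h)^(tcd) is a section of O(-dt B) above O1 and generates it at E. So w makes
    forms of degree dt regular above O1, and makes b x_i^(dt) a unit of E. *)
Lemma over_fractions E O1 : pdiv E -> pt O1 -> local_hom phi E O1 ->
  forall z, E z -> exists zt u, [/\ over phi O1 zt, over phi O1 u, unit_in E u & z * u = zt].
Proof.
move=> pE pt1 l z Ez; have dE := dvrE pE; have rR0 := cd_subring cd.
have [i AE] := pt_chart cd pE.1; have x0 := cd_neq0 cd i.
have := Ez; rewrite {1}(pt_chartE cd pE.1 AE) => -[a [b [Aa Ab nb zE]]].
have ub : unit_in E b by apply: nonunitsP; [exact: AE|move=> h; apply: nb].
have b0 : b != 0 by case: ub.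
have [da Fa] := Aa; have [db Fb] := Ab.
have [t [y [t0 [y0 gy vy]]]] := saH' pE.1.
have [h [U [h0 oU UO hU]]] := lH pt1.
pose d := (da + db)%N.
have dle e : (e <= d)%N -> (e <= d * t)%N by move=> ed; apply: leq_trans ed (leq_pmulr _ t0).
have Fa' := chartR_up rR0 (dle _ (leq_addr _ _)) Fa.
have Fb' := chartR_up rR0 (dle _ (leq_addl _ _)) Fb.
pose w := y ^+ d * phi h ^+ (t * c * d).
have wov F : forms x R0 (d * t) F -> over phi O1 (w * F).
  move=> FF; apply: (over_pdiv hartogs dom) => // E0 E' pE0 ptE' l0 OE'.
  have dE0 := dvrE pE0; apply/(mem_vge dE0).
  have hE : H' E0 = vord E0 (phi h) by exact: (pullback_local h0 oU UO hU pE0 ptE' l0 OE').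
  have v1 := vgeX dE0 d (gy E0 pE0).
  have v2 := vgeX dE0 (t * c * d) (vge_vord E0 (phi h)).
  have := vgeM dE0 (vgeM dE0 v1 v2) (forms_global FF pE0); apply: vge_le.
  by rewrite -hE !mnE !PoszM; lia.
exists (w * (a * x i ^+ (d * t))), (w * (b * x i ^+ (d * t))); split; [exact: wov|exact: wov| |].
  have hE : H' E = vord E (phi h) by exact: (pullback_local h0 oU UO hU pE pt1 l).
  have ph0 : phi h != 0 by rewrite fmorph_eq0.
  apply: (unit_vord dE); first by rewrite !mulf_neq0 ?expf_neq0.
  rewrite !(vordM dE) ?mulf_neq0 ?expf_neq0 // !(vordX dE) // (vord_unit dE ub) -hE vy //.
  have -> : vord E (x i) = - B E by apply/(Bdiv_chart cd normal i pE).
  by rewrite !mnE !PoszM; lia.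
by rewrite zE; field.
Qed.

Lemma exists_edata : exists t ff rho, edata phi t ff rho /\
  forall E, pdiv E -> H' E = fstar ff rho H E.
Proof.
have [b hb] := hdeg.
have [t [tD tphi t1 tp]] := exists_trace charp hb cop.
have [m [M [_ [MD Mphi M1 MM Minj]]]] := exists_rep hb.
have /choice[ff ffP] : forall O, exists O', pt O -> pt O' /\ local_hom phi O O'.
  move=> O; have [/dom[O' ptO' l]|h] := pselect (pt O); first by exists O'.
  by exists O.
have ffd E : pdiv E -> pdiv (ff E).
  move=> pE; have [ptE' l] := ffP E pE.1.
  by apply: (dim1_image nX hartogs charp phi_const dom MD Mphi M1 MM Minj pE ptE' l); exact: over_fractions.
have /choice[pi piP] : forall E, exists u, pdiv E -> u != 0 /\ vord (ff E) u = 1.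
  move=> E; have [pE|h] := pselect (pdiv E); last by exists 0.
  by have [u u0 vu] := exists_vord (dvrE (ffd E pE)) 1; exists u.
have rhoE E z : pdiv E -> z != 0 -> vord E (phi z) = vord E (phi (pi E)) * vord (ff E) z.
  move=> pE z0; have dE := dvrE pE; have dE' := dvrE (ffd E pE).
  have [u0 vu] := piP E pE; have [_ l] := ffP E pE.1.
  pose n := vord (ff E) z; pose r := z / pi E ^ n.
  have pn : pi E ^ n != 0 by rewrite expfz_neq0.
  have r0 : r != 0 by rewrite mulf_neq0 // invr_eq0.
  have ur : unit_in (ff E) r.
    apply: (unit_vord dE') => //; rewrite (vordM dE') ?invr_eq0 // (vordV dE') //.
    by rewrite (vordXz dE') // vu mul1r subrr.
  have ur' : unit_in E (phi r).
    have [_ rE rE'] := ur; split; first by rewrite fmorph_eq0.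
      by case: (l _ rE).
    by rewrite -fmorphV; case: (l _ rE').
  have -> : z = r * pi E ^ n by rewrite /r divfK.
  rewrite rmorphM (vordM dE) ?fmorph_eq0 // (vord_unit dE ur') add0r rmorphXz ?unitfE //.
  rewrite (vordXz dE) ?fmorph_eq0 //; congr (_ * _).
  by rewrite (vordM dE') // (vord_unit dE' ur) add0r (vordXz dE') // vu mul1r.
exists t, ff, (fun E => vord E (phi (pi E))); split.
  split=> // E pE; have [u0 vu] := piP E pE; have [_ l] := ffP E pE.1.
  rewrite -vge_eq ?fmorph_eq0 //; apply/(mem_vge (dvrE pE)).
  have h : ff E (pi E) by apply/(mem_vge (dvrE (ffd E pE))); rewrite vge_eq // vu.
  by case: (l _ h).
move=> E pE; have [ptE' l] := ffP E pE.1; have [h [U [h0 oU UO hU]]] := lH ptE'.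
rewrite (pullback_local h0 oU UO hU pE ptE' l) // rhoE // /fstar -hU //.
exact: ffd.
Qed.
End Construction.

Section EData.
Variables (phi : {rmorphism X -> X}) (t : X -> X) (ff : set X -> set X) (rho : set X -> int).
Hypothesis ed : edata phi t ff rho.
Let dom O : pt O -> exists2 O', pt O' & local_hom phi O O'.
Proof. by move=> /(ed_pt ed)[]; exists (ff O). Qed.

Lemma ff_mono O E : pt O -> pdiv E -> O `<=` E -> ff O `<=` ff E.
Proof.
move=> ptO pE OE; have [p1 l1] := ed_pt ed ptO; have [p2 l2] := ed_pt ed pE.1.
exact: (local_hom_mono cd ptO pE.1 p1 p2 OE l1 l2).
Qed.

Lemma sa_fstar N : sa N -> sa (fstar ff rho N).
Proof.
move=> saN O ptO; have [pt1 _] := ed_pt ed ptO; have [m [s [m0 [s0 gs vs]]]] := saN _ pt1.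
exists m, (phi s); split=> //; split=> [|E pE|E pE OE]; first by rewrite fmorph_eq0.
  rewrite vge_eq ?fmorph_eq0 // (ed_rho ed pE s0) /fstar -mulrnAr -mulrN.
  by apply: ler_wpM2l; [exact: (ed_rho0 ed)|rewrite -vge_eq //; apply: gs; exact: (ed_pdiv ed)].
rewrite (ed_rho ed pE s0) vs; [by rewrite mulrN mulrnAr|exact: (ed_pdiv ed)|exact: ff_mono].
Qed.

Lemma fsupp_fstar N : fsupp N -> fsupp (fstar ff rho N).
Proof.
move=> fN; have /choice[pi piP] : forall E1, exists u, pdiv E1 -> u != 0 /\ vord E1 u = 1.
  move=> E1; have [pE|h] := pselect (pdiv E1); last by exists 0.
  by have [u u0 vu] := exists_vord (dvrE pE) 1; exists u.
apply: (@sub_finite_set _ _ (\bigcup_(E1 in [set E | pdiv E /\ N E != 0])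
    [set E | pdiv E /\ vord E (phi (pi E1)) != 0])); last first.
  apply: bigcup_finite => // E1 [pE1 _]; apply: (finite_div cd normal).
  by rewrite fmorph_eq0; case: (piP E1 pE1).
move=> E [pE h]; exists (ff E); split=> //.
- exact: (ed_pdiv ed).
- by apply: contraNneq h => e; rewrite /fstar e mulr0.
have [u0 vu] := piP _ (ed_pdiv ed pE); rewrite (ed_rho ed pE u0) vu mulr1.
by apply: contraNneq h => e; rewrite /fstar e mul0r.
Qed.

(* The powers of y have bounded denominators over E1, so that the valuations of
   t(y)^(p^s) = t(y^(p^s)) are bounded below. *)
Lemma trace_in E1 y : pdiv E1 -> (forall E, pdiv E -> ff E = E1 -> E y) -> E1 (t y).
Proof.
move=> pE1 Hy; have dE := dvrE pE1.
have oy : over phi E1 y.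
  apply: (over_pdiv hartogs dom pE1.1) => E E' pE ptE' l E1E'; apply: Hy => //.
  have [ptf lf] := ed_pt ed pE.1.
  rewrite (local_hom_uniq cd ptE' ptf l lf) in E1E'.
  by apply/esym; apply: (pdiv_eq cd normal pE1 _ E1E'); exact: (ed_pdiv ed).
have [ns nsP] := integral_over_pt cd (ed_const ed) dom pE1.1 oy.
have [N NP] := exists_vbound E1 [seq t n | n <- ns].
have t0 : t 0 = 0 by have := ed_semi ed 0 0; rewrite mulr0 mul0r.
have bnd l : vge E1 (- N%:Z) (t (y ^+ l)).
  elim: (nsP l) => [|a n z [b Eb <-] nns _ IH]; first by rewrite t0 vge0.
  rewrite (ed_add ed); apply: (vgeD dE) => //; rewrite -[phi b *: n]/(phi b * n) (ed_semi ed) -[- _]add0r.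
  apply: (vgeM dE); first exact/(mem_vge dE).
  by apply: NP; apply/mapP; exists n.
have tX s : t (y ^+ (p ^ s)) = t y ^+ (p ^ s).
  by elim: s => // s IH; rewrite expnSr !exprM (ed_frob ed) IH.
apply/(mem_vge dE); have [->|c0] := eqVneq (t y) 0; first by rewrite vge0.
rewrite vge_eq // leNgt; apply/negP => vc.
have := bnd (p ^ N)%N; rewrite tX vge_eq ?expf_neq0 // (vordX dE) // mnE.
have sp : (N < p ^ N)%N by apply: ltn_expl; apply: prime_gt1; case/andP: charp.
have h2 : 0 <= (- 1 - vord E1 (t y)) * (p ^ N)%N%:Z by apply: mulr_ge0 => //; lia.
by move: sp h2; rewrite mulrBl mulN1r; lia.
Qed.
End EData.

Lemma edata_comp phi t ff rho phi' t' ff' rho' :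
  edata phi t ff rho -> edata phi' t' ff' rho' ->
  edata (phi \o phi')%FUN (fun z => t' (t z)) (fun E => ff' (ff E))
    (fun E => rho E * rho' (ff E)).
Proof.
move=> e e'; split=> [y z|a y||y|a Ra|O ptO|E pE|E pE|E z pE z0].
- by rewrite (ed_add e) (ed_add e').
- by rewrite /= (ed_semi e) (ed_semi e').
- by rewrite (ed_one e) (ed_one e').
- by rewrite (ed_frob e) (ed_frob e').
- by rewrite /= (ed_const e' Ra) (ed_const e Ra).
- have [p1 l1] := ed_pt e ptO; have [p2 l2] := ed_pt e' p1; split=> // z /l2[h u].
  by have [h' u'] := l1 _ h; split=> // /u' /u.
- exact/(ed_pdiv e')/(ed_pdiv e).
- by apply: mulr_ge0; [exact: (ed_rho0 e)|apply: (ed_rho0 e'); exact: (ed_pdiv e)].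
rewrite /= (ed_rho e pE) ?fmorph_eq0 // (ed_rho e') //; last exact: (ed_pdiv e).
by rewrite mulrA.
Qed.

Lemma edata_id : edata idfun id id (fun=> 1).
Proof.
by split=> // E z pE z0; rewrite mul1r.
Qed.

Lemma sa0 : sa (fun=> 0).
Proof.
move=> O ptO; exists 1%N, 1; split=> //; split=> [|E pE|E pE _]; first exact: oner_neq0.
  by rewrite mul0rn oppr0; apply/(mem_vge (dvrE pE)); exact: subring1 (pt_subring cd pE.1).
by rewrite mul0rn oppr0 (vord1 (dvrE pE)).
Qed.

Section Positivity.
Variables (phi : {rmorphism X -> X}) (t : X -> X) (ff : set X -> set X) (rho : set X -> int).
Hypothesis ed : edata phi t ff rho.
Variables (A H : set X -> int) (a b c : nat).
Hypotheses (a0 : (0 < a)%N) (b0 : (0 < b)%N) (c0 : (0 < c)%N).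
Hypothesis saAH : sa (fun E => A E *+ a - H E).
Hypothesis saHB : sa (fun E => H E *+ b - B E).
Hypothesis saH : sa (fun E => fstar ff rho H E *+ c - H E *+ c.+1).

(** Iterates the inequality f^* H >= (1 + 1/c) H, with denominators cleared. *)
Lemma sa_iter m : exists phi' t' ff' rho', edata phi' t' ff' rho' /\
  sa (fun E => fstar ff' rho' H E *+ (c ^ m) - H E *+ (c.+1 ^ m)).
Proof.
elim: m => [|m [phi' [t' [ff' [rho' [e' sam]]]]]].
  exists idfun, id, id, (fun=> 1); split; first exact: edata_id.
  apply: (sa_ext _ sa0) => E _; by rewrite /fstar mul1r subrr.
exists (phi' \o phi)%FUN, (fun z => t (t' z)), (fun E => ff (ff' E)), (fun E => rho' E * rho (ff' E)).
split; first exact: edata_comp.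
have s1 := saMn cd normal (c ^ m) (sa_fstar e' saH).
have s2 := saMn cd normal c.+1 sam.
apply: (sa_ext _ (saD cd normal s1 s2)) => E _.
by rewrite /fstar !mnE !expnS !PoszM; ring.
Qed.

(** Bernoulli's inequality [bern] makes ((c + 1) / c)^m exceed a b Q for m = cK. Modulo semiample
    divisors, the pull-back of A dominates that of H divided by a, which dominates H times ((c + 1)
    / c)^m / a, and H dominates B / b. *)
Lemma exists_positive Q : exists phi' t' ff' rho', edata phi' t' ff' rho' /\
  sa (fun E => fstar ff' rho' A E - B E *+ Q).
Proof.
have bern m : (c ^ m * (c + m) <= c * c.+1 ^ m)%N.
  elim: m => [|m IH]; first by rewrite !expn0; lia.
  by rewrite !expnS; move: (c ^ m)%N (c.+1 ^ m)%N IH => r s IH; nia.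
pose K := (a * b * Q)%N; pose m := (c * K)%N.
have big : (a * b * c ^ m * Q <= c.+1 ^ m)%N.
  rewrite -(leq_pmul2l c0); apply: leq_trans (bern m).
  rewrite /m (_ : c * (a * b * c ^ (c * K) * Q) = c ^ (c * K) * (c * K))%N; last by rewrite /K; ring.
  by rewrite leq_mul2l leq_addl orbT.
have [phi' [t' [ff' [rho' [e' sam]]]]] := sa_iter m.
exists phi', t', ff', rho'; split=> //.
have s1 := saMn cd normal (b * c ^ m) (sa_fstar e' saAH).
have s2 := saMn cd normal b sam.
have s3 := saMn cd normal (c.+1 ^ m) saHB.
have s4 := sa_BMn cd normal (c.+1 ^ m - a * b * c ^ m * Q) (saD cd normal (saD cd normal s1 s2) s3).
have k0 : (0 < a * b * c ^ m)%N by rewrite !muln_gt0 a0 b0 expn_gt0 c0.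
apply: (sa_div k0); apply: (sa_ext _ s4) => E _.
rewrite /fstar !mnE -subzn // !PoszM; ring.
Qed.
End Positivity.
End Pullback.

Theorem theorem4 (k : fieldType) (p : nat) (X : projVariety k)
    (f : dominantEndo X) (deg : nat) :
  perfect_of_char k p ->
  fano X ->
  int_amplified f ->
  has_degree f deg ->
  coprime deg p ->
  strongly_F_regular X p ->
  globally_F_regular p (points X).
Proof.
move=> perf [nX [C canC [_ [m0 m0_gt0 aC]]]] [H [H' [aH pH aHH]]] hdeg cop SF D wD eD.
have charp := pchar_funField perf X.
pose R0 := @consts k X; pose x := @coordX k X.
have cd : chart_data R0 x := chart_dataX X; have normal := normalE nX.
have hartogs := fun O z => @strong_hartogs k p X nX O z SF.
have [wC [n [d [w [ud w0 loc]]]]] := canC.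
have dD := univ_dD ud; have dM := univ_dM ud.
have [t0 W0] := ex_wedge_neq0 ud; have sp0 := pspan_wedge perf ud W0.
pose T := tau p d t0 w.
have TD := iter_tauD charp dD dM w W0 sp0.
have TZ := iter_tauZ charp dD dM W0 sp0 w0.
have Tlin := @linear_iter_tau _ _ _ charp _ dD dM _ _ W0 sp0 w0.
have coord E : pdiv R0 x E -> exists u g, [/\ local_coordinates d E u, w = g * wedge d u & C E = vord E g].
  by move=> /prime_divisorE/loc[u [g [? ? ?]]]; exists u, g.
have Tdual E e (m : int) z : pdiv R0 x E ->
    vge E (- C E - m *+ (p ^ e)) z <-> forall a, E a -> vge E (- C E - m) (iter e T (a * z)).
  move=> pE; have [u [g [[uE Wu duE] wE ->]]] := coord E pE.
  exact: (tau_dual charp dD dM W0 sp0 w0 (pdiv_dvr cd normal pE) (pt_subring cd pE.1) (normal E pE.1)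
    Wu (pspan_wedge perf ud Wu) wE uE duE).
have fC := weil_fsupp wC; have fD := weil_fsupp wD.
have D0 E : pdiv R0 x E -> 0 <= D E.
  by move=> pE; apply: eD; [rewrite pointsE; exact: pE.1|exact/prime_divisorE].
have split_charts := chart_splitting nX SF charp TD TZ Tdual Tlin fC.
have [e1 [g1 [e1_gt0 g1P]]] := split_charts (fun=> 0) (fsupp0 R0 x) (fun _ _ => lexx 0).
(* M1 is fixed here, before the iterate phi is chosen to exceed it; D' and its splittings [g2] come
   afterwards. *)
have [M1 lift] := lift_form cd normal hartogs charp TD TZ Tdual fC e1_gt0 g1P.
have [cH _] := aH; have fH := weil_fsupp cH.1; have lH := cartier_principal cH.
have fB := fsupp_Bdiv cd normal; have lB := principal_B nX.
have [c1 c1_gt0 sa1] := ample_sub nX aHH fB lB.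
(* Positivity of f^* H, the sum of H' - H and H; through [over_fractions] it stands for the
   finiteness of f. *)
have saH' : sa R0 x (fun E => H' E *+ c1 - Bdiv x E).
  apply: (sa_ext _ (saD cd normal sa1 (saMn cd normal c1 (sa_ample aH)))) => E _.
  have -> : (H' - H) E = H' E - H E by [].
  by rewrite mulrnBl; lia.
have [t [ff [rho [ed HE]]]] := exists_edata nX hartogs charp hdeg cop lH pH saH'.
have [c2 c2_gt0 sa2] := ample_sub nX aHH fH lH.
have saH : sa R0 x (fun E => fstar ff rho H E *+ c2 - H E *+ c2.+1).
  apply: (sa_ext _ sa2) => E pE; have -> : (H' - H) E = H' E - H E by [].
  by rewrite HE // mulrnBl mulrSr; lia.
have [a a_gt0 sa3] := ample_sub nX aC fH lH.
have saA : sa R0 x (fun E => - C E *+ (m0 * a) - H E).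
  by apply: (sa_ext _ sa3) => E _; rewrite mulrn_fctE -mulrnA.
have [b b_gt0 saB] := ample_sub nX aH fB lB.
have ma_gt0 : (0 < m0 * a)%N by rewrite muln_gt0 m0_gt0.
have [phi [t' [ff' [rho' [ed' saL]]]]] :=
  exists_positive nX charp ed ma_gt0 b_gt0 c2_gt0 saA saB saH M1.
pose L := fstar ff' rho' (fun E => - C E).
have dvrE E : pdiv R0 x E -> dvr E by exact: pdiv_dvr.
pose j := ramif d t0 w phi.
have j0 : j != 0.
  exact: (ramif_neq0 charp dD dM W0 sp0 w0 (ed_add ed') (ed_semi ed') (ed_one ed') (ed_frob ed')).
have jge E : pdiv R0 x E -> - C E + rho' E * C (ff' E) <= vord E j.
  move=> pE; have pE1 := ed_pdiv ed' pE; have [_ l] := ed_pt ed' pE.1.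
  have [u [g [[uE Wu duE] wE ->]]] := coord E pE.
  have [u1 [g1' [[u1E Wu1 duE1] w1E ->]]] := coord _ pE1.
  have g1n : g1' != 0 by apply: contraNneq w0 => g0; rewrite w1E g0 mul0r.
  rewrite -(vge_eq E _ j0) -(ed_rho ed' pE g1n).
  apply: (ramif_ge charp dD dM W0 w0 (dvrE E pE) (pt_subring cd pE.1) _ Wu wE Wu1
    (pspan_wedge perf ud Wu1) w1E duE u1E) => z Ez.
  by case: (l z Ez).
have jL : global R0 x (fun E => C E + L E) j.
  by move=> E pE; rewrite vge_eq //; have := jge E pE; rewrite /L /fstar mulrN; lia.
(* With this choice, dividing a section of O(C + p^e L - D') by j leaves a section of the pull-back
   of [Ksec p C e D], which the trace maps to a section downstairs. *)
pose D' E := (vord E j + C E - rho' E * C (ff' E)) + fstar ff' rho' D E.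
have fD' : fsupp R0 x D'.
  have fj : fsupp R0 x (fun E => vord E j) by exact: finite_div.
  have fs N := @fsupp_fstar _ _ _ nX _ _ _ _ ed' N.
  apply: (fsupp_ext _ (fsupp_comb 1 1 (fsupp_comb 1 1 fj fC)
    (fsupp_comb (-1) 1 (fs _ fC) (fs _ fD)))) => E _.
  by rewrite /D' {1}/fstar !mul1r mulN1r; lia.
have D'0 E : pdiv R0 x E -> 0 <= D' E.
  move=> pE; apply: addr_ge0; first by have := jge E pE; lia.
  by apply: mulr_ge0; [exact: (ed_rho0 ed')|apply: D0; exact: (ed_pdiv ed')].
have [e2 [g2 [e2_gt0 g2P]]] := split_charts D' fD' D'0.
have fL : fsupp R0 x L.
  by apply: (fsupp_fstar nX ed'); apply: sub_finite_set fC => E [pE]; rewrite oppr_eq0.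
have [e [kap [e_gt0 kG kj]]] := lift L D' j e2 g2 fL fD' saL jL e2_gt0 g2P.
(* The factors j and j^-1 of consecutive steps cancel. *)
have tT s y : iter s T (t' y) = t' (j^-1 * iter s T (j * y)).
  elim: s y => [|s IH] y; first by rewrite /= mulKf.
  rewrite !iterSr [T (t' y)](tau_trace charp dD dM W0 sp0 w0 (ed_add ed') (ed_semi ed')
    (ed_one ed') (ed_frob ed')) -/j IH.
  by rewrite mulVKf.
exists e => //; apply: (splits_of_section nX SF charp TD TZ Tdual (h := t' (j^-1 * kap))) => //.
  move=> E1 _ pE1; have dE1 := dvrE E1 pE1.
  (* Multiplication by c, an equation of [Ksec] at E1, reduces the bound on the order to regularity
     at E1; c enters the trace as phi c and [trace_in] applies. *)
  have [c c0 vc] := exists_vord dE1 (Ksec p C e D E1).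
  suff : E1 (c * t' (j^-1 * kap)).
    move/(mem_vge dE1); rewrite mulrC -(addNr (Ksec p C e D E1)) -{2}vc.
    by rewrite (vge_shift dE1 _ _ c0).
  rewrite -(ed_semi ed'); apply: (trace_in nX hartogs charp ed' pE1) => E pE fE.
  have dE := dvrE E pE; apply/(mem_vge dE).
  have v1 : vge E (rho' E * Ksec p C e D E1) (phi c).
    by rewrite vge_eq ?fmorph_eq0 // (ed_rho ed' pE c0) fE vc.
  have v2 : vge E (- vord E j) j^-1 by rewrite vge_eq ?invr_eq0 // (vordV dE).
  have := vgeM dE v1 (vgeM dE v2 (kG E pE)); apply: vge_le.
  rewrite /Ksec /D' /L /fstar fE !mulrBr mulrN mulrnAr mulNrn; lia.
by rewrite tT mulVKf // kj mulVf // (ed_one ed').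
Qed.
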